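(* Let $a,b>0$ be constants with $a+b<\tfrac12$. There exists $\varepsilon_0>0$ such that for every fixed $0<\varepsilon<\varepsilon_0$ the following holds. Let $n\to\infty$ and let $\boldsymbol{s}=(s_1,\dots,s_n)$, $\boldsymbol{t}=(t_1,\dots,t_n)$ be vectors of positive integers with equal sums such that uniformly $s_j-s=O(n^{1/2+\varepsilon})$ and $t_k-s=O(n^{1/2+\varepsilon})$, and $\frac{(1-2\lambda)^2}{3A}\le a\log n$. Then the expected permanent of a uniformly random $n\times n$ matrix over $\{0,1\}$ with row sums $\boldsymbol{s}$ and column sums $\boldsymbol{t}$ is \[ n!\,\lambda^n\exp\Bigl(\frac{1-\lambda}{2\lambda}-\frac{R+C}{2\lambda^2n^2}+O(n^{-b})\Bigr).\]
   Context: $s=n^{-1}\sum_js_j=n^{-1}\sum_kt_k$, $\lambda=s/n$, $A=\tfrac12\lambda(1-\lambda)$, $R=\sum_{j=1}^n(s_j-s)^2$, $C=\sum_{k=1}^n(t_k-s)^2$. The random matrix is uniformly distributed over all $n\times n$ 0-1 matrices with these row and column sums. Asymptotic notation refers to $n\to\infty$. (The hypotheses are those of the paper's main enumeration theorem with $m=n$, in which case the density condition $\frac{(1-2\lambda)^2}{8A}(1+\frac{5m}{6n}+\frac{5n}{6m})\le a\log n$ becomes $\frac{(1-2\lambda)^2}{3A}\le a\log n$.) *)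

(* Defs.v *)
From HB Require Import structures.
From mathcomp Require Import all_boot all_order all_algebra all_fingroup.
From mathcomp Require Import all_classical all_reals all_analysis.
Set Implicit Arguments. Unset Strict Implicit. Unset Printing Implicit Defensive.
Import Order.TTheory GRing.Theory Num.Theory.
Local Open Scope ring_scope.

Definition zo_mats (n : nat) (s t : 'I_n -> nat) : {set 'M[bool]_n} :=
  [set M : 'M[bool]_n | [forall i, (\sum_(j < n) (M i j : nat))%N == s i]
                     && [forall j, (\sum_(i < n) (M i j : nat))%N == t j]].

Definition perm01 (n : nat) (M : 'M[bool]_n) : nat :=
  (\sum_(sg : 'S_n) \prod_(i < n) (M i (sg i) : nat))%N.

Definition expected_perm (R : realType) (n : nat) (s t : 'I_n -> nat) : R :=
  (\sum_(M in zo_mats s t) ((perm01 M)%:R : R)) / (#|zo_mats s t|)%:R.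

Definition avg (R : realType) (n : nat) (s : 'I_n -> nat) : R :=
  ((\sum_(j < n) s j)%N)%:R / n%:R.

Definition sqdev (R : realType) (n : nat) (s : 'I_n -> nat) (s0 : R) : R :=
  \sum_(j < n) ((s j)%:R - s0) ^+ 2.

(* Main.v *)
(** Let s be the common mean of the row and column sums and lambda = s / n.
    Rescale a matrix M to n s M_ij / (s_i t_j) = 1 + U_ij, which multiplies the
    permanent by an explicit factor.  With q = n^o(1), all but a
    super-polynomially small proportion of the matrices M give a "flat" U: its
    entries, row sums and column sums are at most q, and distinct rows and
    distinct columns have inner products at most T = q sqrt n.

    For flat U the permanent is determined to high precision.  Put
    f(theta) = per(1 + theta U), so that f' = sum_ij U_ij P_ij where P_ij sums over
    the permutations mapping i to j.  Expanding along rows and columns contracts the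
    error in P_ij P_i'k = (1 + theta (U_ij + U_i'k - U_ik - U_i'j) / n) P_ik P_i'j,
    because two rows (or columns) of 1 + theta U share a proportion at least 1 / (2 q) of
    their mass; iterating gives an error q^O(1) T / n^2.  Summing over all the cells,
    f'/f = sum U / n + theta sum U^2 / n^2 + O(q^O(1) T / n), and Gronwall's
    inequality gives per(1 + U) = n! exp(sum U / n + sum U^2 / (2 n^2) + O(n^(o(1) - 1/2))).

    Flatness of a random U comes from switchings: exchanging one element of a row
    against another changes the number of completions by a factor 1 + o(1), which
    bounds the logarithmic derivative of the moment generating function of any
    linear statistic of the row.  The estimate also holds for the matrices that contain
    the graph of a given permutation, so the exceptional M contribute a negligible
    share of the sum of the permanents as well as of the number of matrices. *)

Require Import Defs.
From HB Require Import structures.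
From mathcomp Require Import all_boot all_order all_algebra all_fingroup.
From mathcomp Require Import ring lra zify.
Import Order.TTheory GRing.Theory Num.Theory.
Local Open Scope ring_scope.
Set Implicit Arguments. Unset Strict Implicit. Unset Printing Implicit Defensive.

(** * Partial permanents *)

(** What dictates two levels of comparison is the final summation. The contraction of single ratios
    P_ij / P_ik stalls at relative error q^O(1) / n, because the line sums of the weights are known
    only up to q^O(1); summed over n^2 cells this is too coarse. In cross ratios the factors that
    depend on one row or on one column cancel, and the contraction then reaches an error of order
    q^O(1) T / n^2. The row and column factors left in P_ij are harmless, since they are paired with
    the small line sums of U. Every contraction step prescribes further cells, so the estimates are
    stated for permanents with a list of prescribed cells; the number of steps, about q^2 log n,
    must keep this list below q^4. A contraction only shrinks an oscillation that is already finite.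
    Entries of 1 + theta U may vanish, so even finiteness needs an argument: a comparison of
    permutations by 3-cycles, with a loss of q^O(1). *)

Lemma le_of_eq (R : numDomainType) (x y : R) : x = y -> x <= y.
Proof. by move->. Qed.

Lemma sum_le_const (R : numDomainType) (n : nat) (F : 'I_n -> R) (c : R) :
  (forall i, F i <= c) -> \sum_i F i <= n%:R * c.
Proof.
move=> h; apply: le_trans (_ : \sum_(i < n) c <= _); first exact: ler_sum.
by rewrite sumr_const card_ord mulr_natl.
Qed.

Lemma norm_sum_le_const (R : numDomainType) (n : nat) (F : 'I_n -> R) (c : R) :
  (forall i, `|F i| <= c) -> `|\sum_i F i| <= n%:R * c.
Proof. by move=> h; apply: le_trans (ler_norm_sum _ _ _) _; exact: sum_le_const. Qed.

Section PartialPermanent.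
Variables (R : realFieldType) (n : nat).
Implicit Types (W : 'I_n -> 'I_n -> R) (rho : seq ('I_n * 'I_n)) (sg : 'S_n).

Definition extends rho sg := all (fun e => sg e.1 == e.2) rho.

(* The cells of rho are prescribed but carry no weight. *)
Definition pm W rho : R :=
  \sum_(sg : 'S_n | extends rho sg) \prod_(i | i \notin unzip1 rho) W i (sg i).

Definition injpairs rho := uniq (unzip1 rho) && uniq (unzip2 rho).

Lemma pm_nil W : pm W [::] = \sum_(sg : 'S_n) \prod_i W i (sg i).
Proof. by apply: eq_big => [sg|sg _]. Qed.

Lemma pm_ge0 W rho : (forall i j, 0 <= W i j) -> 0 <= pm W rho.
Proof. by move=> W0; apply: sumr_ge0 => sg _; apply: prodr_ge0. Qed.

Lemma eq_pm W rho rho' : perm_eq rho rho' -> pm W rho = pm W rho'.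
Proof.
move=> e; apply: eq_big => [sg|sg _]; first by rewrite /extends (perm_all _ e).
by apply: eq_bigl => i; rewrite (perm_mem (perm_map fst e)).
Qed.

Lemma extends_col rho sg i : extends rho sg -> i \notin unzip1 rho ->
  sg i \notin unzip2 rho.
Proof.
move=> /allP ext; apply: contra => /mapP[[a b] /= ab e].
by have /= /eqP := ext _ ab; rewrite -e => /perm_inj <-; apply/mapP; exists (a, b).
Qed.

Lemma extends_row rho sg i : extends rho sg -> sg i \notin unzip2 rho ->
  i \notin unzip1 rho.
Proof.
move=> /allP ext; apply: contra => /mapP[[a b] /= ab e].
by have /= /eqP := ext _ ab; rewrite -e => ->; apply/mapP; exists (a, b).
Qed.

Lemma pm_cons_term W rho i j sg : i \notin unzip1 rho -> sg i = j ->
  \prod_(a | a \notin unzip1 rho) W a (sg a) =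
  W i j * \prod_(a | a \notin unzip1 ((i, j) :: rho)) W a (sg a).
Proof.
move=> ir e; rewrite (bigD1 i) //= e; congr (_ * _); apply: eq_bigl => a.
by rewrite inE negb_or andbC.
Qed.

Lemma pm_row W rho i : i \notin unzip1 rho ->
  pm W rho = \sum_(j | j \notin unzip2 rho) W i j * pm W ((i, j) :: rho).
Proof.
move=> ir; rewrite /pm (partition_big (fun sg : 'S_n => sg i) (fun j => j \notin unzip2 rho)) /=.
  apply: eq_bigr => j jr; rewrite mulr_sumr; apply: eq_big => [sg|sg].
    by rewrite /extends /= andbC.
  by case/andP=> _ /eqP e; apply: pm_cons_term.
by move=> sg ext; apply: extends_col.
Qed.

Lemma pm_col W rho j : j \notin unzip2 rho ->
  pm W rho = \sum_(i | i \notin unzip1 rho) W i j * pm W ((i, j) :: rho).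
Proof.
move=> jr; rewrite /pm
  (partition_big (fun sg : 'S_n => (sg^-1)%g j) (fun i => i \notin unzip1 rho)) /=.
  apply: eq_bigr => i ir; rewrite mulr_sumr; apply: eq_big => [sg|sg].
    by rewrite /extends /= andbC; congr andb; apply/eqP/eqP => [<-|<-]; rewrite ?permKV ?permK.
  by case/andP=> _ /eqP e; apply: pm_cons_term => //; rewrite -e permKV.
by move=> sg ext; apply: (extends_row ext); rewrite permKV.
Qed.

(** Prescribed cells carry no weight, so only the rows and columns they use matter; [tperm a b]
    realises the exchange. This is what lets two different partial permanents be expanded over the
    same family. *)
Lemma pm_swap W rho a b j k : a != b -> a \notin unzip1 rho -> b \notin unzip1 rho ->
  pm W ((a, j) :: (b, k) :: rho) = pm W ((a, k) :: (b, j) :: rho).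
Proof.
move=> ab ar br; rewrite /pm (reindex_inj (mulgI (tperm a b))) /=.
have fixr x : x \notin [:: a, b & unzip1 rho] -> tperm a b x = x.
  by rewrite !inE !negb_or => /and3P[xa xb _]; rewrite tpermD // eq_sym.
apply: eq_big => [sg|sg _].
  rewrite /= !permM tpermL tpermR andbCA; congr [&& _, _ & _].
  apply: eq_in_all => -[c d] /= cd; rewrite permM tpermD //.
    by apply: contra ar => /eqP->; apply/mapP; exists (c, d).
  by apply: contra br => /eqP->; apply/mapP; exists (c, d).
by apply: eq_bigr => c cr; rewrite permM fixr.
Qed.

(** Inversion of the permutation. Row estimates for [tr U] become column estimates for [U], so only
    one kind has to be proved. *)
Lemma pm_tr W rho :
  pm (fun i j => W j i) [seq (e.2, e.1) | e <- rho] = pm W rho.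
Proof.
rewrite /pm (reindex_inj invg_inj) /=.
have ext sg : extends [seq (e.2, e.1) | e <- rho] sg^-1 = extends rho sg.
  rewrite /extends all_map; apply: eq_all => -[a b] /=.
  by apply/eqP/eqP => <-; rewrite ?permKV ?permK.
apply: eq_big => // sg; rewrite ext => e.
rewrite (reindex_inj (@perm_inj _ sg)) /=.
have -> : unzip1 [seq (e0.2, e0.1) | e0 <- rho] = unzip2 rho by rewrite /unzip1 -map_comp.
apply: eq_big => [i|i _]; last by rewrite permK.
by apply/idP/idP => [/(extends_row e)//|/(extends_col e)].
Qed.

Lemma injpairs_tr rho : injpairs [seq (e.2, e.1) | e <- rho] = injpairs rho.
Proof. by rewrite /injpairs andbC /unzip1 /unzip2 -!map_comp. Qed.

Lemma injpairs_cons rho i j : injpairs ((i, j) :: rho) =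
  [&& i \notin unzip1 rho, j \notin unzip2 rho & injpairs rho].
Proof. by rewrite /injpairs /=; do !case: (_ \notin _) => //=; rewrite ?andbF. Qed.

Lemma sum_notin (F : 'I_n -> R) (l : seq 'I_n) : uniq l ->
  \sum_(i | i \notin l) F i = \sum_i F i - \sum_(i <- l) F i.
Proof.
move=> ul; rewrite [X in _ = X - _](bigID (mem l)) /= -big_uniq //=.
by rewrite addrAC subrr add0r.
Qed.

End PartialPermanent.

(** * Averages of one function under overlapping weights *)

Section Contraction.
Variables (R : realFieldType) (I : finType) (A : pred I).

(* The weights w and v agree on a mass O, so only the remaining mass sees the oscillation of x. *)
Lemma overlap_contraction (w v x : I -> R) (m m' O Sw Sv : R) : 0 <= m -> 0 <= m' ->
  (forall a, A a -> 0 <= w a) -> (forall a, A a -> 0 <= v a) ->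
  (forall a, A a -> 0 <= x a) ->
  (forall a b, A a -> A b -> x a <= (1 + m) * x b) ->
  \sum_(a | A a) w a <= Sw -> Sv <= \sum_(a | A a) v a ->
  O <= \sum_(a | A a) Num.min (w a) (v a) ->
  m * (Sw - O) + Sw - Sv <= m' * Sv ->
  \sum_(a | A a) w a * x a <= (1 + m') * \sum_(a | A a) v a * x a.
Proof.
move=> m0 m'0 w0 v0 x0 xm hw hv hO h.
have [a0 Aa0|noA] := pickP A; last by rewrite !big_pred0 // mulr0.
case: (arg_minP x Aa0) => a1 Aa1 xmin; set xi := x a1 in xmin.
have xi0 : 0 <= xi by apply: x0.
pose o a := Num.min (w a) (v a).
have e1 : \sum_(a | A a) w a * x a - \sum_(a | A a) v a * x a =
    \sum_(a | A a) ((w a - o a) * x a - (v a - o a) * x a).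
  by rewrite -sumrB; apply: eq_bigr => a _; ring.
(* On the excess of [w] over the common part [o], [x] is at most 1 + m times its minimum [xi]; on
   the excess of [v] it is at least [xi]. *)
have e2 : \sum_(a | A a) w a * x a - \sum_(a | A a) v a * x a <=
    \sum_(a | A a) ((w a - o a) * ((1 + m) * xi) - (v a - o a) * xi).
  rewrite e1; apply: ler_sum => a Aa; apply: lerB.
    by apply: ler_wpM2l; [rewrite subr_ge0 /o ge_min lexx | apply: xm].
  by apply: ler_wpM2l; [rewrite subr_ge0 /o ge_min lexx orbT | apply: xmin].
rewrite sumrB -!mulr_suml !sumrB in e2.
have e3 : Sv * xi <= \sum_(a | A a) v a * x a.
  apply: le_trans (_ : (\sum_(a | A a) v a) * xi <= _); first exact: ler_wpM2r.
  by rewrite mulr_suml; apply: ler_sum => a Aa; apply: ler_wpM2l; [exact: v0|exact: xmin].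
set sw := \sum_(a | A a) w a in hw e2.
set sv := \sum_(a | A a) v a in hv e2.
set so := \sum_(a | A a) o a in e2; have {}hO : O <= so by [].
have e4 : (sw - so) * ((1 + m) * xi) - (sv - so) * xi <= (m * (Sw - O) + Sw - Sv) * xi.
  rewrite mulrA -mulrBl; apply: ler_wpM2r => //.
  have : m * (sw - so) <= m * (Sw - O) by apply: ler_wpM2l => //; lra.
  by lra.
have e5 : (m * (Sw - O) + Sw - Sv) * xi <= m' * Sv * xi by apply: ler_wpM2r.
have e6 : m' * (Sv * xi) <= m' * (\sum_(a | A a) v a * x a) by apply: ler_wpM2l.
rewrite mulrA in e6; lra.
Qed.

End Contraction.

(** * Flat matrices and the weights 1 + theta U *)

Section Flat.
Variables (R : realFieldType) (n : nat).
Implicit Types (U : 'I_n -> 'I_n -> R).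

Definition tr U i j := U j i.

(** The entry bounds keep every weight 1 + theta U with 0 <= theta <= 1 between 0 and q. Only
    columns are constrained here; imposing the predicate on [tr U] as well constrains the rows. *)
Definition half_flat (q T : R) U :=
  [/\ forall i j, -1 <= U i j <= q - 1,
      forall j, `|\sum_i U i j| <= q &
      forall j k, j != k -> `|\sum_i U i j * U i k| <= T].

Definition flat q T U := half_flat q T U /\ half_flat q T (tr U).

Lemma flat_tr q T U : flat q T U -> flat q T (tr U).
Proof. by case. Qed.

Definition wt (th : R) U i j := 1 + th * U i j.

Lemma pm_wt_tr th U rho :
  pm (wt th (tr U)) [seq (e.2, e.1) | e <- rho] = pm (wt th U) rho.
Proof. exact: (pm_tr (wt th U)). Qed.

End Flat.

(** * Absorbing constants into powers of q *)

Section Powers.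
Variables (R : realFieldType) (n : nat) (q T : R).
Hypotheses (q2 : 2 <= q) (qT : q <= T).
Local Notation N := (n%:R : R).
Hypothesis nbig : q ^+ 60 * T <= N.
Local Ltac qlra := have ? := q2; lra.

Lemma qX_ge1 (k : nat) : 1 <= q ^+ k.
Proof. by apply: exprn_ege1; qlra. Qed.

Lemma qX_le (k l : nat) : (k <= l)%N -> q ^+ k <= q ^+ l.
Proof. by move=> kl; apply: ler_weXn2l => //; qlra. Qed.

Lemma natX_le (a k : nat) : (a <= 2 ^ k)%N -> a%:R <= q ^+ k.
Proof.
move=> h; apply: le_trans (_ : (2 ^ k)%:R <= _); first by rewrite ler_nat.
by rewrite natrX lerXn2r // ?nnegrE; qlra.
Qed.

(** As q >= 2, a numerical factor costs a bounded increase of the exponent; this takes the place of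
    O-notation throughout. The 60 in [nbig] exceeds every exponent k for which q^k T <= N is
    invoked. *)
Lemma cX_le (a k l : nat) : (a <= 2 ^ k)%N -> a%:R * q ^+ l <= q ^+ (k + l).
Proof.
move=> h; rewrite exprD; apply: ler_wpM2r; last exact: natX_le.
by apply: exprn_ge0; qlra.
Qed.

Lemma qN (k : nat) : (k <= 61)%N -> q ^+ k <= N.
Proof.
move=> k61; apply: le_trans nbig; apply: le_trans (qX_le k61) _.
by rewrite exprSr; apply: ler_wpM2l => //; apply: exprn_ge0; qlra.
Qed.

Lemma qTN (k : nat) : (k <= 60)%N -> q ^+ k * T <= N.
Proof.
move=> h; apply: le_trans nbig; apply: ler_wpM2r; last exact: qX_le.
by have ? := q2; have ? := qT; lra.
Qed.

End Powers.

Section Weights.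
Variables (R : realFieldType) (n : nat) (U : 'I_n -> 'I_n -> R) (th q T : R).
Hypotheses (flU : flat q T U) (th0 : 0 <= th) (th1 : th <= 1) (q2 : 2 <= q) (qT : q <= T).
Local Notation W := (wt th U).
Local Notation N := (n%:R : R).
Hypothesis nbig : q ^+ 60 * T <= N.

Local Ltac slra := move: th0 th1 q2 qT => ? ? ? ?; lra.

Let U1 i j : -1 <= U i j <= q - 1. Proof. by case: flU => -[]. Qed.

Lemma wt_ge0 i j : 0 <= W i j.
Proof.
have /andP[h _] := U1 i j; rewrite /wt; have := ler_wpM2l th0 h; slra.
Qed.

Lemma wt_le i j : W i j <= q.
Proof.
have /andP[h1 h2] := U1 i j; rewrite /wt.
have : th * U i j <= th * (q - 1) by exact: ler_wpM2l.
have : th * (q - 1) <= 1 * (q - 1) by apply: ler_wpM2r => //; slra.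
by slra.
Qed.

Lemma U_abs i j : `|U i j| <= q.
Proof. have /andP[h1 h2] := U1 i j; rewrite ler_norml; apply/andP; split; slra. Qed.

Lemma col_sum j : `|\sum_i W i j - N| <= q.
Proof.
rewrite /wt big_split /= sumr_const card_ord addrAC subrr add0r -mulr_sumr normrM.
rewrite (ger0_norm th0); case: flU => -[_ h _] _; have := h j.
have := normr_ge0 (\sum_i U i j); set c := `|_| => c0 cq.
have : th * c <= 1 * c by apply: ler_wpM2r.
by slra.
Qed.

Lemma free_col_sum (l : seq 'I_n) j : uniq l -> (size l)%:R <= q ^+ 4 ->
  `|\sum_(i | i \notin l) W i j - N| <= q ^+ 6.
Proof.
move=> ul sl; rewrite sum_notin //.
have h1 : `|\sum_(i <- l) W i j| <= q ^+ 5.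
  rewrite ger0_norm; last by apply: sumr_ge0 => i _; apply: wt_ge0.
  apply: le_trans (_ : \sum_(i <- l) q <= _); first by apply: ler_sum => i _; apply: wt_le.
  rewrite big_const_seq count_predT iter_addr_0 -mulr_natl exprSr.
  by apply: ler_wpM2r => //; slra.
have h2 := col_sum j.
have h3 : q <= q ^+ 5 by rewrite -[X in X <= _]expr1; exact: (qX_le q2).
have := @cX_le R q q2 2 1 5 isT; rewrite add1n => h4.
rewrite addrAC; apply: le_trans (ler_normB _ _) _; move: h1 h2 h3 h4; slra.
Qed.

Lemma col_overlap j k : j != k -> N - 2 * q - T <= \sum_i W i j * W i k.
Proof.
move=> jk.
have -> : \sum_i W i j * W i k =
    N + th * \sum_i U i j + th * \sum_i U i k + th ^+ 2 * \sum_i U i j * U i k.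
  have -> : N = \sum_(i < n) 1 by rewrite sumr_const card_ord.
  rewrite !mulr_sumr -!big_split /=.
  by apply: eq_bigr => i _; rewrite /wt; ring.
case: flU => -[_ hc hcc] _.
have := hc j; have := hc k; have := hcc j k jk; rewrite !ler_norml.
move=> /andP[a1 a2] /andP[b1 b2] /andP[c1 c2].
have t2 : 0 <= th ^+ 2 <= 1 by rewrite exprn_ge0 //= expr_le1.
have f (y u t : R) : 0 <= t <= 1 -> 0 <= y -> - y <= u -> - y <= t * u.
  move=> /andP[t0 t1] y0 yu; have : t * - y <= t * u by exact: ler_wpM2l.
  have : t * y <= 1 * y by exact: ler_wpM2r.
  by rewrite mulrN; slra.
have t1 : 0 <= th <= 1 by rewrite th0.
have := f q (\sum_i U i j) th t1 (ltac:(slra)) c1.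
have := f q (\sum_i U i k) th t1 (ltac:(slra)) b1.
have := f T (\sum_i U i j * U i k) (th ^+ 2) t2 (ltac:(slra)) a1.
by slra.
Qed.

(** For weights between 0 and q, min(x, y) >= x y / q, so the mass shared by two columns is bounded
    below by their inner product, which is close to N; the removed rows cost at most q^6. This
    overlap drives both contractions. *)
Lemma free_min_sum (l : seq 'I_n) j k : j != k -> uniq l -> (size l)%:R <= q ^+ 4 ->
  N / (2 * q) <= \sum_(i | i \notin l) Num.min (W i j) (W i k).
Proof.
move=> jk ul sl.
have q0 : 0 < q by slra.
have h1 : \sum_(i | i \notin l) W i j * W i k <=
    q * \sum_(i | i \notin l) Num.min (W i j) (W i k).
  rewrite mulr_sumr; apply: ler_sum => i _.
  have [le|le] := leP (W i j) (W i k); last rewrite mulrC.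
    by rewrite mulrC; apply: ler_wpM2r; [exact: wt_ge0|exact: wt_le].
  by rewrite mulrC; apply: ler_wpM2r; [exact: wt_ge0|exact: wt_le].
rewrite sum_notin // in h1.
have h2 : \sum_(i <- l) W i j * W i k <= q ^+ 6.
  apply: le_trans (_ : \sum_(i <- l) q * q <= _).
    by apply: ler_sum => i _; apply: ler_pM; rewrite ?wt_ge0 ?wt_le.
  rewrite big_const_seq count_predT iter_addr_0 -mulr_natl -expr2 (exprD q 4 2).
  by apply: ler_wpM2r => //; apply: exprn_ge0; slra.
have h3 := col_overlap jk.
rewrite invfM mulrA ler_pdivrMr // [X in _ <= X]mulrC.
have h4 := @qTN R n q T q2 qT nbig 3 isT; have h5 := @qN R n q T q2 qT nbig 9 isT.
have := @cX_le R q q2 8 3 6 isT; rewrite (_ : 3 + 6 = 9)%N // => h6.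
have h7 : 8 * T <= q ^+ 3 * T by apply: ler_wpM2r; [slra|exact: (@natX_le R q q2 8 3)].
have h8 : 2 * q <= q ^+ 6.
  rewrite -{1}(expr1 q); apply: le_trans (@cX_le R q q2 2 1 1 isT) _; exact: (qX_le q2).
slra.
Qed.

End Weights.

(** * A priori comparison of the partial permanents *)

Section CauchySchwarz.
Variables (R : realFieldType) (I : finType).

Lemma sum_sqr_le (x y : I -> R) :
  (\sum_i x i * y i) ^+ 2 <= (\sum_i x i ^+ 2) * (\sum_i y i ^+ 2).
Proof.
have e : \sum_i \sum_j (x i * y j - x j * y i) ^+ 2 =
    2 * ((\sum_i x i ^+ 2) * (\sum_i y i ^+ 2)) - 2 * (\sum_i x i * y i) ^+ 2.
  set A := _ * (\sum_i y i ^+ 2).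
  have eA : A = \sum_i \sum_j x i ^+ 2 * y j ^+ 2 by rewrite /A big_distrlr.
  have eA' : A = \sum_i \sum_j x j ^+ 2 * y i ^+ 2 by rewrite eA exchange_big.
  have eB : (\sum_i x i * y i) ^+ 2 = \sum_i \sum_j (x i * y i) * (x j * y j).
    by rewrite expr2 big_distrlr.
  rewrite (_ : 2 * A = A + A); last by ring.
  rewrite {1}eA eA' eB mulr_sumr -big_split -sumrB /=.
  apply: eq_bigr => i _; rewrite mulr_sumr -big_split -sumrB /=.
  by apply: eq_bigr => j _; ring.
have : 0 <= \sum_i \sum_j (x i * y j - x j * y i) ^+ 2.
  by apply: sumr_ge0 => i _; apply: sumr_ge0 => j _; apply: sqr_ge0.
by rewrite e; lra.
Qed.

Lemma sum_mem (l : seq I) : uniq l -> \sum_i (i \in l)%:R = (size l)%:R :> R.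
Proof.
move=> ul; rewrite -(card_uniqP ul) -sum1_card natr_sum.
rewrite [X in _ = X](_ : _ = \sum_i if i \in l then 1 else 0); last by rewrite -big_mkcond.
by apply: eq_bigr => i _; case: (i \in l).
Qed.

Lemma le_double_sum_restrict (P : pred I) (Q : rel I) (F : I -> I -> R) (M c : R) :
  0 <= M ->
  (forall a b, 0 <= F a b <= M) ->
  \sum_a \sum_b (~~ (P a && Q a b))%:R <= c ->
  \sum_a \sum_b F a b - M * c <= \sum_(a | P a) \sum_(b | Q a b) F a b.
Proof.
move=> M0 FM hc.
rewrite lerBlDr; apply: le_trans (_ : _ <= \sum_(a | P a) \sum_(b | Q a b) F a b +
  M * \sum_a \sum_b (~~ (P a && Q a b))%:R) _; last by rewrite lerD2l; apply: ler_wpM2l.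
rewrite big_mkcond [X in _ <= X + _]big_mkcond mulr_sumr -big_split /=.
apply: ler_sum => a _; rewrite mulr_sumr.
case: (P a) => /=; last first.
  by rewrite add0r; apply: ler_sum => b _; rewrite mulr1; case/andP: (FM a b).
rewrite [X in _ <= X + _]big_mkcond -big_split /=; apply: ler_sum => b _.
by case: (Q a b) => /=; rewrite ?mulr0 ?addr0 ?add0r ?mulr1 //; case/andP: (FM a b).
Qed.

End CauchySchwarz.

Section APriori.
Variables (R : realFieldType) (n : nat).
Variables (th q T : R).
Hypotheses (th0 : 0 <= th) (th1 : th <= 1) (q2 : 2 <= q) (qT : q <= T).
Local Notation W := (wt th).
Local Notation N := (n%:R : R).
Hypothesis nbig : q ^+ 60 * T <= N.
Implicit Types (U : 'I_n -> 'I_n -> R).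
Local Ltac slra := move: th0 th1 q2 qT => ? ? ? ?; lra.

(** Cauchy-Schwarz in b reduces the form to the second moment of the inner sums over a, whose
    expansion consists of inner products of columns: at most N q^2 on the diagonal and T off it. *)
Lemma bilinear_small U (al be : 'I_n -> R) (sg : 'S_n) : flat q T U ->
  (forall i, 0 <= al i <= q) -> (forall i, 0 <= be i <= q) ->
  `|\sum_a \sum_b al a * be b * U b (sg a)| <= N ^+ 2 / 8.
Proof.
move=> flU al0 be0; set G := \sum_a _.
have q0 : 0 <= q by slra.
have N0 : 0 <= N by [].
have T0 : 0 <= T by slra.
have eG : G = \sum_b be b * \sum_a al a * U b (sg a).
  rewrite /G exchange_big; apply: eq_bigr => b _; rewrite mulr_sumr.
  by apply: eq_bigr => a _; ring.
have h1 : \sum_b be b ^+ 2 <= N * q ^+ 2.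
  by apply: sum_le_const => b; have /andP[b0 b1] := be0 b; rewrite lerXn2r.
have h2 : \sum_b (\sum_a al a * U b (sg a)) ^+ 2 <= N ^+ 2 * q ^+ 2 * (q ^+ 2 + T).
  have -> : \sum_b (\sum_a al a * U b (sg a)) ^+ 2 =
      \sum_a \sum_a' al a * al a' * \sum_b U b (sg a) * U b (sg a').
    transitivity (\sum_b \sum_a \sum_a' al a * al a' * (U b (sg a) * U b (sg a'))).
      apply: eq_bigr => b _; rewrite expr2 big_distrlr /=.
      by apply: eq_bigr => a _; apply: eq_bigr => a' _; ring.
    rewrite exchange_big /=; apply: eq_bigr => a _.
    rewrite exchange_big /=; apply: eq_bigr => a' _; by rewrite mulr_sumr.
  apply: le_trans (_ : \sum_(a < n) \sum_(a' < n)
      q ^+ 2 * ((a == a')%:R * (N * q ^+ 2) + T) <= _).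
    apply: ler_sum => a _; apply: ler_sum => a' _.
    have /andP[a0 a1] := al0 a; have /andP[c0 c1] := al0 a'.
    have bd : \sum_b U b (sg a) * U b (sg a') <= (a == a')%:R * (N * q ^+ 2) + T.
      case: eqVneq => [<-|ne] /=; last first.
        rewrite mul0r add0r; case: flU => -[_ _ h] _.
        apply: le_trans (ler_norm _) _; apply: h.
        by apply: contra ne => /eqP/perm_inj->.
      rewrite mul1r; apply: le_trans (_ : N * q ^+ 2 <= _); last by lra.
      apply: sum_le_const => b; have h := U_abs flU th0 th1 q2 qT b (sg a).
      by rewrite -expr2 -real_normK ?num_real // lerXn2r ?nnegrE.
    set S := \sum_b _ in bd *; set B := _ + T in bd *.
    have B0 : 0 <= B.
      by rewrite addr_ge0 // mulr_ge0 // ?mulr_ge0 // exprn_ge0.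
    apply: le_trans (_ : al a * al a' * B <= _).
      by apply: ler_wpM2l => //; apply: mulr_ge0.
    by apply: ler_wpM2r => //; rewrite expr2; apply: ler_pM.
  under eq_bigr => a _.
    rewrite -mulr_sumr big_split /= -mulr_suml.
    have -> : \sum_(i < n) (a == i)%:R = 1 :> R.
      rewrite (bigD1 a) //= eqxx big1 ?addr0 // => i; by rewrite eq_sym => /negbTE->.
    rewrite sumr_const card_ord.
    over.
  rewrite sumr_const card_ord -mulr_natl -(mulr_natl T).
  by apply: le_of_eq; ring.
have h3 : G ^+ 2 <= (N * q ^+ 2) * (N ^+ 2 * q ^+ 2 * (q ^+ 2 + T)).
  rewrite eG; apply: le_trans (sum_sqr_le _ _) _; apply: ler_pM => //.
    by apply: sumr_ge0 => b _; apply: sqr_ge0.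
  by apply: sumr_ge0 => b _; apply: sqr_ge0.
have h4 : 64 * (q ^+ 4 * (q ^+ 2 + T)) <= N.
  apply: le_trans (@qTN R n q T q2 qT nbig 13 isT).
  have g : 128 <= q ^+ 7 by exact: (@natX_le R q q2 128 7).
  have g1 : 1 <= q ^+ 2 by apply: qX_ge1.
  have g2 : q ^+ 2 * 1 <= q ^+ 2 * T by apply: ler_wpM2l; [lra|slra].
  have g3 : 1 * T <= q ^+ 2 * T by apply: ler_wpM2r.
  have g4 : q ^+ 4 * (q ^+ 2 + T) <= q ^+ 4 * (2 * (q ^+ 2 * T)).
    by apply: ler_wpM2l; [exact: exprn_ge0 | lra].
  have g5 : 128 * (q ^+ 6 * T) <= q ^+ 7 * (q ^+ 6 * T).
    by apply: ler_wpM2r => //; rewrite mulr_ge0 // exprn_ge0.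
  rewrite [X in _ <= X](_ : _ = q ^+ 13 * T) in g5; last by rewrite mulrA -exprD.
  apply: le_trans g5.
  rewrite (_ : 128 * _ = 64 * (q ^+ 4 * (2 * (q ^+ 2 * T)))); last by ring.
  by apply: ler_wpM2l.
have h5 : G ^+ 2 <= (N ^+ 2 / 8) ^+ 2.
  apply: le_trans h3 _.
  have : N ^+ 3 * (64 * (q ^+ 4 * (q ^+ 2 + T))) <= N ^+ 3 * N.
    by apply: ler_wpM2l => //; apply: exprn_ge0.
  have -> : (N ^+ 2 / 8) ^+ 2 = N ^+ 3 * N / 64 by field.
  have -> : N * q ^+ 2 * (N ^+ 2 * q ^+ 2 * (q ^+ 2 + T)) = N ^+ 3 * (64 * (q ^+ 4 * (q ^+ 2 + T))) / 64 by field.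
  lra.
have n8 : 0 <= N ^+ 2 / 8 by rewrite divr_ge0 // exprn_ge0.
by rewrite -(@ler_pXn2r _ 2) ?nnegrE // real_normK ?num_real.
Qed.

(** Expanding only the last factor as 1 + theta U leaves a column sum times a row sum, about N^2,
    plus a bilinear form in U. At most 3 N q^4 pairs of a and b are excluded, each worth at most
    q^3. *)
Lemma bracket_ge U (l : seq 'I_n) (sg : 'S_n) a0 j : flat q T U ->
  uniq l -> (size l)%:R <= q ^+ 4 ->
  N ^+ 2 / 2 <= \sum_(a | a \notin l) \sum_(b | (b \notin l) && (b != a))
     W U a j * (W U a0 (sg b) * W U b (sg a)).
Proof.
move=> flU ul sl.
have q0 : 0 <= q by slra.
have w0 i k : 0 <= W U i k by exact: (wt_ge0 flU).
have wq i k : W U i k <= q by exact: (wt_le flU th0 th1 q2 qT).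
have N0 : 0 <= N by [].
pose F a b := W U a j * (W U a0 (sg b) * W U b (sg a)).
have F0 a b : 0 <= F a b <= q ^+ 3.
  rewrite /F !mulr_ge0 //= exprS expr2; apply: ler_pM => //; first by rewrite mulr_ge0.
  by apply: ler_pM.
have hc : \sum_a \sum_b (~~ ((a \notin l) && ((b \notin l) && (b != a))))%:R <= 3 * (N * q ^+ 4).
  apply: le_trans (_ : \sum_(a < n) \sum_(b < n)
     ((a \in l)%:R + (b \in l)%:R + (b == a)%:R) <= _).
    apply: ler_sum => a _; apply: ler_sum => b _.
    case: (a \in l); case: (b \in l); case: (b == a) => /=; lra.
  have e1 : \sum_(a < n) \sum_(b < n) (a \in l)%:R = N * (size l)%:R :> R.
    under eq_bigr => a _ do rewrite sumr_const card_ord -[_ *+ n]mulr_natl.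
    by rewrite -mulr_sumr sum_mem.
  have e2 : \sum_(a < n) \sum_(b < n) (b \in l)%:R = N * (size l)%:R :> R.
    under eq_bigr => a _ do rewrite sum_mem //.
    by rewrite sumr_const card_ord mulr_natl.
  have e3 : \sum_(a < n) \sum_(b < n) (b == a)%:R = N :> R.
    under eq_bigr => a _.
      rewrite (bigD1 a) //= eqxx big1 ?addr0 => [|b /negbTE-> //].
      over.
    by rewrite sumr_const card_ord.
  under eq_bigr => a _ do rewrite !big_split /=.
  rewrite !big_split /= e1 e2 e3.
  have : N * (size l)%:R <= N * q ^+ 4 by exact: ler_wpM2l.
  have : N * 1 <= N * q ^+ 4 by apply: ler_wpM2l => //; exact: (qX_ge1 q2).
  by lra.
have M0 : 0 <= q ^+ 3 by exact: exprn_ge0.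
have := le_double_sum_restrict M0 F0 hc.
apply: le_trans.
have hb := @bilinear_small U (fun a => W U a j) (fun b => W U a0 (sg b)) sg flU
   (fun a => ltac:(by rewrite w0 wq)) (fun a => ltac:(by rewrite w0 wq)).
set G := \sum_a _ in hb.
have eF : \sum_a \sum_b F a b =
    (\sum_a W U a j) * (\sum_b W U a0 b) + th * G.
  rewrite [X in _ = _ * X + _](reindex_inj (@perm_inj _ sg)) /= big_distrlr /= /G mulr_sumr -big_split /=.
  apply: eq_bigr => a _; rewrite mulr_sumr -big_split /=; apply: eq_bigr => b _.
  by rewrite /F [W U b _]/wt; ring.
rewrite eF.
have hq := qN q2 qT nbig.
have c1 := col_sum flU th0 th1 q2 qT j.
have c2 := col_sum (flat_tr flU) th0 th1 q2 qT a0.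
rewrite [X in `|X - _| <= _](_ : _ = \sum_b W U a0 b) // in c2.
move: c1 c2 hb; rewrite !ler_norml => /andP[c11 c12] /andP[c21 c22] /andP[g1 g2].
have qn1 : q <= N by rewrite -(expr1 q); exact: hq.
have p1 : (N - q) * (N - q) <= (\sum_a W U a j) * (\sum_b W U a0 b).
  by apply: ler_pM; lra.
have p2 : - (N ^+ 2 / 8) <= th * G.
  have NN : 0 <= N ^+ 2 / 8 by rewrite divr_ge0 // exprn_ge0.
  have : th * - (N ^+ 2 / 8) <= th * G by exact: ler_wpM2l.
  have : th * (N ^+ 2 / 8) <= 1 * (N ^+ 2 / 8) by exact: ler_wpM2r.
  by rewrite mulrN; lra.
have p3 : 48 * q ^+ 7 <= N.
  apply: le_trans (hq 13 isT); apply: (@cX_le R q q2 48 6 7); by [].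
have p4 : 48 * (N * q ^+ 7) <= N ^+ 2.
  by rewrite mulrCA expr2; apply: ler_wpM2l.
have p5 : N * (16 * q) <= N * N.
  apply: ler_wpM2l => //; apply: le_trans (hq 6 isT).
  by rewrite -{1}(expr1 q); apply: le_trans (@cX_le R q q2 16 4 1 isT) _; exact: (qX_le q2).
have p6 : q ^+ 3 * (3 * (N * q ^+ 4)) = 3 * (N * q ^+ 7) by ring.
rewrite p6; rewrite expr2 in p2 p4 *; have := mulr_ge0 q0 q0; lra.
Qed.

(* Composing with the 3-cycle a -> a0 -> b -> a moves the value k from a0 to a. *)
Lemma pm_cycle U rho a0 a b k : flat q T U -> injpairs rho -> k \notin unzip2 rho ->
  a0 \notin unzip1 rho -> a \notin a0 :: unzip1 rho ->
  (b \notin a0 :: unzip1 rho) && (b != a) ->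
  \sum_(sg : 'S_n | extends ((a0, k) :: rho) sg)
     (\prod_(i | i \notin unzip1 ((a0, k) :: rho)) W U i (sg i)) *
     (W U a0 (sg b) * W U b (sg a)) <=
  q ^+ 2 * pm (W U) ((a, k) :: rho).
Proof.
move=> flU ir kr a0r ar /andP[br ba].
have q0 : 0 <= q by slra.
have w0 i j : 0 <= W U i j by exact: (wt_ge0 flU).
have wq i j : W U i j <= q by exact: (wt_le flU th0 th1 q2 qT).
move: (ar) (br); rewrite !inE !negb_or => /andP[aa0 ar'] /andP[ba0 br'].
pose p : 'S_n := (tperm a b * tperm a0 b)%g.
have pa : p a = a0 by rewrite permM tpermL tpermR.
have pb : p b = a by rewrite permM tpermR tpermD // eq_sym.
have pa0 : p a0 = b by rewrite permM (tpermD aa0 ba0) tpermL.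
have pD x : x \notin [:: a0, a, b & unzip1 rho] -> p x = x.
  rewrite !inE !negb_or => /and4P[x0 xa xb _].
  by rewrite permM (@tpermD _ a b x) 1?(@tpermD _ a0 b x) // eq_sym.
have pR x : x \in unzip1 rho -> p x = x.
  move=> xr; have ne y : y \notin unzip1 rho -> y != x by apply: contra => /eqP->.
  by rewrite permM (@tpermD _ a b x) 1?(@tpermD _ a0 b x) // ne.
rewrite /pm [X in _ <= _ * X](reindex_inj (mulgI p)) /= mulr_sumr.
rewrite [X in X <= _](eq_bigl (fun sg : 'S_n => extends ((a, k) :: rho) (p * sg)%g)); last first.
  move=> sg /=; rewrite /extends /= permM pa; congr (_ && _).
  apply/esym/eq_in_all => -[c d] /= cd; rewrite permM pR //.
  by apply/mapP; exists (c, d).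
apply: ler_sum => sg _.
have e1 : \prod_(i | i \notin a0 :: unzip1 rho) W U i (sg i) =
   W U a (sg a) * (W U b (sg b) *
   \prod_(i | i \notin [:: a0, a, b & unzip1 rho]) W U i (sg i)).
  rewrite (bigD1 a) //= (bigD1 b) /=; last by rewrite br ba.
  congr (_ * (_ * _)); apply: eq_bigl => i; rewrite !inE.
  by case: (i == a0); case: (i == a); case: (i == b); case: (i \in _).
have e2 : \prod_(i | i \notin a :: unzip1 rho) W U i ((p * sg)%g i) =
   W U a0 (sg b) * (W U b (sg a) *
   \prod_(i | i \notin [:: a0, a, b & unzip1 rho]) W U i (sg i)).
  have aR : a0 \notin a :: unzip1 rho by rewrite inE negb_or eq_sym aa0 a0r.
  rewrite (bigD1 a0) /=; last exact: aR.
  have bR : (b \notin a :: unzip1 rho) && (b != a0) by rewrite inE negb_or ba br' ba0.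
  rewrite permM pa0 (bigD1 b) /=; last exact: bR.
  rewrite permM pb; congr (_ * (_ * _)); apply: eq_big => [i|i].
    rewrite !inE.
    by case: (i == a0); case: (i == a); case: (i == b); case: (i \in _).
  move=> h; rewrite permM pD //; move: h; rewrite !inE.
  by case: (i == a0); case: (i == a); case: (i == b); case: (i \in _).
rewrite e1 e2; set Pi := \prod_(i | _) _.
have Pi0 : 0 <= Pi by apply: prodr_ge0.
have h : W U a (sg a) * W U b (sg b) <= q ^+ 2 by rewrite expr2; apply: ler_pM.
have Q0 : 0 <= W U a0 (sg b) * (W U b (sg a) * Pi) by rewrite !mulr_ge0.
apply: le_trans (ler_wpM2r Q0 h).
by apply: le_of_eq; ring.
Qed.

(** A transposition moving k from a0 to a would bring in the weight of the cell (a0, sg a), and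
    these weights could all vanish where W a j does not. The intermediate row b of a 3-cycle adds an
    average: the new weights, summed over a and b, total at least N^2 / 2 for every [sg]. *)
Lemma pm_a_priori U rho a0 k j : flat q T U -> injpairs rho ->
  (size rho).+1%:R <= q ^+ 4 -> a0 \notin unzip1 rho -> k \notin unzip2 rho ->
  N * pm (W U) ((a0, k) :: rho) <=
  2 * q ^+ 2 * \sum_(a | a \notin unzip1 rho) W U a j * pm (W U) ((a, k) :: rho).
Proof.
move=> flU ir sr a0r kr.
have w0 i l : 0 <= W U i l by exact: (wt_ge0 flU).
have q0 : 0 <= q by slra.
have pos : 0 < N by apply: lt_le_trans (qN q2 qT nbig (isT : (0 <= 61)%N)).
set l := unzip1 ((a0, k) :: rho).
have ul : uniq l by rewrite /l /= a0r; case/andP: ir.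
have sl : (size l)%:R <= q ^+ 4 by rewrite /l size_map.
set S := \sum_(a | _) _.
pose tm (sg : 'S_n) := \prod_(i | i \notin l) W U i (sg i).
have h1 : N ^+ 2 / 2 * pm (W U) ((a0, k) :: rho) <=
    \sum_(a | a \notin l) \sum_(b | (b \notin l) && (b != a))
      W U a j * \sum_(sg | extends ((a0, k) :: rho) sg)
        tm sg * (W U a0 (sg b) * W U b (sg a)).
  rewrite /pm mulr_sumr.
  apply: le_trans (_ : \sum_(sg | extends ((a0, k) :: rho) sg) tm sg *
     \sum_(a | a \notin l) \sum_(b | (b \notin l) && (b != a))
     W U a j * (W U a0 (sg b) * W U b (sg a)) <= _).
    apply: ler_sum => sg _; rewrite mulrC; apply: ler_wpM2l.
      by apply: prodr_ge0.
    exact: bracket_ge.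
  apply: le_of_eq.
  under eq_bigr => sg _ do rewrite mulr_sumr.
  rewrite exchange_big /=; apply: eq_bigr => a _.
  under eq_bigr => sg _ do rewrite mulr_sumr.
  rewrite exchange_big /=; apply: eq_bigr => b _.
  by rewrite mulr_sumr; apply: eq_bigr => sg _; ring.
have h2 : N ^+ 2 / 2 * pm (W U) ((a0, k) :: rho) <= q ^+ 2 * N * S.
  apply: le_trans h1 _.
  apply: le_trans (_ : \sum_(a | a \notin unzip1 rho) N * (W U a j *
     (q ^+ 2 * pm (W U) ((a, k) :: rho))) <= _); last first.
    rewrite /S -mulr_sumr; apply: le_of_eq.
    rewrite !mulr_sumr; apply: eq_bigr => a _; ring.
  rewrite [X in _ <= X](bigID (fun a => a != a0)) /=.
  rewrite [X in _ <= X + _](eq_bigl (fun a => a \notin l)); last first.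
    by move=> a; rewrite /l /= inE negb_or andbC.
  rewrite -[X in X <= _]addr0; apply: lerD; last first.
    by apply: sumr_ge0 => a _; rewrite !mulr_ge0 ?exprn_ge0 ?pm_ge0.
  apply: ler_sum => a al.
  apply: le_trans (_ : \sum_(b | (b \notin l) && (b != a))
     W U a j * (q ^+ 2 * pm (W U) ((a, k) :: rho)) <= _).
    apply: ler_sum => b bl; apply: ler_wpM2l => //; exact: pm_cycle.
  rewrite sumr_const -[_ *+ #|_|]mulr_natl; apply: ler_wpM2r.
    by rewrite !mulr_ge0 ?exprn_ge0 ?pm_ge0.
  by rewrite ler_nat -[X in (_ <= X)%N](card_ord n) max_card.
rewrite -(ler_pM2l pos); move: h2.
by rewrite (_ : N * (N * _) = 2 * (N ^+ 2 / 2 * pm (W U) ((a0, k) :: rho))); [lra|field].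
Qed.

(** [m] bounds the relative oscillation along a row and [d] counts the prescribed cells. The
    contraction bounds depth [d] through depth [d.+1] with rows and columns exchanged. *)
Definition row_ratio U d (m : R) := forall rho i j k, injpairs rho -> size rho = d ->
  i \notin unzip1 rho -> j \notin unzip2 rho -> k \notin unzip2 rho ->
  pm (W U) ((i, j) :: rho) <= (1 + m) * pm (W U) ((i, k) :: rho).

Lemma col_ratio_le U d (m : R) : row_ratio (tr U) d m -> forall rho i i' j, injpairs rho -> size rho = d ->
  j \notin unzip2 rho -> i \notin unzip1 rho -> i' \notin unzip1 rho ->
  pm (W U) ((i, j) :: rho) <= (1 + m) * pm (W U) ((i', j) :: rho).
Proof.
move=> h rho i i' j ir sr jr ir1 ir2.
have e1 : unzip1 [seq (e.2, e.1) | e <- rho] = unzip2 rho by rewrite /unzip1 -map_comp.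
have e2 : unzip2 [seq (e.2, e.1) | e <- rho] = unzip1 rho by rewrite /unzip2 -map_comp.
have := h [seq (e.2, e.1) | e <- rho] j i i'.
rewrite injpairs_tr size_map e1 e2 => /(_ ir sr jr ir1 ir2).
by rewrite -(pm_wt_tr th U ((i, j) :: rho)) -(pm_wt_tr th U ((i', j) :: rho)).
Qed.

(** Expanding along column j and swapping puts the partial permanent at (i, k) over the same family
    as the expansion of the one at (i, j) along column k, with weights W a j in place of W a k. Both
    are weighted sums of one function of a, the setting of [overlap_contraction]. *)
Lemma pm_expand2 U rho i j k : injpairs rho -> i \notin unzip1 rho ->
  j \notin unzip2 rho -> k \notin unzip2 rho -> j != k ->
  pm (W U) ((i, k) :: rho) = \sum_(a | a \notin unzip1 ((i, j) :: rho))
     W U a j * pm (W U) ((a, k) :: (i, j) :: rho).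
Proof.
move=> ir ii jj kk jk; rewrite (@pm_col _ _ _ _ j) /=; last by rewrite inE negb_or jk.
apply: eq_bigr => a; rewrite inE negb_or => /andP[ai ar].
by rewrite [in RHS]pm_swap.
Qed.

Lemma row_ratio_a_priori U d : flat q T U -> d.+2%:R <= q ^+ 4 -> row_ratio U d (4 * q ^+ 2).
Proof.
move=> flU dq rho i j k ir sr ii jj kk.
have w0 a l : 0 <= W U a l by exact: (wt_ge0 flU).
have pos : 0 < N by apply: lt_le_trans (qN q2 qT nbig (isT : (0 <= 61)%N)).
have pg0 r : 0 <= pm (W U) r by exact: pm_ge0.
have q20 : 0 <= q ^+ 2 by exact: sqr_ge0.
have [<-|jk] := eqVneq j k.
  have := mulr_ge0 q20 (pg0 ((i, j) :: rho)); have := pg0 ((i, j) :: rho).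
  by rewrite mulrDl mul1r -mulrA; lra.
have ir' : injpairs ((i, j) :: rho) by rewrite injpairs_cons ii jj.
rewrite -(ler_pM2l pos) (@pm_col _ _ _ _ k) /=; last by rewrite inE negb_or eq_sym jk.
set P := pm _ ((i, k) :: rho).
have h a : a \notin i :: unzip1 rho ->
    N * pm (W U) [:: (a, k), (i, j) & rho] <= 2 * q ^+ 2 * P.
  move=> ai; rewrite /P (pm_expand2 U ir ii jj kk jk).
  by apply: pm_a_priori => //=; rewrite ?sr // inE negb_or eq_sym jk.
have e : N * \sum_(a | a \notin i :: unzip1 rho) W U a k * pm (W U) [:: (a, k), (i, j) & rho] <=
   (\sum_(a | a \notin i :: unzip1 rho) W U a k) * (2 * q ^+ 2 * P).
  rewrite mulr_sumr mulr_suml; apply: ler_sum => a ai.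
  by rewrite mulrCA; apply: ler_wpM2l => //; exact: h.
apply: le_trans e _.
have ui : uniq (i :: unzip1 rho) by case/andP: ir'.
have := free_col_sum flU th0 th1 q2 qT k ui.
rewrite /= size_map sr => h2; have {}h2 : `|\sum_(i0 | i0 \notin i :: unzip1 rho) W U i0 k - N| <= q ^+ 6.
  apply: h2.
  by apply: le_trans dq; rewrite ler_nat.
move: h2; rewrite ler_norml => /andP[_ c2].
have Q := qN q2 qT nbig (isT : (6 <= 61)%N).
have P0 : 0 <= 2 * q ^+ 2 * P by apply: mulr_ge0; [apply: mulr_ge0|exact: pg0].
apply: le_trans (_ : 2 * N * (2 * q ^+ 2 * P) <= _).
  by apply: ler_wpM2r => //; lra.
have := mulr_ge0 (ltW pos) (pg0 ((i, k) :: rho)); rewrite -/P => NP.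
have -> : 2 * N * (2 * q ^+ 2 * P) = 4 * q ^+ 2 * (N * P) by ring.
have -> : N * ((1 + 4 * q ^+ 2) * P) = N * P + 4 * q ^+ 2 * (N * P) by ring.
by lra.
Qed.

(** The overlap N / (2 q) alone would give the factor 1 - 1 / (2 q). Half of this gain pays for the
    deviation q^6 of the free column sums where it is multiplied by m; the rest of that deviation is
    the additive 3 q^6 / N. *)
Lemma row_ratio_step U d (m : R) : flat q T U -> d.+2%:R <= q ^+ 4 -> 0 <= m ->
  row_ratio (tr U) d.+1 m -> row_ratio U d ((1 - (4 * q)^-1) * m + 3 * q ^+ 6 / N).
Proof.
move=> flU dq m0 cm rho i j k ir sr ii jj kk; set m' := (X in 1 + X).
have w0 a l : 0 <= W U a l by exact: (wt_ge0 flU).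
have pos : 0 < N by apply: lt_le_trans (qN q2 qT nbig (isT : (0 <= 61)%N)).
have pg0 r : 0 <= pm (W U) r by exact: pm_ge0.
have q0 : 0 < q by slra.
have q60 : 0 <= q ^+ 6 by apply: exprn_ge0; exact: ltW.
have o0 : 0 < (4 * q)^-1 by rewrite invr_gt0; lra.
have o1 : (4 * q)^-1 <= 1 by rewrite invf_le1; slra.
have m'0 : 0 <= m'.
  apply: addr_ge0; first by apply: mulr_ge0 => //; lra.
  by apply: divr_ge0; [apply: mulr_ge0|exact: ltW].
have [<-|jk] := eqVneq j k.
  by rewrite mulrDl mul1r lerDl mulr_ge0.
have ir' : injpairs ((i, j) :: rho) by rewrite injpairs_cons ii jj.
have kk' : k \notin unzip2 ((i, j) :: rho) by rewrite /= inE negb_or eq_sym jk.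
rewrite (@pm_col _ _ _ _ k) //= (pm_expand2 U ir ii jj kk jk).
have ui : uniq (i :: unzip1 rho) by case/andP: ir'.
have si : (size (i :: unzip1 rho))%:R <= q ^+ 4.
  by rewrite /= size_map sr; apply: le_trans dq; rewrite ler_nat.
have := free_col_sum flU th0 th1 q2 qT k ui si.
have := free_col_sum flU th0 th1 q2 qT j ui si.
rewrite !ler_norml => /andP[c1 _] /andP[_ c2].
have kj : k != j by rewrite eq_sym.
have mo := free_min_sum flU th0 th1 q2 qT nbig kj ui si.
apply: (@overlap_contraction _ _ _ _ _ _ m m' (N / (2 * q)) (N + q ^+ 6) (N - q ^+ 6)) => //.
- move=> a b ai bi; apply: (col_ratio_le cm) => //=; by rewrite ?sr.
- lra.
- lra.
rewrite (_ : N / (2 * q) = 2 * ((4 * q)^-1 * N)); last by field; lra.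
rewrite /m'; set o := (4 * q)^-1 in o0 o1 *; set Q := q ^+ 6 in q60 *.
have hQ : 2 * Q <= o * N.
  rewrite /o [X in _ <= X]mulrC ler_pdivlMr; last by lra.
  have -> : 2 * Q * (4 * q) = 8 * q ^+ 7 by rewrite /Q; ring.
  apply: le_trans (@cX_le R q q2 8 3 7 isT) _; exact: (qN q2 qT nbig).
have hQ3 : 3 * Q <= N.
  apply: le_trans (@cX_le R q q2 3 2 6 isT) _; exact: (qN q2 qT nbig).
have e1 : 2 * Q <= 3 * Q / N * (N - Q).
  have -> : 3 * Q / N * (N - Q) = 3 * Q - Q * (3 * Q) / N by field; lra.
  have : Q * (3 * Q) / N <= Q * N / N.
    by apply: ler_wpM2r; [rewrite invr_ge0 ltW | exact: ler_wpM2l].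
  by rewrite mulfK ?gt_eqF //; lra.
have e2 : m * (N + Q - 2 * (o * N)) <= m * ((1 - o) * (N - Q)).
  by apply: ler_wpM2l => //; have := mulr_ge0 (ltW o0) q60; lra.
clearbody o Q; rewrite [X in _ <= X]mulrDl; set E := 3 * Q / N * (N - Q) in e1 *; lra.
Qed.

End APriori.

(** * Cross ratios *)

Section Antisymmetric.
Variables (R : realFieldType) (I : finType) (A : pred I).

(** After symmetrising, D is seen only by w a v b - w b v a, where the common part o a o b of the
    two products cancels. The gain is therefore O^2 out of Sw Sv. *)
Lemma antisym_sum_le (w v : I -> R) (D : I -> I -> R) (M O Sw Sv : R) :
  (forall a, A a -> 0 <= w a) -> (forall a, A a -> 0 <= v a) ->
  (forall a b, D b a = - D a b) -> 0 <= M ->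
  (forall a b, A a -> A b -> `|D a b| <= M) ->
  \sum_(a | A a) w a <= Sw -> \sum_(a | A a) v a <= Sv ->
  0 <= O -> O <= \sum_(a | A a) Num.min (w a) (v a) ->
  `|\sum_(a | A a) \sum_(b | A b) w a * v b * D a b| <= M * (Sw * Sv - O ^+ 2).
Proof.
move=> w0 v0 aD M0 hD hw hv O0 hO.
pose o a := Num.min (w a) (v a).
have o0 a : A a -> 0 <= o a by move=> Aa; rewrite /o le_min w0 ?v0.
have ow a : A a -> o a <= w a by move=> Aa; rewrite /o ge_min lexx.
have ov a : A a -> o a <= v a by move=> Aa; rewrite /o ge_min lexx orbT.
set S := \sum_(a | A a) _.
have eS : S + S = \sum_(a | A a) \sum_(b | A b) (w a * v b - w b * v a) * D a b.
  rewrite {2}/S exchange_big /= -big_split /=; apply: eq_bigr => a _.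
  by rewrite -big_split /=; apply: eq_bigr => b _; rewrite (aD a b); ring.
have h : `|S + S| <= \sum_(a | A a) \sum_(b | A b)
    (w a * v b + w b * v a - 2 * (o a * o b)) * M.
  rewrite eS; apply: le_trans (ler_norm_sum _ _ _) _; apply: ler_sum => a Aa.
  apply: le_trans (ler_norm_sum _ _ _) _; apply: ler_sum => b Ab.
  rewrite normrM; apply: ler_pM => //; last exact: hD.
  have g1 : o a * o b <= w a * v b by apply: ler_pM; rewrite ?o0 ?ow ?ov.
  have g2 : o b * o a <= w b * v a by apply: ler_pM; rewrite ?o0 ?ow ?ov.
  by rewrite ler_norml; apply/andP; split; lra.
have e : \sum_(a | A a) \sum_(b | A b) (w a * v b + w b * v a - 2 * (o a * o b)) * M =
   2 * (M * ((\sum_(a | A a) w a) * (\sum_(a | A a) v a) - (\sum_(a | A a) o a) ^+ 2)).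
  have -> : (\sum_(a | A a) w a) * (\sum_(a | A a) v a) =
     \sum_(a | A a) \sum_(b | A b) w a * v b by rewrite big_distrlr.
  have -> : (\sum_(a | A a) o a) ^+ 2 = \sum_(a | A a) \sum_(b | A b) o a * o b.
    by rewrite expr2 big_distrlr.
  rewrite (_ : 2 * _ = M * ((\sum_(a | A a) \sum_(b | A b) w a * v b) +
    (\sum_(a | A a) \sum_(b | A b) w a * v b) - 2 * \sum_(a | A a) \sum_(b | A b) o a * o b)); last by ring.
  rewrite [X in _ = M * (_ + X - _)]exchange_big /= -big_split mulr_sumr -sumrB mulr_sumr /=.
  apply: eq_bigr => a _; rewrite -big_split mulr_sumr -sumrB mulr_sumr /=.
  by apply: eq_bigr => b _; ring.
rewrite e in h.
have b1 : (\sum_(a | A a) w a) * (\sum_(a | A a) v a) <= Sw * Sv.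
  by apply: ler_pM => //; apply: sumr_ge0.
have b2 : O ^+ 2 <= (\sum_(a | A a) o a) ^+ 2.
  by apply: lerXn2r; rewrite ?nnegrE //; apply: le_trans hO.
have b3 : M * ((\sum_(a | A a) w a) * (\sum_(a | A a) v a) - (\sum_(a | A a) o a) ^+ 2)
   <= M * (Sw * Sv - O ^+ 2) by apply: ler_wpM2l => //; lra.
have : `|S + S| = 2 * `|S|.
  by rewrite (_ : S + S = 2 * S); [rewrite normrM ger0_norm | ring].
lra.
Qed.

End Antisymmetric.

Lemma norm_alternating4 (R : realFieldType) (x y z w c : R) : `|x| <= c -> `|y| <= c -> `|z| <= c -> `|w| <= c ->
  `|x + y - z - w| <= 4 * c.
Proof.
rewrite !ler_norml => /andP[? ?] /andP[? ?] /andP[? ?] /andP[? ?].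
by apply/andP; split; lra.
Qed.

Lemma dist_le_bound (R : realFieldType) (x y c : R) : 0 <= x <= c -> 0 <= y <= c -> `|x - y| <= c.
Proof. by rewrite ler_norml => /andP[? ?] /andP[? ?]; apply/andP; split; lra. Qed.

Lemma square_overlap (R : realFieldType) (N Q o : R) : Q * Q <= Q * N -> 3 * Q * N <= N ^+ 2 * o ->
  (N + Q) * (N + Q) - 2 * (N ^+ 2 * o) <= N ^+ 2 * (1 - o).
Proof. by rewrite expr2; lra. Qed.

Lemma near_of_sandwich (R : realFieldType) (m B y : R) : 0 <= m -> m <= 1 / 1024 ->
  0 <= B -> 0 <= y -> B <= (1 + m / 32) * (1 + m) * y -> (1 - m / 32) * y <= (1 + m) * B ->
  `|y - B| <= 2 * m * B.
Proof.
move=> m0 m1 B0 y0 h1 h2.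
have my : 0 <= m * y by apply: mulr_ge0.
have mmy : 0 <= m * (m * y) by apply: mulr_ge0.
have mmmy : 0 <= m * (m * (m * y)) by apply: mulr_ge0.
have mB : 0 <= m * B by apply: mulr_ge0.
have mmB : m * (m * B) <= 1 / 1024 * (m * B) by apply: ler_wpM2r.
have l1 : 0 <= 1 - 2 * m by lra.
have h3 := ler_wpM2l l1 h1.
have h4 : y <= (1 + 2 * m) * B.
  rewrite leNgt; apply/negP => lt.
  have l2 : 0 < 1 - m / 32 by lra.
  move: lt; rewrite -(ltr_pM2l l2) => lt.
  by lra.
by rewrite ler_norml; apply/andP; split; lra.
Qed.

Lemma prod_near (R : realFieldType) (m X x y : R) : 0 <= m -> m <= 1 / 1024 -> 0 <= X ->
  `|x - X| <= 2 * m * X -> `|y - X| <= 2 * m * X -> `|x * y - X ^+ 2| <= 5 * m * X ^+ 2.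
Proof.
move=> m0 m1 X0 hx hy.
have -> : x * y - X ^+ 2 = (x - X) * (y - X) + (x - X) * X + X * (y - X) by ring.
have mX : 0 <= m * X ^+ 2 by apply: mulr_ge0 => //; exact: sqr_ge0.
have mmX : m * (m * X ^+ 2) <= 1 / 1024 * (m * X ^+ 2) by exact: ler_wpM2r.
have h1 : `|(x - X) * (y - X)| <= 2 * m * X * (2 * m * X) by rewrite normrM; apply: ler_pM.
have h2 : `|(x - X) * X| <= 2 * m * X * X.
  by rewrite normrM (ger0_norm X0); apply: ler_wpM2r.
have h3 : `|X * (y - X)| <= X * (2 * m * X).
  by rewrite normrM (ger0_norm X0); apply: ler_wpM2l.
apply: le_trans (ler_normD _ _) _.
have := ler_normD ((x - X) * (y - X)) ((x - X) * X).
lra.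
Qed.

Lemma norm_le_double (R : realFieldType) (x c d : R) : `|x - c| <= d -> d <= c -> `|x| <= 2 * c.
Proof. by rewrite !ler_norml => /andP[? ?] ?; apply/andP; split; lra. Qed.

Lemma norm_diff_mul (R : realFieldType) (x y z g M : R) : `|x| <= g -> `|y| <= g -> `|z| <= M ->
  `|(x - y) * z| <= 2 * g * M.
Proof.
move=> hx hy hz; rewrite normrM; apply: ler_pM => //.
by apply: le_trans (ler_normB _ _) _; lra.
Qed.

Lemma power_absorb (R : realFieldType) (q T : R) : 2 <= q -> 1 <= T ->
  10 * q ^+ 25 + 20 * q ^+ 12 + 8 * (q ^+ 7 * T) <= q ^+ 30 * T.
Proof.
move=> q2 T1; have T0 : 0 <= T by exact: le_trans T1.
have z1 := @cX_le R q q2 20 5 12 isT; have z2 := @cX_le R q q2 10 4 25 isT.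
have z3 : 8 * (q ^+ 7 * T) <= q ^+ 10 * T.
  by rewrite mulrA; apply: ler_wpM2r => //; exact: (@cX_le R q q2 8 3 7 isT).
have z4 : q ^+ (5 + 12) <= q ^+ 28 by exact: (qX_le q2).
have z6 : q ^+ 10 * T <= q ^+ 28 * T by apply: ler_wpM2r => //; exact: (qX_le q2).
have q0 k : 0 <= q ^+ k by apply: exprn_ge0; lra.
have z7 : q ^+ 28 <= q ^+ 28 * T by apply: ler_peMr.
have z8 : q ^+ 29 <= q ^+ 29 * T by apply: ler_peMr.
have z9 : 2 * (q ^+ 28 * T) <= q ^+ 29 * T.
  by rewrite mulrA; apply: ler_wpM2r => //; exact: (@cX_le R q q2 2 1 28 isT).
have z10 : 2 * (q ^+ 29 * T) <= q ^+ 30 * T.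
  by rewrite mulrA; apply: ler_wpM2r => //; exact: (@cX_le R q q2 2 1 29 isT).
clear q2 T1; rewrite [(5 + 12)%N]/= [(4 + 25)%N]/= in z1 z2 z4 *; lra.
Qed.

Section Crude.
Variables (R : realFieldType) (n : nat) (th q T : R) (K : nat).
Hypotheses (th0 : 0 <= th) (th1 : th <= 1) (q2 : 2 <= q) (qT : q <= T).
Local Notation W := (wt th).
Local Notation N := (n%:R : R).
Hypothesis nbig : q ^+ 60 * T <= N.
Hypothesis Kbig : (1 - (16 * q ^+ 2)^-1) ^+ K <= (N ^+ 2)^-1.
Implicit Types (U : 'I_n -> 'I_n -> R).
Local Ltac slra := move: th0 th1 q2 qT => ? ? ? ?; lra.

Lemma N_gt0 : 0 < N.
Proof. exact: lt_le_trans (qN q2 qT nbig (isT : (0 <= 61)%N)). Qed.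

Lemma pmW_ge0 U rho : flat q T U -> 0 <= pm (W U) rho.
Proof. by move=> flU; apply: pm_ge0 => a b; exact: (wt_ge0 flU). Qed.

Lemma T_ge1 : 1 <= T. Proof. slra. Qed.

Lemma qXN (a b : nat) : (a + b <= 61)%N -> q ^+ a / N <= (q ^+ b)^-1.
Proof.
move=> ab; have qb : 0 < q ^+ b by apply: exprn_gt0; slra.
by rewrite ler_pdivrMr ?N_gt0 // mulrC ler_pdivlMr // -exprD; exact: (qN q2 qT nbig).
Qed.

Definition crude_rad : R := q ^+ 11 / N.
Local Notation mu := crude_rad.

Lemma crude_rad_ge0 : 0 <= mu.
Proof. by rewrite /crude_rad divr_ge0 ?(ltW N_gt0) // exprn_ge0; slra. Qed.

Lemma crude_rad_le : mu <= 1 / 1024.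
Proof.
apply: le_trans (@qXN 11 10 isT) _; rewrite div1r lef_pV2 ?posrE ?exprn_gt0 //; try slra.
exact: (@natX_le R q q2 1024 10).
Qed.

Lemma crude_radN : mu * N = q ^+ 11.
Proof. by rewrite /crude_rad divfK // gt_eqF // N_gt0. Qed.

(** 12 q^7 / N is the fixed point of m -> (1 - 1 / (4 q)) m + 3 q^6 / N, and 4 q^2 is the a priori
    start. Each step prescribes one more cell and transposes U, hence the induction over all [d] and
    [U]. *)
Lemma row_ratio_iter (t d : nat) U : flat q T U -> (d + t).+2%:R <= q ^+ 4 ->
  row_ratio th U d ((1 - (4 * q)^-1) ^+ t * (4 * q ^+ 2) + 12 * q ^+ 7 / N).
Proof.
have pos := N_gt0.
have q0 : 0 < q by slra.
have r0 : 0 <= 12 * q ^+ 7 / N by rewrite divr_ge0 ?(ltW pos) // mulr_ge0 // exprn_ge0 // ltW.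
have o1 : (4 * q)^-1 <= 1 by rewrite invf_le1; slra.
have o2 : 0 <= (1 - (4 * q)^-1) by slra.
elim: t d U => [|t IH] d U flU dq.
  rewrite addn0 in dq => rho i j k ir sr ii jj kk.
  have c := row_ratio_a_priori th0 th1 q2 qT nbig flU dq ir sr ii jj kk.
  apply: le_trans c _; apply: ler_wpM2r; last by rewrite expr0 mul1r; lra.
  exact: pmW_ge0.
have m0 : 0 <= (1 - (4 * q)^-1) ^+ t * (4 * q ^+ 2) + 12 * q ^+ 7 / N.
  by rewrite addr_ge0 // mulr_ge0 ?exprn_ge0 // mulr_ge0 // exprn_ge0 // ltW.
have -> : (1 - (4 * q)^-1) ^+ t.+1 * (4 * q ^+ 2) + 12 * q ^+ 7 / N =
   (1 - (4 * q)^-1) * ((1 - (4 * q)^-1) ^+ t * (4 * q ^+ 2) + 12 * q ^+ 7 / N) + 3 * q ^+ 6 / N.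
  by rewrite exprS; field; rewrite !gt_eqF.
apply: (row_ratio_step th0 th1 q2 qT nbig flU _ m0); first by apply: le_trans dq; rewrite ler_nat !ltnS leq_addr.
by apply: IH; [exact: flat_tr | move: dq; rewrite addSnnS].
Qed.

Lemma row_ratio_crude d U : flat q T U -> (d + K).+2%:R <= q ^+ 4 -> row_ratio th U d mu.
Proof.
move=> flU dq rho i j k ir sr ii jj kk.
have pos := N_gt0.
have q0 : 0 < q by slra.
have c := row_ratio_iter flU dq ir sr ii jj kk.
apply: le_trans c _; apply: ler_wpM2r; first exact: pmW_ge0.
rewrite lerD2l.
have h1 : (1 - (4 * q)^-1) ^+ K <= (1 - (16 * q ^+ 2)^-1) ^+ K.
  have o1 : (4 * q)^-1 <= 1 by rewrite invf_le1; slra.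
  have le : (16 * q ^+ 2)^-1 <= (4 * q)^-1.
    rewrite lef_pV2 ?posrE ?mulr_gt0 ?exprn_gt0 // expr2 mulrA.
    by apply: ler_wpM2r; slra.
  by apply: lerXn2r; rewrite ?nnegrE; lra.
have N1 : 1 <= N by exact: (qN q2 qT nbig (isT : (0 <= 61)%N)).
have h2 : (1 - (4 * q)^-1) ^+ K <= N^-1.
  apply: le_trans h1 (le_trans Kbig _).
  by rewrite lef_pV2 ?posrE ?exprn_gt0 // expr2 ler_peMr // ltW.
have q20 : 0 <= 4 * q ^+ 2 by rewrite mulr_ge0 // exprn_ge0 // ltW.
have h3 : (1 - (4 * q)^-1) ^+ K * (4 * q ^+ 2) <= N^-1 * (4 * q ^+ 2) by exact: ler_wpM2r.
apply: le_trans (_ : (4 * q ^+ 2 + 12 * q ^+ 7) / N <= _).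
  by rewrite [X in _ <= X](_ : _ = N^-1 * (4 * q ^+ 2) + 12 * q ^+ 7 / N) ?lerD2r //; ring.
rewrite /crude_rad ler_pM2r ?invr_gt0 //.
have := @cX_le R q q2 16 4 7 isT; have := qX_le q2 (isT : (2 <= 7)%N); lra.
Qed.

(* With P a b the partial permanent through (a, b), this is
   P i j P i' k / (P i k P i' j) = 1 + (th / N) (U i j + U i' k - U i k - U i' j) up to E. *)
Definition cross_ratio U d (E : R) := forall rho i i' j k, injpairs rho -> size rho = d ->
  i \notin unzip1 rho -> i' \notin unzip1 rho -> i != i' ->
  j \notin unzip2 rho -> k \notin unzip2 rho -> j != k ->
  forall P, P = (fun a b => pm (W U) ((a, b) :: rho)) ->
  `|P i j * P i' k - P i k * P i' j
     - th / N * (U i j + U i' k - U i k - U i' j) * (P i k * P i' j)| <= E * (P i k * P i' j).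

Lemma u_abs U i i' j k : flat q T U -> `|U i j + U i' k - U i k - U i' j| <= 4 * q.
Proof.
move=> flU.
have ua a b : `|U a b| <= q by exact: (U_abs flU th0 th1 q2 qT).
exact: norm_alternating4.
Qed.

(** Two uses of the crude comparison make the products agree up to a relative 4 mu, and the
    first-order term is itself of order q / N; no cancellation is used yet. *)
Lemma cross_ratio_start d U : flat q T U -> (d + K).+2%:R <= q ^+ 4 -> cross_ratio U d (q ^+ 14 / N).
Proof.
move=> flU dq rho i i' j k ir sr ii ii' nii jj kk njk P eP.
have cU := row_ratio_crude flU dq; have cT := row_ratio_crude (flat_tr flU) dq.
have P0 a b : 0 <= P a b by rewrite eP; exact: pmW_ge0.
have m0 := crude_rad_ge0; have m1 := crude_rad_le; have pos := N_gt0.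
have e1 : P i j <= (1 + mu) * P i k by rewrite eP; apply: cU.
have e2 : P i' k <= (1 + mu) * P i' j by rewrite eP; apply: cU.
have e3 : P i k <= (1 + mu) * P i j by rewrite eP; apply: cU.
have e4 : P i' j <= (1 + mu) * P i' k by rewrite eP; apply: cU.
set X := P i k * P i' j; set Y := P i j * P i' k.
have X0 : 0 <= X by apply: mulr_ge0.
have Y0 : 0 <= Y by apply: mulr_ge0.
have hY : Y <= (1 + mu) ^+ 2 * X.
  by have := ler_pM (P0 _ _) (P0 _ _) e1 e2; rewrite /X /Y; lra.
have hX : X <= (1 + mu) ^+ 2 * Y.
  by have := ler_pM (P0 _ _) (P0 _ _) e3 e4; rewrite /X /Y; lra.
have mm : (1 + mu) ^+ 2 <= 1 + 3 * mu.
  have : mu * mu <= 1 / 1024 * mu by exact: ler_wpM2r.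
  by rewrite expr2; lra.
have hY' : Y <= (1 + 3 * mu) * X by apply: le_trans hY _; exact: ler_wpM2r.
have hX' : X <= (1 + 3 * mu) * Y by apply: le_trans hX _; exact: ler_wpM2r.
have d1 : `|Y - X| <= 4 * mu * X.
  have mX : 0 <= mu * X by exact: mulr_ge0.
  have mY : mu * Y <= mu * ((1 + 3 * mu) * X) by exact: ler_wpM2l.
  have mmX : mu * (mu * X) <= 1 / 1024 * (mu * X) by exact: ler_wpM2r.
  by rewrite ler_norml; apply/andP; split; lra.
have d2 : `|th / N * (U i j + U i' k - U i k - U i' j) * X| <= 4 * q / N * X.
  rewrite normrM (ger0_norm X0); apply: ler_wpM2r => //.
  rewrite normrM ger0_norm; last by rewrite divr_ge0 // ltW.
  rewrite mulrAC; apply: ler_wpM2r; first by rewrite invr_ge0 ltW.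
  rewrite -[X in _ <= X]mul1r; apply: ler_pM => //; exact: u_abs.
apply: le_trans (ler_normB _ _) _.
have : 4 * mu + 4 * q / N <= q ^+ 14 / N.
  rewrite /crude_rad mulrA -mulrDl ler_pM2r ?invr_gt0 //.
  have := @cX_le R q q2 8 3 11 isT; rewrite (_ : 3 + 11 = 14)%N //.
  by have := qX_le q2 (isT : (1 <= 11)%N); rewrite expr1; lra.
move=> /(ler_wpM2r X0); lra.
Qed.

(** [pm] of rho is a weighted sum of its expansions along column l; these agree pairwise up to the
    factor 1 + mu, and their total weight is N up to q^6. *)
Lemma pm_near d U rho a l : flat q T U -> (d + K).+2%:R <= q ^+ 4 ->
  injpairs rho -> size rho = d -> a \notin unzip1 rho -> l \notin unzip2 rho ->
  `|pm (W U) ((a, l) :: rho) - pm (W U) rho / N| <= 2 * mu * (pm (W U) rho / N).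
Proof.
move=> flU dq ir sr ar lr.
have cT := row_ratio_crude (flat_tr flU) dq.
have m0 := crude_rad_ge0; have m1 := crude_rad_le; have pos := N_gt0.
have B0 := pmW_ge0 rho flU; set B := pm _ rho in B0 *.
have x0 b := pmW_ge0 ((b, l) :: rho) flU; set x := pm _ _.
have ur : uniq (unzip1 rho) by case/andP: ir.
have sr4 : (size (unzip1 rho))%:R <= q ^+ 4.
  by rewrite size_map sr; apply: le_trans dq; rewrite ler_nat !leqW // leq_addr.
have := free_col_sum flU th0 th1 q2 qT l ur sr4.
rewrite ler_norml => /andP[c1 c2].
have eB := pm_col (W U) lr.
have w0 b c : 0 <= W U b c by exact: (wt_ge0 flU).
have h1 : B <= (N + q ^+ 6) * ((1 + mu) * x).
  rewrite /B eB; apply: le_trans (_ : \sum_(b | b \notin unzip1 rho) W U b l * ((1 + mu) * x) <= _).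
    apply: ler_sum => b br; apply: ler_wpM2l => //; exact: (col_ratio_le cT).
  rewrite -mulr_suml; apply: ler_wpM2r; last by lra.
  by apply: mulr_ge0; [lra|exact: x0].
have h2 : (N - q ^+ 6) * x <= (1 + mu) * B.
  apply: le_trans (_ : \sum_(b | b \notin unzip1 rho) W U b l * x <= _).
    by rewrite -mulr_suml; apply: ler_wpM2r; [exact: x0|lra].
  rewrite /B eB mulr_sumr; apply: ler_sum => b br; rewrite mulrCA; apply: ler_wpM2l => //.
  exact: (col_ratio_le cT).
have q6 : q ^+ 6 <= mu * N / 32.
  rewrite crude_radN ler_pdivlMr // mulrC; exact: (@cX_le R q q2 32 5 6).
have x00 := x0 a; rewrite -/x in x00.
have [y ey] : exists y, y = N * x by exists (N * x).
have y0 : 0 <= y by rewrite ey mulr_ge0 // ltW.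
have ex : x = y / N by rewrite ey mulrC mulKf // gt_eqF.
have k1 : B <= (1 + mu / 32) * (1 + mu) * y.
  apply: le_trans h1 _; rewrite ey.
  have : (N + q ^+ 6) * ((1 + mu) * x) <= (N + mu * N / 32) * ((1 + mu) * x).
    by apply: ler_wpM2r; [apply: mulr_ge0; lra|lra].
  move=> hh; apply: le_trans hh _; apply: le_of_eq; ring.
have k2 : (1 - mu / 32) * y <= (1 + mu) * B.
  apply: le_trans h2; rewrite ey.
  have : (N - mu * N / 32) * x <= (N - q ^+ 6) * x by apply: ler_wpM2r; lra.
  move=> hh; apply: le_trans _ hh; apply: le_of_eq; ring.
have k3 : `|y - B| <= 2 * mu * B by exact: near_of_sandwich.
rewrite ex -mulrBl normrM normfV (ger0_norm (ltW pos)) mulrA.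
by apply: ler_wpM2r => //; rewrite invr_ge0 ltW.
Qed.

(** The weights of another column turn the sum of U a j into a column sum plus theta times an inner
    product of distinct columns, of size T and not N. This makes the first-order term of the cross
    ratio average out in [cross_ratio_col]. *)
Lemma free_wU U (l : seq 'I_n) j k : flat q T U -> j != k -> uniq l -> (size l)%:R <= q ^+ 4 ->
  `|\sum_(a | a \notin l) W U a k * U a j| <= q ^+ 7 * T.
Proof.
move=> flU jk ul sl.
have q0 : 0 <= q by slra.
rewrite sum_notin //.
have h1 : `|\sum_i W U i k * U i j| <= q + T.
  rewrite (_ : \sum_i _ = \sum_i U i j + th * \sum_i U i j * U i k); last first.
    by rewrite mulr_sumr -big_split /=; apply: eq_bigr => i _; rewrite /wt; ring.
  case: (flU) => -[_ hc hcc] _.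
  apply: le_trans (ler_normD _ _) _; apply: lerD; first exact: hc.
  rewrite normrM (ger0_norm th0) -[X in _ <= X]mul1r; apply: ler_pM => //; exact: hcc.
have h2 : `|\sum_(i <- l) W U i k * U i j| <= q ^+ 6.
  apply: le_trans (ler_norm_sum _ _ _) _.
  apply: le_trans (_ : \sum_(i <- l) q * q <= _).
    apply: ler_sum => i _; rewrite normrM; apply: ler_pM => //.
      by rewrite ger0_norm; [exact: (wt_le flU th0 th1 q2 qT)|exact: (wt_ge0 flU)].
    exact: (U_abs flU th0 th1 q2 qT).
  rewrite big_const_seq count_predT iter_addr_0 -[_ *+ size l]mulr_natl -expr2 (exprD q 4 2).
  by apply: ler_wpM2r => //; apply: exprn_ge0.
apply: le_trans (ler_normB _ _) _.
have T1 := T_ge1.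
have g1 : q ^+ 6 <= q ^+ 6 * T by apply: ler_peMr => //; exact: exprn_ge0.
have g2 : T <= q ^+ 2 * T by apply: ler_peMl; [slra|exact: (qX_ge1 q2)].
have g3 : q ^+ 7 * T = q * (q ^+ 6 * T) by rewrite exprS mulrA.
have g4 : 2 * (q ^+ 6 * T) <= q * (q ^+ 6 * T).
  by apply: ler_wpM2r => //; apply: mulr_ge0; [exact: exprn_ge0|slra].
have g5 : 4 * T <= q ^+ 6 * T.
  apply: ler_wpM2r; first by slra.
  apply: (le_trans (@natX_le R q q2 4 2 isT)); exact: (qX_le q2).
move: h1 h2; slra.
Qed.

(** A ceiling for E kept along the iteration: below it, replacing products of partial permanents by
    their common approximation costs mu E, of order q^25 / N^2. *)
Definition cross_rad : R := 2 * q ^+ 14 / N.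

(** The hypothesis on cross ratios splits x a x' b - x' a x b into a first-order term and an error.
    The first-order term factors into sums bounded by [free_wU], which is why l and l' must avoid j
    and k; the error is antisymmetric and is contracted by the overlap of columns j and k. *)
Lemma cross_ratio_col U e E rho l l' j k : flat q T U -> (e + K).+2%:R <= q ^+ 4 -> 0 <= E -> E <= cross_rad ->
  cross_ratio U e E -> injpairs rho -> size rho = e -> l \notin unzip2 rho -> l' \notin unzip2 rho ->
  l != l' -> j != k -> l \notin [:: j; k] -> l' \notin [:: j; k] ->
  forall x x', x = (fun a => pm (W U) ((a, l) :: rho)) -> x' = (fun a => pm (W U) ((a, l') :: rho)) ->
  `|\sum_(a | a \notin unzip1 rho) \sum_(b | b \notin unzip1 rho)
     W U a k * W U b j * (x a * x' b - x' a * x b)| <=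
  pm (W U) rho ^+ 2 * ((1 - (8 * q ^+ 2)^-1) * E + q ^+ 30 * T / N ^+ 2).
Proof.
move=> flU dq E0 Eq hrc ir sr lr lr' nll njk ljk ljk' x x' ex ex'.
have xE a : x a = pm (W U) ((a, l) :: rho) by rewrite ex.
have xE' a : x' a = pm (W U) ((a, l') :: rho) by rewrite ex'.
have x0 a : 0 <= x a by rewrite ex; exact: pmW_ge0.
have x'0 a : 0 <= x' a by rewrite ex'; exact: pmW_ge0.
have m0 := crude_rad_ge0; have m1 := crude_rad_le; have pos := N_gt0.
have q0 : 0 < q by slra.
have T1 := T_ge1.
have B0 := pmW_ge0 rho flU; set B := pm _ rho in B0 *.
set X := B / N.
have X0 : 0 <= X by rewrite divr_ge0 // ltW.
have ur : uniq (unzip1 rho) by case/andP: ir.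
have sr4 : (size (unzip1 rho))%:R <= q ^+ 4.
  by rewrite size_map sr; apply: le_trans dq; rewrite ler_nat !leqW // leq_addr.
have w0 b c : 0 <= W U b c by exact: (wt_ge0 flU).
pose u a b := U a l + U b l' - U a l' - U b l.
have uq a b : `|u a b| <= 4 * q by exact: u_abs.
(* With [X ^+ 2] in place of x' a x b the remainder is exactly antisymmetric; the replacement costs
   the terms with [mu] in [E']. *)
pose D a b := x a * x' b - x' a * x b - th / N * u a b * X ^+ 2.
pose E' := E * (1 + 5 * mu) + 20 * q * mu / N.
have E'0 : 0 <= E'.
  apply: addr_ge0; first by apply: mulr_ge0 => //; lra.
  by apply: divr_ge0; [apply: mulr_ge0 => //; lra|exact: ltW].
have near a b : a \notin unzip1 rho -> b \notin unzip1 rho ->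
    `|x' a * x b - X ^+ 2| <= 5 * mu * X ^+ 2.
  move=> ar br.
  have := pm_near flU dq ir sr ar lr'; have := pm_near flU dq ir sr br lr.
  rewrite -/B -/X -xE -xE' => h1 h2.
  exact: prod_near.
have hD a b : a \notin unzip1 rho -> b \notin unzip1 rho -> `|D a b| <= E' * X ^+ 2.
  move=> ar br.
  have [<-|nab] := eqVneq a b.
    rewrite /D (_ : _ - _ = 0); last by rewrite /u; ring.
    by rewrite normr0 mulr_ge0 // sqr_ge0.
  have := hrc rho a b l l' ir sr ar br nab lr lr' nll _ erefl; rewrite /= -!xE -!xE'.
  set Y := x' a * x b => h1.
  have hY := near a b ar br; rewrite -/Y in hY.
  have -> : D a b = (x a * x' b - Y - th / N * u a b * Y) + th / N * u a b * (Y - X ^+ 2).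
    by rewrite /D /Y; ring.
  apply: le_trans (ler_normD _ _) _.
  have g1 : E * Y <= E * ((1 + 5 * mu) * X ^+ 2).
    apply: ler_wpM2l => //; move: hY; rewrite ler_norml => /andP[_ ?]; lra.
  have g2 : `|th / N * u a b * (Y - X ^+ 2)| <= 1 / N * (4 * q) * (5 * mu * X ^+ 2).
    rewrite normrM; apply: ler_pM => //; rewrite normrM; apply: ler_pM => //.
    rewrite ger0_norm; last by rewrite divr_ge0 // ltW.
    by apply: ler_wpM2r => //; rewrite invr_ge0 ltW.
  rewrite /E' mulrDl; apply: lerD; first by apply: le_trans h1 _; lra.
  by apply: le_trans g2 _; apply: le_of_eq; ring.
have csk := free_col_sum flU th0 th1 q2 qT k ur sr4.
have csj := free_col_sum flU th0 th1 q2 qT j ur sr4.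
have q6N : 24 * q ^+ 8 <= N.
  apply: le_trans (@cX_le R q q2 24 5 8 isT) _; exact: (qN q2 qT nbig).
have q6N' : q ^+ 6 <= N by exact: (qN q2 qT nbig).
have kj : k != j by rewrite eq_sym.
have mo := free_min_sum flU th0 th1 q2 qT nbig kj ur sr4.
have o0 : 0 <= N / (2 * q) by apply: divr_ge0; [exact: ltW | lra].
have M0 : 0 <= E' * X ^+ 2 by apply: mulr_ge0 => //; exact: sqr_ge0.
have aD a b : D b a = - D a b by rewrite /D /u; ring.
have main := antisym_sum_le (fun a _ => w0 a k) (fun a _ => w0 a j) aD M0 hD
  (_ : _ <= N + q ^+ 6) (_ : _ <= N + q ^+ 6) o0 mo.
have {}main : `|\sum_(a | a \notin unzip1 rho) \sum_(b | b \notin unzip1 rho)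
     W U a k * W U b j * D a b| <= E' * X ^+ 2 * ((N + q ^+ 6) * (N + q ^+ 6) - (N / (2 * q)) ^+ 2).
  apply: main; [exact: ler_distlDr csk|exact: ler_distlDr csj].
have split : \sum_(a | a \notin unzip1 rho) \sum_(b | b \notin unzip1 rho)
     W U a k * W U b j * (x a * x' b - x' a * x b) =
   \sum_(a | a \notin unzip1 rho) \sum_(b | b \notin unzip1 rho)
     W U a k * W U b j * D a b +
   th / N * X ^+ 2 * (
     (\sum_(a | a \notin unzip1 rho) W U a k * U a l - \sum_(a | a \notin unzip1 rho) W U a k * U a l')
       * (\sum_(b | b \notin unzip1 rho) W U b j) +
     (\sum_(a | a \notin unzip1 rho) W U a k) *
     (\sum_(b | b \notin unzip1 rho) W U b j * U b l' - \sum_(b | b \notin unzip1 rho) W U b j * U b l)).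
  rewrite -!sumrB !big_distrlr /= -big_split mulr_sumr -big_split /=; apply: eq_bigr => a _.
  rewrite -big_split mulr_sumr -big_split /=; apply: eq_bigr => b _.
  by rewrite /D /u; ring.
rewrite split; apply: le_trans (ler_normD _ _) _.
move: ljk ljk'; rewrite !inE !negb_or => /andP[lj lk] /andP[lj' lk'].
have s1 := free_wU flU lk ur sr4; have s2 := free_wU flU lk' ur sr4.
have s3 := free_wU flU lj ur sr4; have s4 := free_wU flU lj' ur sr4.
set g := q ^+ 7 * T in s1 s2 s3 s4.
have T0 : 0 <= T by exact: le_trans T1.
have g0 : 0 <= g by apply: mulr_ge0 => //; apply: exprn_ge0; exact: ltW.
have {csk}csk := norm_le_double csk q6N'; have {csj}csj := norm_le_double csj q6N'.
set S1 := _ * _ + _ * _.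
have hS1 : `|S1| <= 8 * g * N.
  apply: le_trans (ler_normD _ _) _.
  rewrite (_ : 8 * g * N = 2 * g * (2 * N) + 2 * g * (2 * N)); last by ring.
  apply: lerD; first exact: norm_diff_mul.
  by rewrite mulrC; exact: norm_diff_mul.
have hT : `|th / N * X ^+ 2 * S1| <= X ^+ 2 * (8 * g).
  have tX : th / N * X ^+ 2 <= 1 / N * X ^+ 2.
    apply: ler_wpM2r; first exact: sqr_ge0.
    by apply: ler_wpM2r => //; rewrite invr_ge0 ltW.
  have tX0 : 0 <= th / N * X ^+ 2.
    by apply: mulr_ge0; [rewrite divr_ge0 // ltW|exact: sqr_ge0].
  rewrite normrM ger0_norm //; apply: le_trans (ler_pM tX0 (normr_ge0 _) tX hS1) _.
  by apply: le_of_eq; field; rewrite gt_eqF.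
have -> : B ^+ 2 = X ^+ 2 * N ^+ 2 by rewrite /X; field; rewrite gt_eqF.
apply: le_trans (lerD main hT) _.
rewrite -mulrA [E' * _]mulrCA -mulrDr -mulrA; apply: ler_wpM2l; first exact: sqr_ge0.
(* The gain O^2 is N^2 / (4 q^2); half of it absorbs the deviation of the column sums from N. *)
have hN2 : (N + q ^+ 6) * (N + q ^+ 6) - (N / (2 * q)) ^+ 2 <= N ^+ 2 * (1 - (8 * q ^+ 2)^-1).
  have -> : (N / (2 * q)) ^+ 2 = 2 * (N ^+ 2 * (8 * q ^+ 2)^-1) by field; rewrite gt_eqF.
  have : 3 * q ^+ 6 * N <= N ^+ 2 * (8 * q ^+ 2)^-1.
    rewrite ler_pdivlMr; last by rewrite mulr_gt0 // exprn_gt0.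
    have -> : 3 * q ^+ 6 * N * (8 * q ^+ 2) = N * (24 * q ^+ 8) by ring.
    by rewrite expr2; apply: ler_wpM2l => //; exact: ltW.
  have : q ^+ 6 * q ^+ 6 <= q ^+ 6 * N by apply: ler_wpM2l => //; apply: exprn_ge0; exact: ltW.
  by move=> ? ?; exact: square_overlap.
have h1 : E' * ((N + q ^+ 6) * (N + q ^+ 6) - (N / (2 * q)) ^+ 2) <=
   E' * (N ^+ 2 * (1 - (8 * q ^+ 2)^-1)) by exact: ler_wpM2l.
set o := (8 * q ^+ 2)^-1 in h1 hN2 *.
have o0' : 0 <= o by rewrite invr_ge0 mulr_ge0 // exprn_ge0 // ltW.
have o1 : o <= 1.
  rewrite invf_le1; last by rewrite mulr_gt0 // exprn_gt0.
  by apply: le_trans (qX_ge1 q2 2) _; rewrite ler_peMl ?(ler_nat _ 1) // exprn_ge0 // ltW.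
have -> : N ^+ 2 * ((1 - o) * E + q ^+ 30 * T / N ^+ 2) = N ^+ 2 * (1 - o) * E + q ^+ 30 * T.
  by field; rewrite gt_eqF.
have h2 : E' * (N ^+ 2 * (1 - o)) <= N ^+ 2 * (1 - o) * E + 10 * q ^+ 25 + 20 * q ^+ 12.
  have r1 : N ^+ 2 * (5 * mu * E) <= 10 * q ^+ 25.
    have -> : N ^+ 2 * (5 * mu * E) = 5 * q ^+ 11 * (N * E) by rewrite -crude_radN; ring.
    have : N * E <= 2 * q ^+ 14.
      by rewrite mulrC -ler_pdivlMr //.
    have q11 : 0 <= 5 * q ^+ 11 by rewrite mulr_ge0 // exprn_ge0 // ltW.
    move=> /(ler_wpM2l q11); rewrite (_ : 5 * q ^+ 11 * (2 * q ^+ 14) = 10 * q ^+ 25) //; ring.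
  have r2 : N ^+ 2 * (20 * q * mu / N) = 20 * q ^+ 12.
    have -> : 20 * q ^+ 12 = 20 * q * (mu * N) by rewrite crude_radN; ring.
    by field; rewrite gt_eqF.
  have E5 : 0 <= N ^+ 2 * (5 * mu * E).
    by apply: mulr_ge0; [exact: sqr_ge0|do 2!apply: mulr_ge0 => //].
  have r3 : 0 <= N ^+ 2 * (20 * q * mu / N) by rewrite r2 mulr_ge0 // exprn_ge0 // ltW.
  have -> : E' * (N ^+ 2 * (1 - o)) = N ^+ 2 * (1 - o) * E + (1 - o) * (N ^+ 2 * (5 * mu * E))
    + (1 - o) * (N ^+ 2 * (20 * q * mu / N)) by rewrite /E'; ring.
  have o1' : 1 - o <= 1 by rewrite gerBl.
  have z1 := ler_wpM2r E5 o1'; have z2 := ler_wpM2r r3 o1'.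
  rewrite !mul1r in z1 z2; rewrite r2 in z2 *.
  by apply: lerD => //; rewrite lerD2l; exact: le_trans r1.
have h3 : 10 * q ^+ 25 + 20 * q ^+ 12 + 8 * g <= q ^+ 30 * T by exact: power_absorb.
apply: le_trans (lerD (le_trans h1 h2) (lexx _)) _.
by rewrite -!addrA lerD2l addrA.
Qed.

End Crude.

Lemma wsum_near (R : realFieldType) (I : finType) (A : pred I) (w x : I -> R) (N Q m B : R) :
  (forall l, A l -> 0 <= w l) -> (forall l, A l -> `|x l - B| <= m * B) ->
  `|\sum_(l | A l) w l - N| <= Q -> Q <= N -> 0 <= m -> 0 <= B ->
  `|\sum_(l | A l) w l * x l - N * B| <= (Q + 2 * m * N) * B.
Proof.
move=> w0 hx hw QN m0 B0.
have -> : \sum_(l | A l) w l * x l - N * B =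
    \sum_(l | A l) w l * (x l - B) + (\sum_(l | A l) w l - N) * B.
  under [X in _ = X + _]eq_bigr => l _ do rewrite mulrBr.
  by rewrite sumrB -mulr_suml; ring.
have h1 : `|\sum_(l | A l) w l * (x l - B)| <= (\sum_(l | A l) w l) * (m * B).
  apply: le_trans (ler_norm_sum _ _ _) _; rewrite mulr_suml; apply: ler_sum => l Al.
  by rewrite normrM ger0_norm ?w0 //; apply: ler_wpM2l; [exact: w0|exact: hx].
have h2 : `|(\sum_(l | A l) w l - N) * B| <= Q * B.
  by rewrite normrM (ger0_norm B0); apply: ler_wpM2r.
have h3 : \sum_(l | A l) w l <= 2 * N.
  by move: hw; rewrite ler_norml => /andP[_ ?]; lra.
have h4 := ler_wpM2r (mulr_ge0 m0 B0) h3.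
by apply: le_trans (ler_normD _ _) _; lra.
Qed.

Lemma near_mul (R : realFieldType) (x y c d : R) : 0 <= c -> `|x - c| <= d -> `|y - c| <= d ->
  `|x * y - c ^+ 2| <= 2 * (c * d) + d ^+ 2.
Proof.
move=> c0 hx hy.
have -> : x * y - c ^+ 2 = (x - c) * (y - c) + (x - c) * c + c * (y - c) by ring.
have h1 : `|(x - c) * (y - c)| <= d * d by rewrite normrM; apply: ler_pM.
have h2 : `|(x - c) * c| <= d * c by rewrite normrM (ger0_norm c0); apply: ler_wpM2r.
have h3 : `|c * (y - c)| <= c * d by rewrite normrM (ger0_norm c0); apply: ler_wpM2l.
apply: le_trans (ler_normD _ _) _.
have := ler_normD ((x - c) * (y - c)) ((x - c) * c).
rewrite expr2; lra.
Qed.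

Lemma mul_norm_le (R : realFieldType) (a x c d : R) : 0 <= a -> a <= c -> `|x| <= d ->
  `|a * x| <= c * d.
Proof. by move=> a0 ac xd; rewrite normrM ger0_norm //; apply: ler_pM. Qed.

(** Each factor is one entry times B plus a sum of size N B. Products of an entry with such a sum
    give the first-order term, products of two entries are of lower order, and the difference of the
    products of sums is the assumption with [al]. *)
Lemma row_arith (R : realFieldType) (N q B wk wj vk vj Swp Swq Svp Svq al : R) :
  2 <= q -> q ^+ 40 <= N -> 0 <= B ->
  0 <= wk <= q -> 0 <= wj <= q -> 0 <= vk <= q -> 0 <= vj <= q ->
  `|Swp - N * B| <= 5 * q ^+ 11 * B -> `|Swq - N * B| <= 5 * q ^+ 11 * B ->
  `|Svp - N * B| <= 5 * q ^+ 11 * B -> `|Svq - N * B| <= 5 * q ^+ 11 * B ->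
  0 <= al -> al <= q ^+ 16 / N ->
  `|Swp * Svq - Swq * Svp| <= (N + q ^+ 6) ^+ 2 * al * B ^+ 2 ->
  forall P3 P4, P3 = wj * B + Swq -> P4 = vk * B + Svp ->
  `|(wk * B + Swp) * (vj * B + Svq) - P3 * P4 - (wk + vj - wj - vk) / N * (P3 * P4)| <=
  (al + q ^+ 33 / N ^+ 2) * (P3 * P4).
Proof.
move=> q2 qN B0 /andP[wk0 wk1] /andP[wj0 wj1] /andP[vk0 vk1] /andP[vj0 vj1] hwp hwq hvp hvq al0 al1 hA P3 P4 eP3 eP4.
have q0 : 0 <= q by lra.
have qp k : 0 <= q ^+ k by exact: exprn_ge0.
have pos : 0 < N by apply: lt_le_trans qN; rewrite exprn_gt0 //; lra.
have q1 : q <= q ^+ 11 by rewrite -{1}(expr1 q); exact: (qX_le q2).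
have near3 (y S : R) : 0 <= y -> y <= q -> `|S - N * B| <= 5 * q ^+ 11 * B ->
    `|y * B + S - N * B| <= 6 * q ^+ 11 * B.
  move=> y0 y1 hS; have -> : y * B + S - N * B = y * B + (S - N * B) by ring.
  apply: le_trans (ler_normD _ _) _; rewrite ger0_norm ?mulr_ge0 //.
  have : y * B <= q ^+ 11 * B by apply: ler_wpM2r => //; exact: le_trans q1.
  by lra.
have h3 := near3 _ _ wj0 wj1 hwq; have h4 := near3 _ _ vk0 vk1 hvp; rewrite -eP3 in h3; rewrite -eP4 in h4.
have NB0 : 0 <= N * B by rewrite mulr_ge0 // ltW.
have B2 : 0 <= B ^+ 2 by exact: sqr_ge0.
have hPi : `|P3 * P4 - (N * B) ^+ 2| <= 13 * q ^+ 11 * N * B ^+ 2.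
  apply: le_trans (near_mul NB0 h3 h4) _.
  have : 36 * q ^+ 22 * B ^+ 2 <= q ^+ 11 * N * B ^+ 2.
    apply: ler_wpM2r => //; apply: le_trans (@cX_le R q q2 36 6 22 isT) _.
    apply: le_trans (_ : q ^+ 11 * q ^+ 40 <= _); last exact: ler_wpM2l.
    by rewrite -exprD; exact: (qX_le q2).
  have -> : (6 * q ^+ 11 * B) ^+ 2 = 36 * q ^+ 22 * B ^+ 2 by ring.
  have -> : 2 * (N * B * (6 * q ^+ 11 * B)) = 12 * (q ^+ 11 * N * B ^+ 2) by ring.
  by lra.
set Pi := P3 * P4 in hPi *; set u := wk + vj - wj - vk.
have hu : `|u| <= 2 * q.
  have -> : u = (wk - wj) + (vj - vk) by rewrite /u; ring.
  apply: le_trans (ler_normD _ _) _; rewrite mulr_natl mulr2n.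
  by apply: lerD; apply: dist_le_bound; apply/andP.
pose T1 := B ^+ 2 * (wk * vj - wj * vk) +
  B * (wk * (Svq - N * B) + vj * (Swp - N * B) - wj * (Svp - N * B) - vk * (Swq - N * B)).
have e : (wk * B + Swp) * (vj * B + Svq) - Pi - u / N * Pi =
    T1 + (Swp * Svq - Swq * Svp) - u / N * (Pi - (N * B) ^+ 2).
  by rewrite /Pi eP3 eP4 /T1 /u; field; rewrite gt_eqF.
have hT : `|T1| <= 21 * q ^+ 12 * B ^+ 2.
  have z1 : `|B ^+ 2 * (wk * vj - wj * vk)| <= B ^+ 2 * q ^+ 2.
    rewrite normrM (ger0_norm B2); apply: ler_wpM2l => //.
    have k1 : wk * vj <= q ^+ 2 by rewrite expr2; apply: ler_pM.
    have k2 : wj * vk <= q ^+ 2 by rewrite expr2; apply: ler_pM.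
    have k3 : 0 <= wk * vj by apply: mulr_ge0.
    have k4 : 0 <= wj * vk by apply: mulr_ge0.
    by apply: dist_le_bound; apply/andP.
  have z2 := mul_norm_le wk0 wk1 hvq; have z3 := mul_norm_le vj0 vj1 hwp.
  have z4 := mul_norm_le wj0 wj1 hvp; have z5 := mul_norm_le vk0 vk1 hwq.
  apply: le_trans (ler_normD _ _) _; rewrite [`|B * _|]normrM (ger0_norm B0).
  have z6 : `|wk * (Svq - N * B) + vj * (Swp - N * B) - wj * (Svp - N * B) - vk * (Swq - N * B)|
      <= 4 * (q * (5 * q ^+ 11 * B)).
    exact: norm_alternating4.
  have z7 := ler_wpM2l B0 z6.
  have z8 : B ^+ 2 * q ^+ 2 <= B ^+ 2 * q ^+ 12 by apply: ler_wpM2l => //; exact: (qX_le q2).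
  have z9 : B * (4 * (q * (5 * q ^+ 11 * B))) = 20 * q ^+ 12 * B ^+ 2 by ring.
  rewrite z9 in z7; rewrite (_ : 21 * _ * _ = B ^+ 2 * q ^+ 12 + 20 * q ^+ 12 * B ^+ 2); last by ring.
  by apply: lerD => //; exact: le_trans z8.
have hU : `|u / N * (Pi - (N * B) ^+ 2)| <= 26 * q ^+ 12 * B ^+ 2.
  have -> : 26 * q ^+ 12 * B ^+ 2 = (2 * q) / N * (13 * q ^+ 11 * N * B ^+ 2).
    by field; rewrite gt_eqF.
  rewrite normrM normrM normfV (ger0_norm (ltW pos)); apply: ler_pM => //.
    by rewrite divr_ge0 // ltW.
  by apply: ler_wpM2r => //; rewrite invr_ge0 ltW.
rewrite e; apply: le_trans (ler_normB _ _) _.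
apply: le_trans (lerD (ler_normD _ _) (lexx _)) _.
apply: le_trans (lerD (lerD hT hA) hU) _.
have hPi' : (N ^+ 2 - 13 * q ^+ 11 * N) * B ^+ 2 <= Pi.
  by move: hPi; rewrite ler_norml => /andP[? _]; rewrite mulrBl -exprMn; lra.
have be0 : 0 <= q ^+ 33 / N ^+ 2 by rewrite divr_ge0 // sqr_ge0.
apply: le_trans (ler_wpM2l (addr_ge0 al0 be0) hPi').
rewrite [X in X <= _](_ : _ = (47 * q ^+ 12 + (N + q ^+ 6) ^+ 2 * al) * B ^+ 2); last by ring.
rewrite [X in _ <= X]mulrA; apply: ler_wpM2r => //.
have a1 : al * N <= q ^+ 16 by rewrite -ler_pdivlMr.
have a2 : al * N * (13 * q ^+ 11) <= q ^+ 16 * (13 * q ^+ 11).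
  by apply: ler_wpM2r => //; rewrite mulr_ge0.
have a3 : al * N * q ^+ 6 <= q ^+ 16 * q ^+ 6 by apply: ler_wpM2r.
have N1 : 1 <= N by apply: le_trans (qX_ge1 q2 40) qN.
have a4 : al * q ^+ 12 <= q ^+ 16 * q ^+ 12.
  apply: ler_wpM2r => //; apply: le_trans a1; exact: ler_peMr.
have be1 : q ^+ 33 / N ^+ 2 * N ^+ 2 = q ^+ 33 by rewrite divfK // gt_eqF // exprn_gt0.
have be2 : q ^+ 33 / N ^+ 2 * (13 * q ^+ 11 * N) <= q ^+ 33 / 2.
  have -> : q ^+ 33 / N ^+ 2 * (13 * q ^+ 11 * N) = q ^+ 33 * (13 * q ^+ 11 / N).
    by field; rewrite gt_eqF.
  apply: ler_wpM2l => //; rewrite ler_pdivrMr //.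
  have := @cX_le R q q2 32 5 11 isT; have := qX_le q2 (isT : (5 + 11 <= 40)%N); lra.
have p1 := @cX_le R q q2 64 6 12 isT; have p2 := @cX_le R q q2 16 4 27 isT.
have p3 : q ^+ (6 + 12) <= q ^+ 28 by exact: (qX_le q2).
have p4 : 8 * q ^+ 28 <= q ^+ 31 by exact: (@cX_le R q q2 8 3 28).
have p5 : 2 * q ^+ 31 <= q ^+ 32 by exact: (@cX_le R q q2 2 1 31).
have p6 : 2 * q ^+ 32 <= q ^+ 33 by exact: (@cX_le R q q2 2 1 32).
have p7 : q ^+ 22 <= q ^+ 28 by exact: (qX_le q2).
have r1 : q ^+ 16 * (13 * q ^+ 11) = 13 * q ^+ 27 by ring.
have r2 : q ^+ 16 * q ^+ 6 = q ^+ 22 by ring.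
have r3 : q ^+ 16 * q ^+ 12 = q ^+ 28 by ring.
have -> : (N + q ^+ 6) ^+ 2 * al = al * N ^+ 2 + 2 * (al * N * q ^+ 6) + al * q ^+ 12 by ring.
have -> : (al + q ^+ 33 / N ^+ 2) * (N ^+ 2 - 13 * q ^+ 11 * N) =
   al * N ^+ 2 - al * N * (13 * q ^+ 11) + q ^+ 33 / N ^+ 2 * N ^+ 2
   - q ^+ 33 / N ^+ 2 * (13 * q ^+ 11 * N) by ring.
rewrite be1 r1 in a2 *; rewrite r2 in a3; rewrite r3 in a4.
have p8 := qp 12; have p9 := qp 27; have p10 := qp 28.
set Z := _ * (13 * q ^+ 11 * N) in be2 *.
clear - a2 a3 a4 be2 p1 p2 p3 p4 p5 p6 p7 p8 p9 p10; clearbody Z.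
rewrite [(6 + 12)%N]/= in p1 p3; rewrite [(4 + 27)%N]/= in p2; lra.
Qed.

Section RowStep.
Variables (R : realFieldType) (n : nat) (th q T : R) (K : nat).
Hypotheses (th0 : 0 <= th) (th1 : th <= 1) (q2 : 2 <= q) (qT : q <= T).
Local Notation W := (wt th).
Local Notation N := (n%:R : R).
Hypothesis nbig : q ^+ 60 * T <= N.
Hypothesis Kbig : (1 - (16 * q ^+ 2)^-1) ^+ K <= (N ^+ 2)^-1.
Implicit Types (U : 'I_n -> 'I_n -> R).
Local Notation mu := (crude_rad n q).

Lemma crude_near d U rho i j k : flat q T U -> (d + K).+2%:R <= q ^+ 4 ->
  injpairs rho -> size rho = d -> i \notin unzip1 rho -> j \notin unzip2 rho ->
  k \notin unzip2 rho ->
  `|pm (W U) ((i, j) :: rho) - pm (W U) ((i, k) :: rho)| <= mu * pm (W U) ((i, k) :: rho).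
Proof.
move=> flU dq ir sr ii jj kk.
have c := row_ratio_crude th0 th1 q2 qT nbig Kbig flU dq.
have h1 := c rho i j k ir sr ii jj kk; have h2 := c rho i k j ir sr ii kk jj.
have m0 : 0 <= mu by exact: crude_rad_ge0 th0 th1 q2 qT nbig.
have x0 : 0 <= pm (W U) ((i, j) :: rho) by apply: pm_ge0 => a b; exact: (wt_ge0 flU).
move: h1 h2 x0; set x := pm _ _; set y := pm _ _ => h1 h2 x0.
rewrite mulrDl mul1r in h1 h2.
rewrite ler_norml; apply/andP; split; last by rewrite lerBlDl.
have [xy|yx] := leP x y.
  by have := ler_wpM2l m0 xy; lra.
suff : 0 <= mu * y by lra.
apply: mulr_ge0 => //; have m1 : 0 < 1 + mu by rewrite ltr_pwDl.
by rewrite -(pmulr_rge0 _ m1) mulrDl mul1r; apply: le_trans h1.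
Qed.

Lemma pm_cons2 (V : 'I_n -> 'I_n -> R) rho i i' j k : pm V ((i, j) :: (i', k) :: rho) = pm V ((i', k) :: (i, j) :: rho).
Proof. by apply: eq_pm; apply/seq.permP => p /=; rewrite addnCA. Qed.

Lemma pm_rot3 (V : 'I_n -> 'I_n -> R) rho i i' i'' j k l :
  pm V ((i, j) :: (i', k) :: (i'', l) :: rho) = pm V ((i', k) :: (i'', l) :: (i, j) :: rho).
Proof. by apply: eq_pm; apply/seq.permP => p /=; lia. Qed.

(* Expanding along two rows and then along two columns leaves an antisymmetric form in
   the errors of depth d.+2, on which the overlap of two columns contracts. *)
Lemma cross_ratio_step d U (E : R) : flat q T U -> (d.+2 + K).+2%:R <= q ^+ 4 ->
  0 <= E -> E <= cross_rad n q -> cross_ratio th U d.+2 E ->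
  cross_ratio th U d ((1 - (8 * q ^+ 2)^-1) * E + q ^+ 30 * T / N ^+ 2 + q ^+ 33 / N ^+ 2).
Proof.
move=> flU dq E0 Eq hrc rho i i' j k ir sr ii ii' nii jj kk njk P eP.
have q0 : 0 <= q by move: q2; lra.
have T0 : 0 <= T by move: q0 qT; lra.
have pos := N_gt0 q2 qT nbig.
have w0 a b : 0 <= W U a b by exact: (wt_ge0 flU).
have wq a b : W U a b <= q by exact: (wt_le flU th0 th1 q2 qT).
have pg r : 0 <= pm (W U) r by exact: pm_ge0.
have m0 := crude_rad_ge0 th0 th1 q2 qT nbig.
have kj : k != j by rewrite eq_sym.
set rho3 := (i', k) :: (i, j) :: rho; set B := pm (W U) rho3.
have ir3 : injpairs rho3.
  by rewrite !injpairs_cons /= !inE !negb_or ii jj ir ii' kk (eq_sym i') nii kj.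
have sr3 : size rho3 = d.+2 by rewrite /= sr.
pose L (l : 'I_n) := l \notin unzip2 rho3.
have LE l : L l = [&& l != k, l != j & l \notin unzip2 rho] by rewrite /L /= !inE !negb_or.
pose p l := pm (W U) ((i', l) :: (i, j) :: rho).
pose r l := pm (W U) ((i', l) :: (i, k) :: rho).
have Bswap : pm (W U) ((i', j) :: (i, k) :: rho) = B.
  by rewrite /B /rho3 pm_swap // eq_sym.
have eq1 (F : 'I_n -> R) : \sum_(l | l \notin unzip2 ((i, j) :: rho)) F l = F k + \sum_(l | L l) F l.
  rewrite (bigD1 k) /=; last by rewrite inE negb_or kj.
  by congr (_ + _); apply: eq_bigl => l; rewrite LE inE negb_or andbC.
have eq2 (F : 'I_n -> R) : \sum_(l | l \notin unzip2 ((i, k) :: rho)) F l = F j + \sum_(l | L l) F l.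
  rewrite (bigD1 j) /=; last by rewrite inE negb_or njk.
  by congr (_ + _); apply: eq_bigl => l; rewrite LE inE negb_or andbC andbCA.
have e1 : P i j = W U i' k * B + \sum_(l | L l) W U i' l * p l.
  by rewrite eP (@pm_row _ _ _ _ i') ?eq1 // inE negb_or eq_sym nii.
have e2 : P i k = W U i' j * B + \sum_(l | L l) W U i' l * r l.
  by rewrite eP (@pm_row _ _ _ _ i') ?eq2 ?Bswap // inE negb_or eq_sym nii.
have e3 : P i' k = W U i j * B + \sum_(l | L l) W U i l * r l.
  rewrite eP (@pm_row _ _ _ _ i) ?eq2; last by rewrite inE negb_or nii.
  rewrite pm_cons2; congr (_ + _); apply: eq_bigr => l _.
  by rewrite pm_swap // pm_cons2.
have e4 : P i' j = W U i k * B + \sum_(l | L l) W U i l * p l.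
  rewrite eP (@pm_row _ _ _ _ i) ?eq1; last by rewrite inE negb_or nii.
  rewrite pm_cons2 Bswap; congr (_ + _); apply: eq_bigr => l _.
  by rewrite pm_swap // pm_cons2.
have dq1 : (d.+1 + K).+2%:R <= q ^+ 4 by apply: le_trans dq; rewrite ler_nat !addSn leqnSn.
have ir1 : injpairs ((i, j) :: rho) by rewrite injpairs_cons ii jj.
have ir2 : injpairs ((i, k) :: rho) by rewrite injpairs_cons ii kk.
have hp l : L l -> `|p l - B| <= mu * B.
  rewrite LE => /and3P[lk lj lr]; apply: (crude_near flU dq1 ir1) => //=; rewrite ?sr //.
  - by rewrite inE negb_or eq_sym nii.
  - by rewrite inE negb_or lj.
  - by rewrite inE negb_or kj.
have hr l : L l -> `|r l - B| <= mu * B.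
  rewrite LE => /and3P[lk lj lr]; rewrite -Bswap.
  apply: (crude_near flU dq1 ir2) => //=; rewrite ?sr //.
  - by rewrite inE negb_or eq_sym nii.
  - by rewrite inE negb_or lk.
  - by rewrite inE negb_or njk.
have uL : uniq (unzip2 rho3) by case/andP: ir3.
have sL : (size (unzip2 rho3))%:R <= q ^+ 4.
  by rewrite size_map sr3; apply: le_trans dq; rewrite ler_nat; apply/leqW/leqW/leq_addr.
have hw a : `|\sum_(l | L l) W U a l - N| <= q ^+ 6.
  exact: (free_col_sum (flat_tr flU) th0 th1 q2 qT a uL sL).
have q6N : q ^+ 6 <= N by exact: (qN q2 qT nbig).
have B0 : 0 <= B by exact: pg.
have near a (x : 'I_n -> R) : (forall l, L l -> `|x l - B| <= mu * B) ->
    `|\sum_(l | L l) W U a l * x l - N * B| <= 5 * q ^+ 11 * B.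
  move=> hx; apply: le_trans (wsum_near (fun l _ => w0 a l) hx (hw a) q6N m0 B0) _.
  apply: ler_wpM2r => //.
  have -> : 2 * mu * N = 2 * q ^+ 11 by rewrite -mulrA (crude_radN q2 qT nbig).
  by have := qX_le q2 (isT : (6 <= 11)%N); have := qX_ge1 q2 11; lra.
set al := (1 - (8 * q ^+ 2)^-1) * E + q ^+ 30 * T / N ^+ 2.
have o1 : (8 * q ^+ 2)^-1 <= 1.
  rewrite invf_le1; last by rewrite mulr_gt0 // exprn_gt0 // (lt_le_trans _ q2).
  by have := qX_ge1 q2 2; lra.
have o0 : 0 <= (8 * q ^+ 2)^-1 by rewrite invr_ge0 mulr_ge0 // sqr_ge0.
have qT0 : 0 <= q ^+ 30 * T / N ^+ 2.
  by rewrite divr_ge0 ?sqr_ge0 // mulr_ge0 // exprn_ge0.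
have al0 : 0 <= al by rewrite addr_ge0 // mulr_ge0 // subr_ge0.
have al1 : al <= q ^+ 16 / N.
  have z1 : (1 - (8 * q ^+ 2)^-1) * E <= 2 * q ^+ 14 / N.
    by apply: le_trans Eq; rewrite ler_piMl // gerBl.
  have z2 : q ^+ 30 * T / N ^+ 2 <= 1 / N.
    rewrite ler_pdivrMr ?exprn_gt0 // (_ : 1 / N * N ^+ 2 = N); last by field; rewrite gt_eqF.
    exact: (qTN q2 qT nbig).
  have z3 : (2 * q ^+ 14 + 1) / N <= q ^+ 16 / N.
    rewrite ler_pM2r ?invr_gt0 //.
    have := @cX_le R q q2 4 2 14 isT; have := qX_ge1 q2 14; rewrite (_ : 2 + 14 = 16)%N //; lra.
  rewrite /al; apply: le_trans (lerD z1 z2) _.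
  by apply: le_trans z3; rewrite -mulrDl.
have hA l l' : L l -> L l' -> `|p l * r l' - r l * p l'| <= B ^+ 2 * al.
  rewrite !LE => /and3P[lk lj lr] /and3P[lk' lj' lr'].
  have [<-|nll] := eqVneq l l'.
    by rewrite mulrC subrr normr0 mulr_ge0 // sqr_ge0.
  (* [p] is expanded along column k and [r] along column j; swapping brings both to the partial
     permanents over [rho3]. *)
  have exp l0 : l0 != k -> l0 != j -> l0 \notin unzip2 rho ->
      p l0 = \sum_(a | a \notin unzip1 rho3) W U a k * pm (W U) ((a, l0) :: rho3) /\
      r l0 = \sum_(a | a \notin unzip1 rho3) W U a j * pm (W U) ((a, l0) :: rho3).
    move=> k0 j0 r0; split.
      rewrite /p (@pm_expand2 _ _ _ _ _ i' k l0) //= ?inE ?negb_or ?(eq_sym i') ?nii ?kj ?j0 //.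
      by rewrite eq_sym.
    rewrite /r (@pm_expand2 _ _ _ _ _ i' j l0) //= ?inE ?negb_or ?(eq_sym i') ?nii ?njk ?k0 //; last by rewrite eq_sym.
    apply: eq_bigr => a; rewrite !inE !negb_or => /and3P[a1 a2 a3].
    congr (_ * _); rewrite pm_rot3 pm_swap //; first by rewrite -pm_rot3.
      by rewrite eq_sym.
    by rewrite inE negb_or eq_sym a1.
    by rewrite inE negb_or eq_sym a2.
  have [-> ->] := exp l lk lj lr; have [-> ->] := exp l' lk' lj' lr'.
  pose x a := pm (W U) ((a, l) :: rho3); pose x' a := pm (W U) ((a, l') :: rho3).
  have := cross_ratio_col th0 th1 q2 qT nbig Kbig flU dq E0 Eq hrc ir3 sr3 (l := l) (l' := l')
     (j := j) (k := k) _ _ nll njk _ _ (x := x) (x' := x') erefl erefl.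
  rewrite !inE !negb_or lk lj lr lk' lj' lr' => /(_ isT isT isT isT).
  rewrite -/B -/al; apply: le_trans; apply: le_of_eq.
  congr `|_|; rewrite !big_distrlr /= -/x -/x'.
  rewrite [X in _ - X]exchange_big /= -sumrB; apply: eq_bigr => a _.
  by rewrite -sumrB; apply: eq_bigr => b _; rewrite /x /x'; ring.
have main := row_arith (wk := W U i' k) (wj := W U i' j) (vk := W U i k) (vj := W U i j)
   q2 (_ : q ^+ 40 <= N) B0 _ _ _ _ (near i' p hp) (near i' r hr) (near i p hp) (near i r hr) al0 al1
   _ e2 e4.
rewrite e1 e3.
have -> : th / N * (U i j + U i' k - U i k - U i' j) =
   (W U i' k + W U i j - W U i' j - W U i k) / N by rewrite /wt; ring.
apply: main; rewrite ?w0 ?wq //; first exact: (qN q2 qT nbig).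
rewrite !big_distrlr /= -sumrB.
apply: le_trans (_ : \sum_(l | L l) \sum_(l' | L l') (W U i' l * W U i l') * (B ^+ 2 * al) <= _).
  apply: le_trans (ler_norm_sum _ _ _) _; apply: ler_sum => l Ll.
  rewrite -sumrB; apply: le_trans (ler_norm_sum _ _ _) _; apply: ler_sum => l' Ll'.
  have -> : W U i' l * p l * (W U i l' * r l') - W U i' l * r l * (W U i l' * p l') =
    (W U i' l * W U i l') * (p l * r l' - r l * p l') by ring.
  by rewrite normrM ger0_norm ?mulr_ge0 //; apply: ler_wpM2l; [exact: mulr_ge0|exact: hA].
under eq_bigr => l _ do rewrite -mulr_suml.
rewrite -mulr_suml -big_distrlr /= expr2 -[X in _ <= X]mulrA [al * _]mulrC.
apply: ler_wpM2r; first by rewrite mulr_ge0 // sqr_ge0.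
by apply: ler_pM; try exact: sumr_ge0; rewrite -lerBlDl; apply: le_trans (ler_norm _) (hw _).
Qed.

End RowStep.

(** * From cross ratios to the logarithmic derivative *)

Lemma norm_le_comb (R : realFieldType) (a b c : R) : `|a - b| <= c -> `|a| <= `|b| + c.
Proof. by move=> h; rewrite -[a in X in X <= _](subrK b) addrC; apply: le_trans (ler_normD _ _) _; rewrite lerD2l. Qed.

Lemma ler_norm_sum2 (R : numDomainType) (m n : nat) (F : 'I_m -> 'I_n -> R) (c : R) :
  (forall i j, `|F i j| <= c) -> `|\sum_i \sum_j F i j| <= m%:R * n%:R * c.
Proof.
by move=> h; rewrite -mulrA; apply: norm_sum_le_const => i; exact: norm_sum_le_const.
Qed.

(** Summing the cross ratio relation against U i j turns the first products into the derivative
    times the total of P, and the second into U paired with products of row and column sums of P. *)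
Lemma quad_sum_split (R : comPzRingType) (I : finType) (U P : I -> I -> R)
    (u : I -> I -> I -> I -> R) (c : R) :
  \sum_i \sum_j \sum_i' \sum_k U i j * (P i j * P i' k - P i k * P i' j - c * u i i' j k) =
  (\sum_i \sum_j U i j * P i j) * (\sum_i \sum_j P i j)
  - \sum_i \sum_j U i j * ((\sum_k P i k) * (\sum_i' P i' j))
  - c * \sum_i \sum_j \sum_i' \sum_k U i j * u i i' j k.
Proof.
rewrite mulr_suml mulr_sumr -!sumrB; apply: eq_bigr => i _.
rewrite mulr_suml mulr_sumr -!sumrB; apply: eq_bigr => j _.
rewrite [(\sum_k P i k) * _]mulrC big_distrlr !mulr_sumr -!sumrB; apply: eq_bigr => i' _.
by rewrite !mulr_sumr -!sumrB; apply: eq_bigr => k _ /=; ring.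
Qed.

(** Only the pairing of U i j with itself keeps the sum of squares with the full factor n^2; the
    other pairings collapse to squares of line sums or of the total, which flatness makes small. *)
Lemma quad_sum_cross (R : comPzRingType) (n : nat) (U : 'I_n -> 'I_n -> R) :
  \sum_i \sum_j \sum_i' \sum_k U i j * (U i j + U i' k - U i k - U i' j) =
  n%:R ^+ 2 * (\sum_i \sum_j U i j ^+ 2) + (\sum_i \sum_j U i j) ^+ 2
  - n%:R * (\sum_i (\sum_j U i j) ^+ 2) - n%:R * (\sum_j (\sum_i U i j) ^+ 2).
Proof.
have -> : (\sum_i \sum_j U i j) ^+ 2 = \sum_i \sum_j \sum_i' \sum_k U i j * U i' k.
  rewrite expr2 mulr_suml; apply: eq_bigr => i _; rewrite mulr_suml; apply: eq_bigr => j _.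
  by rewrite mulr_sumr; apply: eq_bigr => i' _; rewrite mulr_sumr.
have -> : n%:R ^+ 2 * (\sum_i \sum_j U i j ^+ 2) =
    \sum_i \sum_j \sum_(i' < n) \sum_(k < n) U i j * U i j.
  rewrite mulr_sumr; apply: eq_bigr => i _; rewrite mulr_sumr; apply: eq_bigr => j _.
  by rewrite !sumr_const !card_ord -[RHS]mulr_natl -[U i j * U i j *+ n]mulr_natl; ring.
have -> : n%:R * (\sum_i (\sum_j U i j) ^+ 2) =
    \sum_i \sum_j \sum_(i' < n) \sum_k U i j * U i k.
  rewrite mulr_sumr; apply: eq_bigr => i _; rewrite expr2 big_distrlr mulr_sumr /=.
  by apply: eq_bigr => j _; rewrite sumr_const card_ord mulr_natl.
have -> : n%:R * (\sum_j (\sum_i U i j) ^+ 2) =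
    \sum_i \sum_j \sum_i' \sum_(k < n) U i j * U i' j.
  rewrite exchange_big mulr_sumr; apply: eq_bigr => j _; rewrite expr2 big_distrlr mulr_sumr /=.
  apply: eq_bigr => i _; rewrite mulr_sumr; apply: eq_bigr => i' _.
  by rewrite sumr_const card_ord mulr_natl.
rewrite -big_split -!sumrB; apply: eq_bigr => i _.
rewrite -big_split -!sumrB; apply: eq_bigr => j _.
rewrite -big_split -!sumrB; apply: eq_bigr => i' _.
rewrite -big_split -!sumrB; apply: eq_bigr => k _ /=.
by ring.
Qed.

Section Derivative.
Variables (R : realFieldType) (n : nat) (th q T : R) (K : nat).
Hypotheses (th0 : 0 <= th) (th1 : th <= 1) (q2 : 2 <= q) (qT : q <= T).
Local Notation W := (wt th).
Local Notation N := (n%:R : R).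
Hypothesis nbig : q ^+ 60 * T <= N.
Hypothesis Kbig : (1 - (16 * q ^+ 2)^-1) ^+ K <= (N ^+ 2)^-1.
Hypothesis Kq : (3 * K).+4%:R <= q ^+ 4.
Variable (U : 'I_n -> 'I_n -> R).
Hypothesis flU : flat q T U.
Local Notation mu := (crude_rad n q).

Let pos : 0 < N := N_gt0 q2 qT nbig.
Let q0 : 0 < q. Proof. by move: q2; lra. Qed.
Let T0 : 0 < T. Proof. by move: q0 qT; lra. Qed.
Let T1 : 1 <= T. Proof. by move: q2 qT; lra. Qed.

Definition cross_err : R := q ^+ 41 * T / N ^+ 2.

(** 16 q^36 T / N^2 dominates the fixed point of the step at the slower rate 1 / (16 q^2). A step
    prescribes two more cells, and the crude comparison inside it needs K further ones, whence d + 2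
    t + K. *)
Lemma cross_ratio_iter t d : (d + 2 * t + K).+2%:R <= q ^+ 4 ->
  cross_ratio th U d ((1 - (16 * q ^+ 2)^-1) ^+ t * (q ^+ 14 / N) + 16 * q ^+ 36 * T / N ^+ 2).
Proof.
have P0 r : 0 <= pm (W U) r by apply: pm_ge0 => a b; exact: (wt_ge0 flU).
have F0 : 0 <= 16 * q ^+ 36 * T / N ^+ 2.
  by rewrite divr_ge0 ?sqr_ge0 // mulr_ge0 ?(ltW T0) // mulr_ge0 // exprn_ge0 // ltW.
have mono d' E E' : E <= E' -> cross_ratio th U d' E -> cross_ratio th U d' E'.
  move=> EE h rho i i' j k ir sr ii ii' nii jj kk njk P eP.
  apply: le_trans (h rho i i' j k ir sr ii ii' nii jj kk njk P eP) _.
  by apply: ler_wpM2r => //; apply: mulr_ge0; rewrite eP.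
elim: t d => [|t IH] d dq.
  apply: mono (cross_ratio_start th0 th1 q2 qT nbig Kbig flU _); last by move: dq; rewrite muln0 addn0.
  by rewrite expr0 mul1r lerDl.
have dq' : (d.+2 + 2 * t + K).+2%:R <= q ^+ 4.
  by move: dq; rewrite (_ : d.+2 + 2 * t = d + 2 * t.+1)%N // mulnS !addSnnS addnA.
have := IH d.+2 dq'; set E := _ + _ => hE.
set o := (16 * q ^+ 2)^-1 in E hE *.
have o0 : 0 <= o by rewrite invr_ge0 mulr_ge0 // sqr_ge0.
have o1 : o <= 1.
  rewrite invf_le1; last by rewrite mulr_gt0 // exprn_gt0.
  by have := qX_ge1 q2 2; lra.
have q14 : 0 <= q ^+ 14 / N by rewrite divr_ge0 ?(ltW pos) // exprn_ge0 // ltW.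
have ot0 : 0 <= (1 - o) ^+ t by rewrite exprn_ge0 // subr_ge0.
have E0 : 0 <= E by rewrite /E addr_ge0 // mulr_ge0.
have Ec : E <= cross_rad n q.
  have z1 : (1 - o) ^+ t * (q ^+ 14 / N) <= q ^+ 14 / N.
    by rewrite ler_piMl // exprn_ile1 // ?subr_ge0 // gerBl.
  have z2 : 16 * q ^+ 36 * T / N ^+ 2 <= q ^+ 14 / N.
    rewrite ler_pdivrMr ?exprn_gt0 // (_ : q ^+ 14 / N * N ^+ 2 = q ^+ 14 * N); last by field; rewrite gt_eqF.
    apply: le_trans (_ : q ^+ 14 * (q ^+ 26 * T) <= _); last first.
      apply: ler_wpM2l; [by apply: exprn_ge0; exact: ltW|exact: (qTN q2 qT nbig)].
    rewrite mulrA; apply: ler_wpM2r; first exact: ltW.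
    by rewrite -exprD; exact: (@cX_le R q q2 16 4 36).
  have -> : cross_rad n q = q ^+ 14 / N + q ^+ 14 / N by rewrite /cross_rad; ring.
  exact: lerD.
have st := cross_ratio_step th0 th1 q2 qT nbig Kbig flU (_ : (d.+2 + K).+2%:R <= q ^+ 4) E0 Ec hE.
apply: mono (st _); last first.
  by apply: le_trans dq'; rewrite ler_nat !ltnS leq_add2r leq_addr.
have oo : o <= (8 * q ^+ 2)^-1.
  rewrite /o lef_pV2 ?posrE ?mulr_gt0 ?exprn_gt0 //; apply: ler_wpM2r; [exact: sqr_ge0|lra].
have z3 : (1 - (8 * q ^+ 2)^-1) * E <= (1 - o) * E by apply: ler_wpM2r => //; lra.
have z4 : q ^+ 30 * T / N ^+ 2 + q ^+ 33 / N ^+ 2 <= o * (16 * q ^+ 36 * T / N ^+ 2).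
  have -> : o * (16 * q ^+ 36 * T / N ^+ 2) = q ^+ 34 * T / N ^+ 2.
    by rewrite /o; field; rewrite !gt_eqF.
  rewrite -mulrDl; apply: ler_wpM2r; first by rewrite invr_ge0 sqr_ge0.
  have a1 : q ^+ 33 * 1 <= q ^+ 33 * T by apply: ler_wpM2l; [apply: exprn_ge0; exact: ltW|exact: T1].
  have a2 : q ^+ 30 * T <= q ^+ 33 * T by apply: ler_wpM2r; [exact: ltW|exact: (qX_le q2)].
  have a3 : 2 * (q ^+ 33 * T) <= q ^+ 34 * T.
    by rewrite mulrA; apply: ler_wpM2r; [exact: ltW|exact: (@cX_le R q q2 2 1 33 isT)].
  by rewrite mulr1 in a1; lra.
have -> : (1 - o) ^+ t.+1 * (q ^+ 14 / N) + 16 * q ^+ 36 * T / N ^+ 2 =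
  (1 - o) * E + o * (16 * q ^+ 36 * T / N ^+ 2) by rewrite /E exprS; ring.
by rewrite -addrA; apply: lerD.
Qed.

Lemma cross_ratio_near : cross_ratio th U 0 cross_err.
Proof.
have P0 r : 0 <= pm (W U) r by apply: pm_ge0 => a b; exact: (wt_ge0 flU).
move=> rho i i' j k ir sr ii ii' nii jj kk njk P eP.
have dq : (0 + 2 * K + K).+2%:R <= q ^+ 4.
  by apply: le_trans Kq; rewrite ler_nat add0n -mulSnr; apply/leqW/leqnSn.
apply: le_trans (cross_ratio_iter dq ir sr ii ii' nii jj kk njk eP) _.
apply: ler_wpM2r; first by apply: mulr_ge0; rewrite eP.
have q14 : 0 <= q ^+ 14 / N by rewrite divr_ge0 ?(ltW pos) // exprn_ge0 // ltW.
have h1 := ler_wpM2r q14 Kbig.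
have qN14 : q ^+ 14 / N <= 1.
  by rewrite ler_pdivrMr // mul1r; exact: (qN q2 qT nbig).
have iN : 0 <= (N ^+ 2)^-1 by rewrite invr_ge0 sqr_ge0.
have h2 := ler_wpM2l iN qN14.
apply: le_trans (lerD (le_trans h1 h2) (lexx _)) _.
rewrite mulr1 /cross_err -[X in X + _]mul1r -mulrDl; apply: ler_wpM2r => //.
have a1 : 1 * 1 <= q ^+ 36 * T by apply: ler_pM => //; exact: (qX_ge1 q2).
have a2 : 17 * (q ^+ 36 * T) <= q ^+ 41 * T.
  by rewrite mulrA; apply: ler_wpM2r; [exact: ltW|exact: (@cX_le R q q2 17 5 36 isT)].
lra.
Qed.

Let P i j := pm (W U) [:: (i, j)].
Let f := pm (W U) [::].
Let p := f / N.

Let mu0 : 0 <= mu. Proof. exact: crude_rad_ge0 th0 th1 q2 qT nbig. Qed.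
Let mu1 : mu <= 1 / 1024. Proof. exact: crude_rad_le th0 th1 q2 qT nbig. Qed.
Let f0 : 0 <= f. Proof. by apply: pm_ge0 => a b; exact: (wt_ge0 flU). Qed.
Let p0 : 0 <= p. Proof. by rewrite divr_ge0 // ltW. Qed.

Lemma P_near i j : `|P i j - p| <= 2 * mu * p.
Proof.
apply: (pm_near th0 th1 q2 qT nbig Kbig flU (d := 0)) => //.
by apply: le_trans Kq; rewrite ler_nat add0n !ltnS leqW // leqW // mulSn leq_addr.
Qed.

Let uu i i' j k := U i j + U i' k - U i k - U i' j.

Lemma cross_near i i' j k :
  `|P i j * P i' k - P i k * P i' j - th / N * p ^+ 2 * uu i i' j k| <= q ^+ 43 * T / N ^+ 2 * p ^+ 2.
Proof.
rewrite [_ * p ^+ 2 * _]mulrAC.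
have b0 : 0 <= q ^+ 43 * T / N ^+ 2.
  by rewrite divr_ge0 ?sqr_ge0 // mulr_ge0 ?(ltW T0) // exprn_ge0 // ltW.
have p20 : 0 <= p ^+ 2 by exact: sqr_ge0.
have [<-|nii] := eqVneq i i'.
  have -> : P i j * P i k - P i k * P i j - th / N * uu i i j k * p ^+ 2 = 0 by rewrite /uu; ring.
  by rewrite normr0 mulr_ge0.
have [<-|njk] := eqVneq j k.
  have -> : P i j * P i' j - P i j * P i' j - th / N * uu i i' j j * p ^+ 2 = 0 by rewrite /uu; ring.
  by rewrite normr0 mulr_ge0.
have h := cross_ratio_near (rho := [::]) isT erefl isT isT nii isT isT njk erefl.
rewrite -/(P i j) -/(P i' k) -/(P i k) -/(P i' j) -/(uu i i' j k) in h.
have hY := prod_near mu0 mu1 p0 (P_near i k) (P_near i' j).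
set Y := P i k * P i' j in h hY *; set X := P i j * P i' k in h *.
have -> : X - Y - th / N * uu i i' j k * p ^+ 2 =
   (X - Y - th / N * uu i i' j k * Y) + th / N * uu i i' j k * (Y - p ^+ 2) by ring.
apply: le_trans (ler_normD _ _) _.
have E0 : 0 <= cross_err by rewrite divr_ge0 ?sqr_ge0 // mulr_ge0 ?(ltW T0) // exprn_ge0 // ltW.
have hY2 : Y <= 2 * p ^+ 2.
  have : mu * p ^+ 2 <= 1 / 1024 * p ^+ 2 by exact: ler_wpM2r.
  by move: hY; rewrite ler_norml => /andP[_ ?]; lra.
have h1 := le_trans h (ler_wpM2l E0 hY2).
have h2 : `|th / N * uu i i' j k * (Y - p ^+ 2)| <= 1 / N * (4 * q) * (5 * mu * p ^+ 2).
  rewrite normrM; apply: ler_pM => //; rewrite normrM; apply: ler_pM => //.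
    rewrite ger0_norm; last by rewrite divr_ge0 // ltW.
    by apply: ler_wpM2r => //; rewrite invr_ge0 ltW.
  exact: (u_abs th0 th1 q2 qT).
apply: le_trans (lerD h1 h2) _.
rewrite [X in X <= _](_ : _ = (2 * q ^+ 41 * T + 20 * q ^+ 12) / N ^+ 2 * p ^+ 2); last first.
  by rewrite /cross_err /crude_rad; field; rewrite gt_eqF.
apply: ler_wpM2r => //; apply: ler_wpM2r; first by rewrite invr_ge0 sqr_ge0.
have a1 : 20 * q ^+ 12 <= q ^+ 17 by exact: (@cX_le R q q2 20 5 12 isT).
have a2 : q ^+ 17 <= q ^+ 41 by exact: (qX_le q2).
have a3 : q ^+ 41 * 1 <= q ^+ 41 * T by apply: ler_wpM2l; [apply: exprn_ge0; exact: ltW|exact: T1].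
have a4 : 4 * (q ^+ 41 * T) <= q ^+ 43 * T.
  by rewrite mulrA; apply: ler_wpM2r; [exact: ltW|exact: (@cX_le R q q2 4 2 41 isT)].
by rewrite mulr1 in a3; have := mulr_ge0 (exprn_ge0 41 (ltW q0)) (ltW T0); lra.
Qed.

Let SU := \sum_i \sum_j U i j.
Let SU2 := \sum_i \sum_j U i j ^+ 2.
Let S := \sum_i \sum_j U i j * P i j.
Let G := \sum_i \sum_j P i j.
Let rG i := \sum_k P i k.
Let cG j := \sum_i P i j.

Let Uq i j : `|U i j| <= q. Proof. exact: (U_abs flU th0 th1 q2 qT). Qed.
Let rU i : `|\sum_j U i j| <= q. Proof. by case: flU => _ [_ h _]; exact: h. Qed.
Let cU j : `|\sum_i U i j| <= q. Proof. by case: flU => -[_ h _] _; exact: h. Qed.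

Lemma cross_sum :
  `|S * G - \sum_i \sum_j U i j * (rG i * cG j)
    - th / N * p ^+ 2 * \sum_i \sum_j \sum_i' \sum_k U i j * uu i i' j k|
  <= p ^+ 2 * N ^+ 2 * (q ^+ 44 * T).
Proof.
have <- := quad_sum_split U P uu (th / N * p ^+ 2).
apply: le_trans (_ : N * N * (N * N * (q * (q ^+ 43 * T / N ^+ 2 * p ^+ 2))) <= _); last first.
  by apply: le_of_eq; field; rewrite gt_eqF.
apply: ler_norm_sum2 => i j.
apply: ler_norm_sum2 => i' k.
by rewrite normrM; apply: ler_pM => //; exact: cross_near.
Qed.

Let r0 : 0 <= mu * N. Proof. by rewrite (crude_radN q2 qT nbig) exprn_ge0 // ltW. Qed.

Lemma rG_near i : `|rG i - N * p| <= 2 * mu * (N * p).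
Proof.
have -> : rG i - N * p = \sum_k (P i k - p).
  by rewrite sumrB sumr_const card_ord mulr_natl.
by rewrite mulrCA; apply: norm_sum_le_const => k; exact: P_near.
Qed.

Lemma cG_near j : `|cG j - N * p| <= 2 * mu * (N * p).
Proof.
have -> : cG j - N * p = \sum_i (P i j - p).
  by rewrite sumrB sumr_const card_ord mulr_natl.
by rewrite mulrCA; apply: norm_sum_le_const => k; exact: P_near.
Qed.

Lemma G_near : `|G - N ^+ 2 * p| <= 2 * mu * (N ^+ 2 * p).
Proof.
have -> : G - N ^+ 2 * p = \sum_i (rG i - N * p).
  by rewrite sumrB sumr_const card_ord -[_ *+ n]mulr_natl /G /rG; congr (_ - _); ring.
rewrite [X in _ <= X](_ : _ = N * (2 * mu * (N * p))); last by ring.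
by apply: norm_sum_le_const => k; exact: rG_near.
Qed.

(** A deviation of a row or column sum of P is multiplied by a line sum of U, which is at most q
    instead of N q; products of two deviations are of second order. *)
Lemma UGG_near :
  `|\sum_i \sum_j U i j * (rG i * cG j) - N ^+ 2 * p ^+ 2 * SU| <= p ^+ 2 * N ^+ 2 * (8 * q ^+ 23).
Proof.
pose a i := rG i - N * p; pose b j := cG j - N * p.
have -> : \sum_i \sum_j U i j * (rG i * cG j) - N ^+ 2 * p ^+ 2 * SU =
    N * p * \sum_i (\sum_j U i j) * a i + N * p * \sum_j (\sum_i U i j) * b j
    + \sum_i \sum_j U i j * (a i * b j).
  have -> : \sum_j (\sum_i U i j) * b j = \sum_i \sum_j U i j * b j.
    by rewrite exchange_big; apply: eq_bigr => j _; rewrite mulr_suml.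
  rewrite /SU !mulr_sumr -sumrB -!big_split; apply: eq_bigr => i _ /=.
  rewrite mulr_suml !mulr_sumr -sumrB -!big_split; apply: eq_bigr => j _ /=.
  by rewrite /a /b; ring.
have Np : 0 <= N * p by rewrite mulr_ge0 // ltW.
set ep := 2 * mu * (N * p).
have ep0 : 0 <= ep by rewrite /ep mulr_ge0 // mulr_ge0.
have h1 : `|N * p * \sum_i (\sum_j U i j) * a i| <= N * p * (N * (q * ep)).
  rewrite normrM (ger0_norm Np); apply: ler_wpM2l => //.
  by apply: norm_sum_le_const => k; rewrite normrM; apply: ler_pM => //; exact: rG_near.
have h2 : `|N * p * \sum_j (\sum_i U i j) * b j| <= N * p * (N * (q * ep)).
  rewrite normrM (ger0_norm Np); apply: ler_wpM2l => //.
  by apply: norm_sum_le_const => k; rewrite normrM; apply: ler_pM => //; exact: cG_near.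
have h3 : `|\sum_i \sum_j U i j * (a i * b j)| <= N * N * (q * (ep * ep)).
  apply: ler_norm_sum2 => i j.
  rewrite normrM; apply: ler_pM => //; rewrite normrM; apply: ler_pM => //.
    exact: rG_near.
  exact: cG_near.
apply: le_trans (ler_normD _ _) _; apply: le_trans (lerD (ler_normD _ _) (lexx _)) _.
apply: le_trans (lerD (lerD h1 h2) h3) _.
have -> : N * p * (N * (q * ep)) + N * p * (N * (q * ep)) + N * N * (q * (ep * ep)) =
    p ^+ 2 * N ^+ 2 * (4 * (q * (mu * N)) + 4 * (q * (mu * N) * (mu * N))).
  by rewrite /ep; ring.
rewrite (crude_radN q2 qT nbig) -exprS -exprD; apply: ler_wpM2l; first by rewrite mulr_ge0 ?sqr_ge0.
by have := qX_le q2 (isT : (12 <= 23)%N); rewrite [(12 + 11)%N]/=; lra.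
Qed.

Lemma quad_near :
  `|th / N * p ^+ 2 * (\sum_i \sum_j \sum_i' \sum_k U i j * uu i i' j k)
   - N ^+ 2 * p ^+ 2 * (th / N * SU2)| <= p ^+ 2 * N ^+ 2.
Proof.
rewrite quad_sum_cross -/SU -/SU2.
set r2 := \sum_i (\sum_j U i j) ^+ 2; set c2 := \sum_j (\sum_i U i j) ^+ 2.
have -> : th / N * p ^+ 2 * (N ^+ 2 * SU2 + SU ^+ 2 - N * r2 - N * c2) - N ^+ 2 * p ^+ 2 * (th / N * SU2)
  = th / N * p ^+ 2 * (SU ^+ 2 - N * r2 - N * c2) by ring.
have sq x : `|x| <= q -> 0 <= x ^+ 2 <= q ^+ 2.
  move=> h; rewrite sqr_ge0 -real_normK ?num_real //=.
  by apply: lerXn2r => //; rewrite nnegrE // ltW.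
have hr : 0 <= r2 <= N * q ^+ 2.
  rewrite sumr_ge0 => [|i _]; last exact: sqr_ge0.
  by apply: sum_le_const => i; case/andP: (sq _ (rU i)).
have hc : 0 <= c2 <= N * q ^+ 2.
  rewrite sumr_ge0 => [|i _]; last exact: sqr_ge0.
  by apply: sum_le_const => i; case/andP: (sq _ (cU i)).
have hS : `|SU| <= N * q by exact: norm_sum_le_const.
have hS2 : 0 <= SU ^+ 2 <= N ^+ 2 * q ^+ 2.
  rewrite sqr_ge0 -real_normK ?num_real //= -exprMn.
  by apply: lerXn2r => //; rewrite nnegrE // mulr_ge0 // ltW.
have hx : `|SU ^+ 2 - N * r2 - N * c2| <= 2 * (N ^+ 2 * q ^+ 2).
  move: hr hc hS2 => /andP[r20 r21] /andP[c20 c21] /andP[s20 s21].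
  have := ler_wpM2l (ltW pos) r21; have := ler_wpM2l (ltW pos) c21.
  have := mulr_ge0 (ltW pos) r20; have := mulr_ge0 (ltW pos) c20.
  rewrite !mulrA -expr2 ler_norml => *; apply/andP; split; lra.
have tN : 0 <= th / N * p ^+ 2 by rewrite mulr_ge0 ?sqr_ge0 // divr_ge0 // ltW.
have tN1 : th / N * p ^+ 2 <= 1 / N * p ^+ 2.
  apply: ler_wpM2r; first exact: sqr_ge0.
  by apply: ler_wpM2r => //; rewrite invr_ge0 ltW.
apply: le_trans (mul_norm_le tN tN1 hx) _.
have -> : 1 / N * p ^+ 2 * (2 * (N ^+ 2 * q ^+ 2)) = p ^+ 2 * N * (2 * q ^+ 2).
  by field; rewrite gt_eqF.
rewrite [X in _ <= X](_ : _ = p ^+ 2 * N * N); last by ring.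
apply: ler_wpM2l; first by rewrite mulr_ge0 ?sqr_ge0 // ltW.
by apply: le_trans (@cX_le R q q2 2 1 2 isT) _; exact: (qN q2 qT nbig).
Qed.

(** The summed relation determines S G. Replacing G by N^2 p has only the relative precision [mu],
    but S is already known to be O(q^2 N p), so in units of p^2 N^2 the loss is of order q^13 and
    not of order N. *)
Lemma derivative_near :
  `|S - (SU / N + th * (SU2 / N ^+ 2)) * f| <= q ^+ 46 * T / N * f.
Proof.
have p20 : 0 <= p ^+ 2 * N ^+ 2 by rewrite mulr_ge0 // sqr_ge0.
have q0' := ltW q0; have T0' := ltW T0.
pose M := SU + th / N * SU2.
have h1 : `|S * G - N ^+ 2 * p ^+ 2 * M| <= p ^+ 2 * N ^+ 2 * (q ^+ 45 * T).
  set A := \sum_i \sum_j U i j * (rG i * cG j).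
  set Q := th / N * p ^+ 2 * (\sum_i \sum_j \sum_i' \sum_k U i j * uu i i' j k).
  have -> : S * G - N ^+ 2 * p ^+ 2 * M = (S * G - A - Q) + (A - N ^+ 2 * p ^+ 2 * SU)
    + (Q - N ^+ 2 * p ^+ 2 * (th / N * SU2)) by rewrite /M; ring.
  apply: le_trans (ler_normD _ _) _; apply: le_trans (lerD (ler_normD _ _) (lexx _)) _.
  apply: le_trans (lerD (lerD cross_sum UGG_near) quad_near) _.
  rewrite -{3}[p ^+ 2 * N ^+ 2]mulr1 -!mulrDr; apply: ler_wpM2l => //.
  have a1 : 8 * q ^+ 23 <= q ^+ 44.
    by apply: le_trans (@cX_le R q q2 8 3 23 isT) _; exact: (qX_le q2).
  have a2 : 2 * 1 <= q ^+ 44.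
    by apply: le_trans (@cX_le R q q2 2 1 0 isT) _; exact: (qX_le q2).
  have a3 : q ^+ 44 * 1 <= q ^+ 44 * T by apply: ler_wpM2l; [exact: exprn_ge0|exact: T1].
  have a4 : 4 * (q ^+ 44 * T) <= q ^+ 45 * T * 2.
    by have := ler_wpM2r T0' (@cX_le R q q2 2 1 44 isT); rewrite [(1 + 44)%N]/=; lra.
  have a5 : 2 * (q ^+ 44 * T) <= q ^+ 45 * T by lra.
  have a6 : 8 * q ^+ 23 + 1 <= q ^+ 44.
    have b1 := @cX_le R q q2 8 3 23 isT; have b2 := qX_ge1 q2 26.
    have b3 : 2 * q ^+ 26 <= q ^+ 27 by exact: (@cX_le R q q2 2 1 26 isT).
    have b4 : q ^+ 27 <= q ^+ 44 by exact: (qX_le q2).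
    by rewrite [(3 + 23)%N]/= in b1; lra.
  lra.
have [fz|fnz] := eqVneq f 0.
  have pz : p = 0 by rewrite /p fz mul0r.
  have Pz i j : P i j = 0.
    by have := P_near i j; rewrite pz mulr0 subr0 normr_le0 => /eqP.
  rewrite fz !mulr0 subr0 /S big1 ?normr0 // => i _; rewrite big1 // => j _.
  by rewrite Pz mulr0.
have fp : 0 < f by rewrite lt_def fnz f0.
have pp : 0 < p by rewrite divr_gt0.
have hM : `|M| <= 2 * (N * q ^+ 2).
  have z1 : `|SU| <= N * q ^+ 2.
    apply: le_trans (norm_sum_le_const rU) _; apply: ler_wpM2l; first exact: ltW.
    by rewrite -{1}(expr1 q); exact: (qX_le q2).
  have z2 : `|SU2| <= N * N * q ^+ 2.
    apply: ler_norm_sum2 => i j.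
    by rewrite normrX; apply: lerXn2r => //; rewrite nnegrE.
  have z3 : `|th / N * SU2| <= 1 / N * (N * N * q ^+ 2).
    rewrite normrM; apply: ler_pM => //; rewrite ger0_norm; last by rewrite divr_ge0 // ltW.
    by apply: ler_wpM2r => //; rewrite invr_ge0 ltW.
  rewrite (_ : 1 / N * (N * N * q ^+ 2) = N * q ^+ 2) in z3; last by field; rewrite gt_eqF.
  by apply: le_trans (ler_normD _ _) _; lra.
have g0 : 0 < N ^+ 2 * p by rewrite mulr_gt0 // exprn_gt0.
have gg := G_near.
have hG : N ^+ 2 * p / 2 <= G.
  move: gg; rewrite ler_norml => /andP[g1 _].
  by have := ler_wpM2r (ltW g0) mu1; lra.
have hS : `|S| <= p * (6 * (N * q ^+ 2)).
  have G0 : 0 <= G by lra.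
  have z1 := norm_le_comb h1; rewrite normrM (ger0_norm G0) in z1.
  have z2 : `|S| * (N ^+ 2 * p / 2) <= `|S| * G by apply: ler_wpM2l.
  have z3 : `|N ^+ 2 * p ^+ 2 * M| <= N ^+ 2 * p ^+ 2 * (2 * (N * q ^+ 2)).
    have z0 : 0 <= N ^+ 2 * p ^+ 2 by rewrite mulr_ge0 // sqr_ge0.
    by rewrite normrM (ger0_norm z0); apply: ler_wpM2l.
  have z4 : p ^+ 2 * N ^+ 2 * (q ^+ 45 * T) <= p ^+ 2 * N ^+ 2 * (N * q ^+ 2).
    apply: ler_wpM2l => //; rewrite -[X in X <= _]mulr1; apply: ler_pM => //.
    - by rewrite mulr_ge0 // exprn_ge0.
    - exact: (qTN q2 qT nbig).
    - exact: (qX_ge1 q2).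
  rewrite -(ler_pM2r g0).
  have -> : p * (6 * (N * q ^+ 2)) * (N ^+ 2 * p) =
    2 * (N ^+ 2 * p ^+ 2 * (2 * (N * q ^+ 2)) + p ^+ 2 * N ^+ 2 * (N * q ^+ 2)) by ring.
  lra.
have hSG : `|S * (G - N ^+ 2 * p)| <= p ^+ 2 * N ^+ 2 * (12 * q ^+ 13).
  rewrite normrM; apply: le_trans (ler_pM (normr_ge0 _) (normr_ge0 _) hS gg) _.
  rewrite [X in X <= _](_ : _ = p ^+ 2 * N ^+ 2 * (12 * q ^+ 2 * (mu * N))); last by ring.
  by rewrite (crude_radN q2 qT nbig) (_ : 12 * q ^+ 2 * q ^+ 11 = 12 * q ^+ 13) //; ring.
have h2 : `|S * (N ^+ 2 * p) - N ^+ 2 * p ^+ 2 * M| <= p ^+ 2 * N ^+ 2 * (q ^+ 46 * T).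
  have -> : S * (N ^+ 2 * p) - N ^+ 2 * p ^+ 2 * M =
     (S * G - N ^+ 2 * p ^+ 2 * M) - S * (G - N ^+ 2 * p) by ring.
  apply: le_trans (ler_normB _ _) _; apply: le_trans (lerD h1 hSG) _.
  rewrite -mulrDr; apply: ler_wpM2l => //.
  have b1 := @cX_le R q q2 12 4 13 isT.
  have b2 : q ^+ (4 + 13) <= q ^+ 45 by exact: (qX_le q2).
  have b3 : q ^+ 45 * 1 <= q ^+ 45 * T by apply: ler_wpM2l; [exact: exprn_ge0|exact: T1].
  have b4 : 2 * (q ^+ 45 * T) <= q ^+ 46 * T.
    by rewrite mulrA; apply: ler_wpM2r => //; exact: (@cX_le R q q2 2 1 45 isT).
  by rewrite [(4 + 13)%N]/= in b1 b2; lra.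
have e1 : S * (N ^+ 2 * p) - N ^+ 2 * p ^+ 2 * M = (S - p * M) * (N ^+ 2 * p) by ring.
rewrite e1 normrM (gtr0_norm g0) in h2.
have e2 : p ^+ 2 * N ^+ 2 * (q ^+ 46 * T) = p * (q ^+ 46 * T) * (N ^+ 2 * p) by ring.
rewrite e2 ler_pM2r // in h2.
have -> : (SU / N + th * (SU2 / N ^+ 2)) * f = p * M.
  by rewrite /p /M; field; rewrite gt_eqF.
apply: le_trans h2 _; apply: le_of_eq.
by rewrite /p; field; rewrite gt_eqF.
Qed.

End Derivative.

(** * Switchings *)

Section DoubleCounting.
Variables (R : realFieldType) (X Y : finType) (Z Z' : {set X}) (T : X -> Y -> X).
Variables (ok ok' : X -> pred Y).

(** Each switching gets weight 1 / #ok at its source and 1 / #ok' at its target; the totals are #Z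
    and at most #Z'. Comparing the two weights along each single switching lets both counts vary
    from matrix to matrix. *)
Lemma switch_count (kappa : R) : 0 <= kappa ->
  (forall M y, M \in Z -> ok M y -> [/\ T M y \in Z', ok' (T M y) y & T (T M y) y = M]) ->
  (forall M, M \in Z -> (0 < #|[set y | ok M y]|)%N) ->
  (forall M y, M \in Z -> ok M y ->
     #|[set z | ok' (T M y) z]|%:R <= kappa * #|[set z | ok M z]|%:R) ->
  #|Z|%:R <= kappa * #|Z'|%:R.
Proof.
move=> k0 hT hpos hk.
pose a M : R := #|[set y | ok M y]|%:R; pose b M : R := #|[set y | ok' M y]|%:R.
pose A := [set p : X * Y | (p.1 \in Z) && ok p.1 p.2].
pose B := [set p : X * Y | (p.1 \in Z') && ok' p.1 p.2].
pose h (p : X * Y) := (T p.1 p.2, p.2).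
have sumA (G : X -> R) : \sum_(p in A) G p.1 = \sum_(M in Z) \sum_(y | ok M y) G M.
  by rewrite pair_big_dep; apply: eq_bigl => p; rewrite inE.
have sumB (G : X -> R) : \sum_(p in B) G p.1 = \sum_(M in Z') \sum_(y | ok' M y) G M.
  by rewrite pair_big_dep; apply: eq_bigl => p; rewrite inE.
have -> : #|Z|%:R = \sum_(p in A) (a p.1)^-1.
  rewrite (sumA (fun M => (a M)^-1)) -sum1_card natr_sum; apply: eq_bigr => M MZ.
  rewrite sumr_const (_ : #|_| = #|[set y | ok M y]|); last by apply: eq_card => y; rewrite inE.
  by rewrite -[RHS]mulr_natr mulVf // pnatr_eq0 -lt0n hpos.
have hinj : {in A &, injective h}.
  move=> [M y] [M1 y1]; rewrite !inE /= => /andP[MZ oy] /andP[M1Z oy1] [e1 e2].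
  have [_ _ <-] := hT _ _ MZ oy; have [_ _ <-] := hT _ _ M1Z oy1.
  by rewrite e1 e2.
have hB : h @: A \subset B.
  apply/subsetP => p /imsetP[[M y]]; rewrite inE /= => /andP[MZ oy] ->.
  by have [t1 t2 _] := hT _ _ MZ oy; rewrite inE /= t1 t2.
have bpos M y : M \in Z -> ok M y -> 0 < b (T M y).
  move=> MZ oy; rewrite ltr0n; apply/card_gt0P; exists y; rewrite inE.
  by have [] := hT _ _ MZ oy.
apply: le_trans (_ : \sum_(p in A) kappa * (b (h p).1)^-1 <= _).
  apply: ler_sum => -[M y]; rewrite inE /= => /andP[MZ oy].
  have ap : 0 < a M by rewrite ltr0n hpos.
  by rewrite ler_pdivlMr ?bpos // mulrC ler_pdivrMr // hk.
rewrite -mulr_sumr; apply: ler_wpM2l => //.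
rewrite -(big_imset (fun p => (b p.1)^-1) hinj) /=.
apply: le_trans (_ : \sum_(p in B) (b p.1)^-1 <= _).
  rewrite [X in _ <= X](big_setID (h @: A)) /= (setIidPr hB) lerDl.
  by apply: sumr_ge0 => p _; rewrite invr_ge0.
rewrite (sumB (fun M => (b M)^-1)) -sum1_card natr_sum; apply: ler_sum => M _.
rewrite sumr_const (_ : #|_| = #|[set y | ok' M y]|); last by apply: eq_card => y; rewrite inE.
rewrite -[X in X <= _]mulr_natr -/(b M); have [->|b0] := eqVneq (b M) 0; first by rewrite mulr0.
by rewrite mulVf.
Qed.

End DoubleCounting.

Section Toggle.
Variable n : nat.
Implicit Types (M : 'M[bool]_n) (s t : 'I_n -> nat).

Definition rsup M i : {set 'I_n} := [set j | M i j].
Definition csup M j : {set 'I_n} := [set i | M i j].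

Lemma zoP s t M : reflect ((forall i, #|rsup M i| = s i) /\ (forall j, #|csup M j| = t j))
  (M \in zo_mats s t).
Proof.
have er i : (\sum_(j < n) (M i j : nat))%N = #|rsup M i|.
  by rewrite -sum1dep_card [RHS]big_mkcond; apply: eq_bigr => j _; case: (M i j).
have ec j : (\sum_(i < n) (M i j : nat))%N = #|csup M j|.
  by rewrite -sum1dep_card [RHS]big_mkcond; apply: eq_bigr => i _; case: (M i j).
rewrite inE; apply: (iffP andP) => [[/forallP h1 /forallP h2]|[h1 h2]]; split.
- by move=> i; rewrite -er; apply/eqP.
- by move=> j; rewrite -ec; apply/eqP.
- by apply/forallP => i; rewrite er h1.
- by apply/forallP => j; rewrite ec h2.
Qed.

(** Flipping the corners of a rectangle by exclusive or is an involution, so one operation serves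
    both directions of a switching. *)
Definition tog M (a b c d : 'I_n) : 'M[bool]_n :=
  \matrix_(i, j) (M i j (+) ((i \in [:: a; b]) && (j \in [:: c; d]))).

Lemma togK M a b c d : tog (tog M a b c d) a b c d = M.
Proof. by apply/matrixP => i j; rewrite !mxE -addbA addbb addbF. Qed.

Lemma tog_tr M a b c d : (tog M a b c d)^T = tog M^T c d a b.
Proof. by apply/matrixP => i j; rewrite !mxE andbC. Qed.

Lemma tog_rsup M a b c d i : c != d -> M a c = ~~ M a d -> M b c = ~~ M b d ->
  #|rsup (tog M a b c d) i| = #|rsup M i|.
Proof.
move=> cd ha hb.
have [iab|niab] := boolP (i \in [:: a; b]); last first.
  by apply: eq_card => j; rewrite !inE mxE (negbTE niab) addbF.
have hi : M i c = ~~ M i d by move: iab; rewrite !inE => /orP[]/eqP->.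
rewrite -(card_imset (mem (rsup M i)) (@perm_inj _ (tperm c d))).
apply: eq_card => j; rewrite !inE mxE iab /=.
have -> : (j \in [set tperm c d x | x in rsup M i]) = (tperm c d j \in rsup M i).
  apply/imsetP/idP => [[x xr ->]|h]; first by rewrite tpermK.
  by exists (tperm c d j) => //; rewrite tpermK.
rewrite !inE; case: tpermP => [->|->|/eqP nc /eqP nd].
- by rewrite eqxx addbT hi negbK.
- by rewrite eqxx orbT addbT hi.
- by rewrite (negbTE nc) (negbTE nd) addbF.
Qed.

Lemma csup_tr M j : csup M j = rsup M^T j.
Proof. by apply/setP => i; rewrite !inE mxE. Qed.

Lemma tog_zo s t M a b c d : a != b -> c != d ->
  M a c = ~~ M a d -> M b c = ~~ M b d -> M a c = ~~ M b c ->
  M \in zo_mats s t -> tog M a b c d \in zo_mats s t.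
Proof.
move=> ab cd h1 h2 h3 /zoP[hr hc]; apply/zoP; split=> [i|j].
  by rewrite tog_rsup.
rewrite csup_tr tog_tr tog_rsup ?mxE ?csup_tr -?csup_tr //.
by move: h1 h2; rewrite h3; case: (M a d); case: (M b d); case: (M b c).
Qed.

(** Prescribing cells covers all the uses: no constraint, the graph of a permutation, and one or two
    rows fixed in addition. *)
Definition fam (Phi : 'I_n -> 'I_n -> bool) (M0 : 'M[bool]_n) s t :=
  [set M in zo_mats s t | [forall i, forall j, Phi i j ==> (M i j == M0 i j)]].

Lemma famP (Phi : 'I_n -> 'I_n -> bool) M0 s t M : reflect (M \in zo_mats s t /\ forall i j, Phi i j -> M i j = M0 i j)
  (M \in fam Phi M0 s t).
Proof.
rewrite [M \in fam _ _ _ _]inE; apply: (iffP andP) => -[h1 h2]; split=> //.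
  by move=> i j p; move/forallP/(_ i)/forallP/(_ j)/implyP/(_ p)/eqP: h2.
by apply/forallP => i; apply/forallP => j; apply/implyP => p; rewrite h2.
Qed.

Lemma tog_fam (Phi : 'I_n -> 'I_n -> bool) M0 s t M a b c d : a != b -> c != d ->
  M a c = ~~ M a d -> M b c = ~~ M b d -> M a c = ~~ M b c ->
  ~~ Phi a c -> ~~ Phi a d -> ~~ Phi b c -> ~~ Phi b d ->
  M \in fam Phi M0 s t -> tog M a b c d \in fam Phi M0 s t.
Proof.
move=> ab cd h1 h2 h3 p1 p2 p3 p4 /famP[hz hp]; apply/famP; split; first exact: tog_zo.
move=> i j pij; rewrite mxE -(hp _ _ pij) (_ : _ && _ = false) ?addbF //.
apply/negbTE/negP => /andP[]; rewrite !inE => /orP[]/eqP ei /orP[]/eqP ej;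
 by move: pij; rewrite ei ej; apply/negP.
Qed.

End Toggle.

(** * Overlaps of two columns *)

Lemma card_sum (R : realFieldType) (I : finType) (P : pred I) : #|[set i | P i]|%:R = \sum_i (P i)%:R :> R.
Proof.
rewrite -sum1dep_card natr_sum big_mkcond /=; apply: eq_bigr => i _.
by case: (P i).
Qed.

Lemma card_sum3 (R : realFieldType) (I : finType) (Q : I -> I -> I -> bool) :
  #|[set p : I * I * I | Q p.1.1 p.1.2 p.2]|%:R = \sum_l \sum_i \sum_i' (Q i i' l)%:R :> R.
Proof.
rewrite card_sum -(pair_bigA _ (fun p l => (Q p.1 p.2 l)%:R)) exchange_big /=.
by apply: eq_bigr => l _; rewrite -(pair_bigA _ (fun i i' => (Q i i' l)%:R)).
Qed.

Lemma column_excess_le (R : realFieldType) (x y z : bool) :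
  x%:R - y%:R - (z && ~~ y)%:R <= (x && ~~ z && ~~ y)%:R - (z && y && ~~ x)%:R :> R.
Proof. by case: x; case: y; case: z => /=; lra. Qed.

Lemma column_meet_natr (R : realFieldType) (x y z : bool) :
  (x && y && ~~ z)%:R = (x && y)%:R * (1 - z%:R) :> R.
Proof. by case: x; case: y; case: z => /=; lra. Qed.

Lemma leq_and_not4 (e a b c d : bool) : (e <= (e && [&& ~~ a, ~~ b, ~~ c & ~~ d]) + a + b + c + d)%N.
Proof. by case: e; case: a; case: b; case: c; case: d. Qed.

Lemma quadratic_gap (R : realFieldType) (A u : R) : 0 <= u -> 6 * u <= A -> 24 * u * u <= A * (A - 2 * u).
Proof.
move=> u0 uA; have -> : 24 * u * u = 6 * u * (4 * u) by ring.
by apply: ler_pM; lra.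
Qed.

Section Overlap.
Variables (R : realFieldType) (n : nat) (s t : 'I_n -> nat) (sig Del de : R).
Local Notation N := (n%:R : R).

(** [de] measures sig (N - sig) / N^2, heuristically the chance that two given cells carry 1 and 0;
    an excess below de N is abnormally small. The last inequalities make [Del] and the prescribed
    cells negligible on that scale. *)
Definition near_regular :=
  [/\ forall i, `|(s i)%:R - sig| <= Del, forall j, `|(t j)%:R - sig| <= Del &
    [/\ 0 < de, 8 * de * N <= sig, 8 * de * N <= N - sig, 8 * de * N ^+ 2 <= sig * (N - sig) &
     [/\ 2 * Del + 20 <= de * N, 12 <= de ^+ 2 * N & 0 <= Del]]].

Hypothesis nr : near_regular.
Variables (Phi : 'I_n -> 'I_n -> bool) (M0 : 'M[bool]_n).
Hypothesis Phi3 : forall j, (#|[set i | Phi i j]| <= 3)%N.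
Variables (j k : 'I_n).
Hypothesis jk : j != k.

(** Counts the rows in which a 1 in column j can be exchanged for a 0 in column k. At most three
    prescribed cells per column leave room for the graph of a permutation and two fixed rows. *)
Definition excess (M : 'M[bool]_n) := #|csup M j :\: csup M k|.

(** The admissible switchings out of a matrix. [okm'] only contains those that lead back, with no
    condition on column l, since the reverse count need only be bounded above. *)
Let okm (M : 'M[bool]_n) (p : 'I_n * 'I_n * 'I_n) :=
  let: (i1, i2, l) := p in
  [&& M i1 j, M i1 k, ~~ M i1 l, M i2 l, ~~ M i2 j & ~~ M i2 k] &&
  [&& ~~ Phi i1 k, ~~ Phi i1 l, ~~ Phi i2 k & ~~ Phi i2 l].
Let okm' (M : 'M[bool]_n) (p : 'I_n * 'I_n * 'I_n) :=
  let: (i1, i2, l) := p in [&& M i1 j, ~~ M i1 k, ~~ M i2 j & M i2 k].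
Let Tm (M : 'M[bool]_n) (p : 'I_n * 'I_n * 'I_n) := let: (i1, i2, l) := p in tog M i1 i2 k l.

Let excessE (M : 'M[bool]_n) : (excess M)%:R = \sum_i (M i j && ~~ M i k)%:R :> R.
Proof.
rewrite /excess (_ : _ :\: _ = [set i | M i j && ~~ M i k]) ?card_sum //.
by apply/setP => i; rewrite !inE andbC.
Qed.

Let colE (M : 'M[bool]_n) l : M \in fam Phi M0 s t -> \sum_i (M i l)%:R = (t l)%:R :> R.
Proof. by move=> /famP[/zoP[_ <-] _]; rewrite card_sum. Qed.

Let rowE (M : 'M[bool]_n) i : M \in fam Phi M0 s t -> \sum_l (M i l)%:R = (s i)%:R :> R.
Proof. by move=> /famP[/zoP[<- _] _]; rewrite card_sum. Qed.

(** Let a l count the rows with j and k but not l, and b l those with l but neither j nor k. A small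
    excess forces b l >= a l - 2 de N, and the a l sum to at least 6 de N^2, so Cauchy-Schwarz
    bounds the sum of a l b l below by 24 de^2 N^3. Prescribed cells remove at most 12 N^2
    triples. *)
Lemma okm_count M : M \in fam Phi M0 s t -> (excess M).+1%:R <= de * N ->
  23 * de ^+ 2 * N ^+ 3 <= #|[set p | okm M p]|%:R.
Proof.
case: nr => hs ht [d0 d1 d2 d3 [d4 d5 D0]] Mf hx.
have N0 : 0 <= N by [].
pose a l : R := \sum_i (M i j && M i k && ~~ M i l)%:R.
pose b l : R := \sum_i (M i l && ~~ M i j && ~~ M i k)%:R.
set x : R := (excess M)%:R.
have hx' : x + 1 <= de * N by move: hx; rewrite -addn1 natrD.
have a0 l : 0 <= a l by apply: sumr_ge0.
have ht' l := ht l.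
have ab l : a l - 2 * de * N <= b l.
  have h : \sum_i ((M i l)%:R - (M i k)%:R - (M i j && ~~ M i k)%:R) <= b l - a l.
    rewrite /b /a -sumrB; apply: ler_sum => i _.
    exact: column_excess_le.
  rewrite !sumrB -excessE !colE // in h.
  have := ht l; have := ht k; rewrite !ler_norml => /andP[? ?] /andP[? ?].
  by rewrite -/x in h; lra.
have jkE : \sum_i (M i j && M i k)%:R = (t j)%:R - x.
  rewrite -(colE j Mf) /x excessE -sumrB; apply: eq_bigr => i _.
  by case: (M i j); case: (M i k) => /=; lra.
have sa : 6 * de * N ^+ 2 <= \sum_l a l.
  have -> : \sum_l a l = \sum_i (M i j && M i k)%:R * (N - (s i)%:R).
    rewrite /a exchange_big /=; apply: eq_bigr => i _.
    have -> : N - (s i)%:R = \sum_l (1 - (M i l)%:R) by rewrite sumrB rowE // sumr_const card_ord.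
    rewrite mulr_sumr.
    by apply: eq_bigr => l _; exact: column_meet_natr.
  have h : \sum_i (M i j && M i k)%:R * (N - sig - Del) <= \sum_i (M i j && M i k)%:R * (N - (s i)%:R).
    apply: ler_sum => i _; apply: ler_wpM2l => //.
    by have := hs i; rewrite ler_norml => /andP[_ ?]; lra.
  apply: le_trans h; rewrite -mulr_suml jkE.
  have k1 : 13 / 16 * sig <= (t j)%:R - x.
    by have := ht j; rewrite ler_norml => /andP[? _]; lra.
  have k2 : 15 / 16 * (N - sig) <= N - sig - Del by lra.
  have k3 : 0 <= de * N by apply: mulr_ge0 => //; exact: ltW.
  have k4 : 13 / 16 * sig * (15 / 16 * (N - sig)) <= ((t j)%:R - x) * (N - sig - Del).
    by apply: ler_pM => //; lra.
  have k5 : 0 <= de * N ^+ 2 by apply: mulr_ge0; [exact: ltW|exact: sqr_ge0].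
  lra.
pose Q i1 i2 l := [&& M i1 j, M i1 k, ~~ M i1 l, M i2 l, ~~ M i2 j & ~~ M i2 k].
have card_ok : #|[set p | okm M p]|%:R = \sum_l \sum_i \sum_i' (okm M (i, i', l))%:R :> R.
  by rewrite -card_sum3; congr _%:R; apply: eq_card => -[[i i'] l]; rewrite !inE.
have phi_col l : \sum_i (Phi i l)%:R <= 3 :> R.
  by rewrite -card_sum (ler_nat _ _ 3).
have cst (F : 'I_n -> R) (c : R) : (forall i, F i <= c) -> \sum_i F i <= N * c := @sum_le_const R n F c.
have lowQ : \sum_l a l * b l <= #|[set p | okm M p]|%:R + 12 * N ^+ 2.
  have -> : \sum_l a l * b l = \sum_l \sum_i \sum_i' (Q i i' l)%:R.
    apply: eq_bigr => l _; rewrite big_distrlr /=; apply: eq_bigr => i _; apply: eq_bigr => i' _.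
    rewrite -natrM mulnb /Q; congr (_ %:R).
    by rewrite -!andbA.
  rewrite card_ok.
  apply: le_trans (_ : \sum_l \sum_i \sum_i' ((okm M (i, i', l))%:R + (Phi i k)%:R + (Phi i l)%:R
     + (Phi i' k)%:R + (Phi i' l)%:R) <= _).
    apply: ler_sum => l _; apply: ler_sum => i _; apply: ler_sum => i' _.
    rewrite /okm -/(Q i i' l) -!natrD ler_nat.
    exact: leq_and_not4.
  have c3 : 3 * N ^+ 2 = N * (N * 3) by ring.
  have c1 (i0 : 'I_n) : \sum_(i < n) \sum_(i' < n) (Phi i i0)%:R <= N * 3 :> R.
    under eq_bigr => i _ do rewrite sumr_const card_ord -[_ *+ n]mulr_natl.
    by rewrite -mulr_sumr; apply: ler_wpM2l.
  have c2 (i0 : 'I_n) : \sum_(i < n) \sum_(i' < n) (Phi i' i0)%:R <= N * 3 :> R.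
    exact: (cst _ _ (fun=> phi_col i0)).
  have e1 := cst _ _ (fun=> c1 k); have e2 := cst _ _ c1.
  have e3 := cst _ _ (fun=> c2 k); have e4 := cst _ _ c2.
  rewrite -c3 in e1 e2 e3 e4.
  under eq_bigr => l _.
    under eq_bigr => i _ do rewrite !big_split /=.
    rewrite !big_split /=.
    over.
  rewrite !big_split /=; lra.
have sab : 24 * de ^+ 2 * N ^+ 3 <= \sum_l a l * b l.
  have h1 : \sum_l a l * (a l - 2 * de * N) <= \sum_l a l * b l.
    by apply: ler_sum => l _; apply: ler_wpM2l.
  apply: le_trans h1.
  have -> : \sum_l a l * (a l - 2 * de * N) = \sum_l a l ^+ 2 - 2 * de * N * \sum_l a l.
    by rewrite mulr_sumr -sumrB; apply: eq_bigr => l _; ring.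
  have cs := sum_sqr_le a (fun=> 1).
  have e1 : \sum_l a l * 1 = \sum_l a l by apply: eq_bigr => l _; rewrite mulr1.
  have e2 : \sum_(l < n) 1 ^+ 2 = N by rewrite expr1n sumr_const card_ord.
  rewrite e1 e2 in cs.
  have N1 : 0 < N.
    rewrite lt_def N0 andbT; apply/eqP => z; move: d5; rewrite z mulr0; lra.
  set A := \sum_l a l in sa cs *.
  have A0 : 0 <= A - 6 * de * N ^+ 2 by lra.
  have cs' : A ^+ 2 / N <= \sum_l a l ^+ 2 by rewrite ler_pdivrMr.
  suff : 24 * de ^+ 2 * N ^+ 3 <= A ^+ 2 / N - 2 * de * N * A by lra.
  have -> : A ^+ 2 / N - 2 * de * N * A = A * (A - 2 * de * N ^+ 2) / N by field; rewrite gt_eqF.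
  rewrite ler_pdivlMr //.
  have -> : 24 * de ^+ 2 * N ^+ 3 * N = 24 * (de * N ^+ 2) * (de * N ^+ 2) by ring.
  rewrite -[2 * de * _]mulrA.
  have p0 : 0 <= de * N ^+ 2 by apply: mulr_ge0; [exact: ltW|exact: sqr_ge0].
  by apply: quadratic_gap => //; rewrite mulrA.
have dN : 12 * N ^+ 2 <= de ^+ 2 * N ^+ 3.
  have -> : de ^+ 2 * N ^+ 3 = de ^+ 2 * N * N ^+ 2 by ring.
  by apply: ler_wpM2r => //; exact: sqr_ge0.
lra.
Qed.

Lemma okm'_count M : M \in fam Phi M0 s t ->
  #|[set p | okm' M p]|%:R = N * ((excess M)%:R * ((excess M)%:R + (t k)%:R - (t j)%:R)) :> R.
Proof.
move=> Mf.
have -> : #|[set p | okm' M p]|%:R = \sum_l \sum_i \sum_i' (okm' M (i, i', l))%:R :> R.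
  by rewrite -card_sum3; congr _%:R; apply: eq_card => -[[i i'] l]; rewrite !inE.
have -> : (excess M)%:R + (t k)%:R - (t j)%:R = \sum_i (~~ M i j && M i k)%:R :> R.
  rewrite excessE -!(colE _ Mf) -big_split -sumrB; apply: eq_bigr => i _ /=.
  by case: (M i j); case: (M i k) => /=; ring.
rewrite excessE big_distrlr /=.
under eq_bigr => l _.
  under eq_bigr => i _.
    under eq_bigr => i' _.
      have -> : (okm' M (i, i', l))%:R = (M i j && ~~ M i k)%:R * (~~ M i' j && M i' k)%:R :> R.
        by rewrite -natrM mulnb /okm' -!andbA.
      over.
    over.
  over.
by rewrite sumr_const card_ord mulr_natl.
Qed.

Lemma okmT M p : M \in fam Phi M0 s t -> okm M p ->
  [/\ Tm M p \in fam Phi M0 s t, okm' (Tm M p) p, Tm (Tm M p) p = M & excess (Tm M p) = (excess M).+1].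
Proof.
case: p => [[i1 i2] l] Mf /andP[/and5P[h1 h2 h3 h4 /andP[h5 h6]] /and4P[p1 p2 p3 p4]].
have i12 : i1 != i2 by apply: contraTneq h1 => ->.
have kl : k != l by apply: contraTneq h2 => ->.
have jl : j != l by apply: contraTneq h1 => ->.
have ej i : tog M i1 i2 k l i j = M i j.
  by rewrite mxE !inE (negbTE jk) (negbTE jl) andbF addbF.
have ek i : tog M i1 i2 k l i k = M i k (+) (i \in [:: i1; i2]).
  by rewrite mxE [k \in _]inE eqxx andbT.
split.
- by apply: tog_fam; rewrite ?h2 ?h3 ?h4 ?(negbTE h3) ?(negbTE h6).
- by rewrite /okm' /Tm !ej !ek h1 h2 h5 !inE !eqxx (negbTE h6) orbT.
- exact: togK.
- have -> : excess (Tm M (i1, i2, l)) = #|i1 |: (csup M j :\: csup M k)|.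
    apply: eq_card => i; rewrite !inE ej ek !inE.
    have [->|ni1] := eqVneq i i1; first by rewrite h1 h2.
    have [->|ni2] := eqVneq i i2; first by rewrite (negbTE h5) !andbF.
    by rewrite addbF.
  by rewrite cardsU1 !inE h1 h2.
Qed.

(* Switching rows i1 and i2 in the columns k and l raises the excess of column j over
   column k; far more such switchings leave a matrix of small excess than enter one. *)
Lemma overlap_tail y : y.+1%:R <= de * N ->
  #|[set M in fam Phi M0 s t | (excess M <= y)%N]|%:R <=
  1 / 2 * #|[set M in fam Phi M0 s t | (excess M <= y.+1)%N]|%:R :> R.
Proof.
move=> hy.
have lower M : M \in [set M in fam Phi M0 s t | (excess M <= y)%N] ->
    23 * de ^+ 2 * N ^+ 3 <= #|[set p | okm M p]|%:R.
  rewrite inE => /andP[Mf Mx]; apply: okm_count => //.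
  by apply: le_trans hy; rewrite ler_nat.
case: (nr) => hs ht [d0 d1 d2 d3 [d4 d5 D0]].
have N1 : 0 < N.
  rewrite lt_def ler0n andbT; apply/eqP => z; move: d5; rewrite z mulr0; lra.
have dN0 : 0 < de ^+ 2 * N ^+ 3 by rewrite mulr_gt0 // exprn_gt0.
apply: (@switch_count R _ _ _ _ Tm okm okm'); first by lra.
- move=> M p; rewrite inE => /andP[Mf Mx] op.
  by have [t1 t2 t3 t4] := okmT Mf op; split=> //; rewrite inE t1 t4 ltnS.
- move=> M MZ; rewrite -(ltr0n R); apply: lt_le_trans (lower _ MZ); lra.
- move=> M p MZ op; have lo := lower _ MZ; move: MZ; rewrite inE => /andP[Mf Mx].
  have [t1 t2 t3 t4] := okmT Mf op.
  rewrite (okm'_count t1) t4.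
  have xb : (excess M).+1%:R <= de * N by apply: le_trans hy; rewrite ler_nat.
  have x0 : 0 <= (excess M).+1%:R :> R by [].
  have := ht j; have := ht k; rewrite !ler_norml => /andP[? ?] /andP[? ?].
  set x := (excess M).+1%:R in xb x0 *.
  have e1 : x * (x + (t k)%:R - (t j)%:R) <= de * N * (2 * (de * N)).
    apply: le_trans (_ : x * (2 * (de * N)) <= _); last by apply: ler_wpM2r; lra.
    by apply: ler_wpM2l => //; lra.
  have e2 := ler_wpM2l (ltW N1) e1.
  have e3 : N * (de * N * (2 * (de * N))) = 2 * (de ^+ 2 * N ^+ 3) by ring.
  rewrite e3 in e2; lra.
Qed.

Lemma overlap_small (y m : nat) : (y + m)%:R <= de * N ->
  2 ^+ m * #|[set M in fam Phi M0 s t | (excess M <= y)%N]|%:R <= #|fam Phi M0 s t|%:R :> R.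
Proof.
move=> hy; apply: le_trans (_ : #|[set M in fam Phi M0 s t | (excess M <= y + m)%N]|%:R <= _).
  elim: m hy => [|m IH] hy; first by rewrite expr0 mul1r addn0.
  have h1 : (y + m)%:R <= de * N by apply: le_trans hy; rewrite ler_nat leq_add2l.
  have h2 : (y + m).+1%:R <= de * N by rewrite -addnS.
  rewrite exprS -mulrA; apply: le_trans (ler_wpM2l _ (IH h1)) _; first by [].
  by have := overlap_tail h2; rewrite addnS; lra.
by rewrite ler_nat; apply: subset_leq_card; apply/subsetP => M; rewrite inE => /andP[].
Qed.

End Overlap.

(** * Exchanging one element of a row *)

Section SwapRatio.
Variables (R : realFieldType) (n : nat) (s t : 'I_n -> nat) (sig Del de : R).
Local Notation N := (n%:R : R).
Hypothesis nr : near_regular s t sig Del de.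
Variables (Phi : 'I_n -> 'I_n -> bool) (M0 : 'M[bool]_n) (i : 'I_n).
Hypothesis Phi2 : forall j, (#|[set a | Phi a j]| <= 2)%N.

Definition fiber (V : {set 'I_n}) := [set M in fam Phi M0 s t | rsup M i == V].

(* The first term accounts for the matrices in which column k barely exceeds column j, the
   second for the imbalance between the two directions of the switch in the others. *)
Definition eta (m : nat) : R := (2 ^+ m)^-1 + (2 * Del + 4) / (m%:R - 3).

Variables (m : nat) (V : {set 'I_n}) (j k : 'I_n).
Hypotheses (m4 : (4 <= m)%N) (m2 : (2 * m)%:R <= de * N).
Hypotheses (jV : j \in V) (kV : k \notin V) (pj : ~~ Phi i j) (pk : ~~ Phi i k).

Let jk : j != k. Proof. by apply: contraTneq jV => ->. Qed.

Let Phi' a b := Phi a b || (a == i).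

(** Fixing row i is a further prescription of cells, so the overlap bound applies inside a fiber. *)
Lemma fiber_fam M1 : M1 \in fiber V -> fiber V = fam Phi' M1 s t.
Proof.
rewrite inE => /andP[/famP[z1 h1] /eqP r1]; apply/setP => M; rewrite inE.
apply/andP/famP => [[/famP[z h] /eqP r]|[z h]]; split=> //.
- move=> a b /orP[p|/eqP->]; first by rewrite h // h1.
  by have /setP/(_ b) : rsup M i = rsup M1 i; [rewrite r r1 | rewrite !inE].
- by apply/famP; split=> // a b p; rewrite h ?h1 // /Phi' p.
- by apply/eqP; rewrite -r1; apply/setP => b; rewrite !inE h // /Phi' eqxx orbT.
Qed.

Lemma fiber_low : 2 ^+ m * #|[set M in fiber V | (excess k j M <= m)%N]|%:R <= #|fiber V|%:R :> R.
Proof.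
have [->|[M1 M1V]] := set_0Vmem (fiber V).
  rewrite cards0 (_ : [set M in _ | _] = set0) ?cards0 ?mulr0 //.
  by apply/setP => M; rewrite !inE.
rewrite (fiber_fam M1V); apply: (overlap_small nr) => //; last by rewrite addnn -mul2n.
  move=> b; apply: leq_trans (_ : #|[set a | Phi a b] :|: [set i]| <= _)%N.
    by apply: subset_leq_card; apply/subsetP => a; rewrite !inE.
  by apply: leq_trans (leq_card_setU _ _) _; rewrite cards1 addn1 ltnS.
by rewrite eq_sym.
Qed.

Let ok (M : 'M[bool]_n) (a : 'I_n) := [&& M a k, ~~ M a j, ~~ Phi a j & ~~ Phi a k].
Let ok' (M : 'M[bool]_n) (a : 'I_n) := [&& M a j, ~~ M a k, ~~ Phi a j & ~~ Phi a k].
Let Tm (M : 'M[bool]_n) (a : 'I_n) := tog M i a j k.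

Lemma fiberP M : M \in fiber V -> [/\ M \in fam Phi M0 s t, M i j, M i k = false & rsup M i = V].
Proof.
rewrite inE => /andP[Mf /eqP r]; split=> //.
  by move: jV; rewrite -r inE.
by apply/negbTE; move: kV; rewrite -r inE.
Qed.

Lemma excess_sum (M : 'M[bool]_n) (a b : 'I_n) : (excess a b M)%:R = \sum_c (M c a && ~~ M c b)%:R :> R.
Proof.
rewrite /excess (_ : _ :\: _ = [set c | M c a && ~~ M c b]) ?card_sum //.
by apply/setP => c; rewrite !inE andbC.
Qed.

Lemma okT M a : M \in fiber V -> ok M a ->
  [/\ Tm M a \in fiber (k |: (V :\ j)), ok' (Tm M a) a, Tm (Tm M a) a = M &
    (excess j k (Tm M a))%:R = (excess k j M)%:R + (t j)%:R - (t k)%:R :> R].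
Proof.
move=> MV /and4P[ak aj pa1 pa2]; have [Mf ij ik r] := fiberP MV.
have ia : i != a by apply: contraNneq aj => <-.
have Tf : Tm M a \in fam Phi M0 s t.
  by apply: tog_fam; rewrite ?ij ?ik ?ak ?(negbTE aj).
have eT c b : Tm M a c b = M c b (+) ((c \in [:: i; a]) && (b \in [:: j; k])) by rewrite mxE.
split.
- rewrite inE Tf; apply/eqP/setP => b; rewrite !inE eT !inE eqxx /=.
  have rb : M i b = (b \in V) by rewrite -r inE.
  have [->|bj] := eqVneq b j; first by rewrite ij (negbTE jk).
  have [->|bk] := eqVneq b k; first by rewrite ik.
  by rewrite rb addbF.
- by rewrite /ok' !eT !inE !eqxx !orbT /= (negbTE aj) ak pa1 pa2.
- exact: togK.
- have [/zoP[_ hc] _] := famP _ _ _ _ _ Mf.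
  have -> : (t j)%:R = \sum_c (M c j)%:R :> R by rewrite -hc card_sum.
  have -> : (t k)%:R = \sum_c (M c k)%:R :> R by rewrite -hc card_sum.
  rewrite !excess_sum -big_split -sumrB /=.
  rewrite (bigD1 i) // (bigD1 a) /= 1?eq_sym // [in RHS](bigD1 i) // [in RHS](bigD1 a) /= 1?eq_sym //.
  rewrite !eT !inE !eqxx !orbT /= ij ik ak (negbTE aj) /=.
  rewrite (eq_bigr (fun c => (M c k && ~~ M c j)%:R + (M c j)%:R - (M c k)%:R)) => [|c /andP[ci ca]].
    by ring.
  rewrite !eT !inE (negbTE ci) (negbTE ca) /= !addbF.
  by case: (M c j); case: (M c k) => /=; ring.
Qed.

(** The reverse choices are at most the excess of j over k after the switch, which differs from the
    old excess of k over j by t j - t k, hence by at most 2 Del. Prescribed cells remove at most 4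
    forward choices, so more than m - 4 of them, at least m - 3, remain. *)
Lemma fiber_high : #|[set M in fiber V | (m < excess k j M)%N]|%:R <=
  (1 + (2 * Del + 4) / (m%:R - 3)) * #|fiber (k |: (V :\ j))|%:R :> R.
Proof.
case: (nr) => hs ht [d0 d1 d2 d3 [d4 d5 D0]].
have m3 : 0 < m%:R - 3 :> R by rewrite subr_gt0 (ltr_nat _ 3).
have kap0 : 0 <= (2 * Del + 4) / (m%:R - 3) by rewrite divr_ge0 ?(ltW m3) //; lra.
have lower M : M \in fiber V -> (excess k j M)%:R - 4 <= #|[set a | ok M a]|%:R :> R.
  move=> MV.
  have p2 b : \sum_a (Phi a b)%:R <= 2 :> R by rewrite -card_sum (ler_nat _ _ 2).
  have : (excess k j M)%:R <= #|[set a | ok M a]|%:R + \sum_a (Phi a j)%:R + \sum_a (Phi a k)%:R :> R.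
    rewrite excess_sum card_sum -!big_split /=; apply: ler_sum => a _.
    rewrite -!natrD ler_nat /ok.
    by case: (M a j); case: (M a k); case: (Phi a j); case: (Phi a k).
  by have := p2 j; have := p2 k; lra.
apply: (@switch_count R _ _ _ _ Tm ok ok'); first by lra.
- by move=> M a; rewrite inE => /andP[MV _] oka; have [] := okT MV oka.
- move=> M; rewrite inE => /andP[MV mx]; rewrite -(ltr0n R); apply: lt_le_trans (lower _ MV).
  have : m%:R < (excess k j M)%:R :> R by rewrite ltr_nat.
  have : 4 <= m%:R :> R by rewrite (ler_nat _ 4).
  lra.
- move=> M a; rewrite inE => /andP[MV mx] oka; have [_ _ _ e] := okT MV oka.
  have up : #|[set z | ok' (Tm M a) z]|%:R <= (excess j k (Tm M a))%:R :> R.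
    rewrite card_sum excess_sum; apply: ler_sum => z _; rewrite ler_nat /ok'.
    by case: (Tm M a z j); case: (Tm M a z k); case: (Phi z j); case: (Phi z k).
  rewrite e in up; apply: le_trans up _.
  have := ht j; have := ht k; rewrite !ler_norml => /andP[? ?] /andP[? ?].
  have mx' : m.+1%:R <= (excess k j M)%:R :> R by rewrite ler_nat.
  rewrite -addn1 natrD in mx'.
  have := lower _ MV; set x := (excess k j M)%:R in mx' *; set y := #|_|%:R => xy.
  have h : 2 * Del + 4 <= (2 * Del + 4) / (m%:R - 3) * y.
    rewrite mulrAC ler_pdivlMr //; apply: ler_wpM2l; lra.
  lra.
Qed.

(** Matrices of small excess form a fraction at most 2^-m of the fiber; the others are switched.
    When the second term of [eta] exceeds 1 the left side is not positive. *)
Lemma swap_ratio : (1 - eta m) * #|fiber V|%:R <= #|fiber (k |: (V :\ j))|%:R :> R.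
Proof.
case: (nr) => hs ht [d0 d1 d2 d3 [d4 d5 D0]].
have m3 : 0 < m%:R - 3 :> R by rewrite subr_gt0 (ltr_nat _ 3).
have kap0 : 0 <= (2 * Del + 4) / (m%:R - 3) by rewrite divr_ge0 ?(ltW m3) //; lra.
have hi := fiber_high; have lo := fiber_low.
have split : #|fiber V|%:R = #|[set M in fiber V | (excess k j M <= m)%N]|%:R +
    #|[set M in fiber V | (m < excess k j M)%N]|%:R :> R.
  rewrite -natrD; congr _%:R; rewrite -(cardsID [set M | (excess k j M <= m)%N] (fiber V)).
  by congr (_ + _)%N; apply: eq_card => M; rewrite !inE // -ltnNge andbC.
rewrite /eta; set ka := _ / _ in hi kap0 *.
set A := #|fiber V|%:R in lo split *; set B := #|fiber (k |: _)|%:R in hi *.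
set L := #|_|%:R in lo split; set H := #|_|%:R in split hi.
have p2 : 0 < 2 ^+ m :> R by rewrite exprn_gt0.
have L0 : 0 <= L by exact: ler0n.
have A0 : 0 <= A by exact: ler0n.
have B0 : 0 <= B by exact: ler0n.
have lo' : L <= (2 ^+ m)^-1 * A by rewrite ler_pdivlMl.
set ep := (2 ^+ m)^-1 in lo' *.
have ep0 : 0 <= ep by rewrite invr_ge0 ltW.
have h : (1 - ep) * A <= (1 + ka) * B by lra.
have [k1|k1] := leP ka 1; last first.
  apply: le_trans (_ : 0 <= _) => //; apply: mulr_le0_ge0 => //; lra.
have h2 : (1 - ka) * ((1 - ep) * A) <= (1 - ka) * ((1 + ka) * B) by apply: ler_wpM2l => //; lra.
have kkB : 0 <= ka * ka * B by do 2!apply: mulr_ge0 => //.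
have keA : 0 <= ka * ep * A by do 2!apply: mulr_ge0 => //.
lra.
Qed.

End SwapRatio.

(** * Existence of a matrix with given margins *)

Section Shift.
Variable n : nat.
Implicit Types (M : 'M[bool]_n).

Definition shift M (i j k : 'I_n) : 'M[bool]_n :=
  \matrix_(a, b) M a (if a == i then tperm j k b else b).

Lemma shift_rsup M i j k a : #|rsup (shift M i j k) a| = #|rsup M a|.
Proof.
rewrite -(card_imset (mem (rsup M a)) (@perm_inj _ (if a == i then tperm j k else 1%g))).
apply: eq_card => b; rewrite !inE mxE; apply/idP/imsetP => [h|[x]].
  exists (if a == i then tperm j k b else b); first by rewrite inE.
  by case: (a == i); rewrite ?tpermK ?perm1.
by rewrite inE => h ->; move: h; case: (a == i) => h; rewrite ?tpermK ?perm1.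
Qed.

Lemma shift_csup M i j k b : M i j -> ~~ M i k ->
  #|csup (shift M i j k) b| = if b == j then #|csup M j|.-1 else if b == k then #|csup M k|.+1 else #|csup M b|.
Proof.
move=> ij ik; have [->|bj] := eqVneq b j.
  rewrite (cardsD1 i (csup M j)) inE ij /=; apply: eq_card => a; rewrite !inE mxE.
  by have [->|] := eqVneq a i; rewrite // tpermL (negbTE ik).
have [->|bk] := eqVneq b k.
  transitivity #|i |: csup M k|; last by rewrite cardsU1 inE ik.
  apply: eq_card => a; rewrite !inE mxE.
  by have [->|] := eqVneq a i; rewrite // tpermR ij.
by apply: eq_card => a; rewrite !inE mxE tpermD 1?eq_sym // if_same.
Qed.

Lemma shift_descent M i j k (F : 'I_n -> nat -> nat) : M i j -> ~~ M i k ->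
  (F j #|csup M j|.-1 + F k #|csup M k|.+1 < F j #|csup M j| + F k #|csup M k|)%N ->
  (\sum_b F b #|csup (shift M i j k) b| < \sum_b F b #|csup M b|)%N.
Proof.
move=> ij ik h; have kj : k != j by apply: contraNneq ik => ->.
rewrite (bigD1 j) // (bigD1 k) //= [X in (_ < X)%N](bigD1 j) // [X in (_ < _ + X)%N](bigD1 k) //=.
rewrite !(shift_csup _ ij ik) !eqxx (negbTE kj).
rewrite (eq_bigr (fun b => F b #|csup M b|)) => [|b /andP[bj bk]]; first by rewrite !addnA ltn_add2r.
by rewrite (shift_csup _ ij ik) (negbTE bj) (negbTE bk).
Qed.

Lemma column_shift M j k : (#|csup M k| < #|csup M j|)%N -> exists2 i, M i j & ~~ M i k.
Proof.
move=> h; have /subsetPn[i] : ~~ (csup M j \subset csup M k).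
  by apply: contraTN h => /subset_leq_card; rewrite -leqNgt.
by rewrite !inE => ? ?; exists i.
Qed.

(** A minimiser of the sum of squared column sums works: if two columns differed by 2 or more,
    shifting a unit between them would lower the sum. *)
Lemma balanced_columns (s : 'I_n -> nat) : (forall i, s i <= n)%N ->
  exists2 M, (forall i, #|rsup M i| = s i) & forall j k, (#|csup M j| <= #|csup M k|.+1)%N.
Proof.
move=> sn.
pose P M := [forall i, #|rsup M i| == s i].
pose M0 : 'M[bool]_n := \matrix_(i, j) (j < s i)%N.
have P0 : P M0.
  apply/forallP => i; rewrite -sum1_card.
  rewrite (eq_bigl (fun j : 'I_n => (j < s i)%N)) => [|j]; last by rewrite !inE mxE.
  by rewrite -(big_ord_widen n (fun=> 1%N) (sn i)) sum1_card card_ord.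
case: (arg_minnP (fun M => \sum_b #|csup M b| ^ 2)%N P0) => M /forallP PM min.
exists M => [i|j k]; first exact/eqP.
rewrite leqNgt; apply/negP => h.
have [i ij ik] := column_shift (ltnW h).
have PS : P (shift M i j k) by apply/forallP => a; rewrite shift_rsup.
have := min _ PS; rewrite leqNgt => /negP; apply.
apply: (shift_descent (F := fun _ c => (c ^ 2)%N)) => //; nia.
Qed.

End Shift.

(* Among near-regular column sums, take those closest to t; overlap_small provides a matrix
   with the same margins in which column j is not contained in column k, so that one unit
   can still be moved from j to k. *)
Lemma zo_nonempty (R : realFieldType) (n : nat) (s t : 'I_n -> nat) (sig Del de : R) :
  near_regular s t sig Del de -> (\sum_i s i = \sum_j t j)%N -> exists M, M \in zo_mats s t.
Proof.
move=> nr st; case: (nr) => hs ht [d0 d1 d2 d3 [d4 d5 D0]].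
have sn i : (s i <= n)%N.
  rewrite -(ler_nat R); have := hs i; rewrite ler_norml => /andP[_ ?]; lra.
have total (M : 'M[bool]_n) : (forall i, #|rsup M i| = s i) -> (\sum_j #|csup M j| = \sum_j t j)%N.
  move=> h; rewrite -st -(eq_bigr _ (fun i _ => h i)).
  under eq_bigr do rewrite -sum1_card; rewrite [RHS](eq_bigr (fun i => \sum_(j in rsup M i) 1)%N) => [|i _]; last by rewrite sum1_card.
  rewrite [RHS](exchange_big_dep xpredT) //=; apply: eq_bigr => j _; apply: eq_bigl => i.
  by rewrite !inE.
pose P (M : 'M[bool]_n) := [forall i, #|rsup M i| == s i] && [forall j, `|#|csup M j|%:R - sig| <= Del].
have [M0 P0] : exists M0, P M0.
  have [M r bal] := balanced_columns sn; exists M; apply/andP; split; first by apply/forallP => i; rewrite r.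
  apply/forallP => j; rewrite ler_norml; apply/andP; split.
    have [/existsP[k h]|/existsPn h] := boolP [exists k, (t k <= #|csup M j|)%N].
      by have := ht k; rewrite ler_norml => /andP[? _]; move: h; rewrite -(ler_nat R); lra.
    (* Here every t k exceeds column j, so balance bounds each column by its target, strictly at j,
       against the equal totals. *)
    have : (\sum_k #|csup M k| < \sum_k t k)%N; last by rewrite (total M r) ltnn.
    rewrite (bigD1 j) // [X in (_ < X)%N](bigD1 j) //=.
    rewrite -addSn leq_add ?ltnNge ?h //; apply: leq_sum => k _.
    by apply: leq_trans (bal k j) _; rewrite ltnNge h.
  have [/existsP[k h]|/existsPn h] := boolP [exists k, (#|csup M j| <= t k)%N].
    by have := ht k; rewrite ler_norml => /andP[_ ?]; move: h; rewrite -(ler_nat R); lra.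
  have : (\sum_k t k < \sum_k #|csup M k|)%N; last by rewrite (total M r) ltnn.
  rewrite (bigD1 j) // [X in (_ < X)%N](bigD1 j) //=.
  rewrite -addSn leq_add ?ltnNge ?h //; apply: leq_sum => k _.
  by rewrite -ltnS; apply: leq_trans (bal j k); rewrite ltnNge h.
pose dist c b := ((c - t b) + (t b - c))%N.
case: (arg_minnP (fun M => \sum_b dist #|csup M b| b)%N P0) => M /andP[/forallP PM /forallP cM] min.
have r i : #|rsup M i| = s i by exact/eqP.
exists M; apply/zoP; split=> // j0; apply/eqP; apply: contraT => j0n.
have tot := total M r.
have [j hj] : exists j, (t j < #|csup M j|)%N.
  apply/existsP; apply: contraT => /existsPn h.
  have : (\sum_k #|csup M k| < \sum_k t k)%N; last by rewrite tot ltnn.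
  rewrite (bigD1 j0) // [X in (_ < X)%N](bigD1 j0) //=.
  rewrite -addSn leq_add //; first by rewrite ltn_neqAle j0n leqNgt h.
  by apply: leq_sum => k _; rewrite leqNgt h.
have [k hk] : exists k, (#|csup M k| < t k)%N.
  apply/existsP; apply: contraT => /existsPn h.
  have : (\sum_k t k < \sum_k #|csup M k|)%N; last by rewrite tot ltnn.
  rewrite (bigD1 j0) // [X in (_ < X)%N](bigD1 j0) //=.
  rewrite -addSn leq_add //; first by rewrite ltn_neqAle eq_sym j0n leqNgt h.
  by apply: leq_sum => l _; rewrite leqNgt h.
have jk : j != k by apply: contraTneq hj => ->; rewrite -leqNgt ltnW.
pose c b := #|csup M b|.
have nrc : near_regular s c sig Del de by split.
have Mc : M \in zo_mats s c by apply/zoP.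
pose Phi (_ _ : 'I_n) := false.
have Phi3 b : (#|[set a | Phi a b]| <= 3)%N by rewrite (_ : [set a | _] = set0) ?cards0 //; apply/setP => a; rewrite !inE.
have famE A : (A \in fam Phi M s c) = (A \in zo_mats s c).
  by apply/famP/idP => [[]|].
have [A Az /subsetPn[i]] : exists2 A, A \in zo_mats s c & ~~ (csup A j \subset csup A k).
  have [/existsP[A /andP[? ?]]|/existsPn h] := boolP [exists A, (A \in zo_mats s c) && ~~ (csup A j \subset csup A k)].
    by exists A.
  (* With y = 0 and m = 1: at most half of the matrices with these margins have column j inside
     column k. *)
  have := overlap_small nrc M Phi3 jk (y := 0) (m := 1).
  rewrite (_ : [set A in fam Phi M s c | _] = fam Phi M s c) => [H|].
    have pos : 0 < #|fam Phi M s c|%:R :> R by rewrite ltr0n; apply/card_gt0P; exists M; rewrite famE.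
    have h1 : (0 + 1)%:R <= de * n%:R by move: D0 d4; rewrite add0n; lra.
    by have := H h1; rewrite expr1; lra.
  apply/setP => A; rewrite [LHS]inE famE leqn0 cards_eq0 setD_eq0.
  by have := h A; rewrite negb_and negbK; case: (A \in _) => //= ->.
rewrite !inE => Aij Aik.
have /zoP[rA cA] := Az.
have PS : P (shift A i j k).
  apply/andP; split; apply/forallP => b; rewrite ?shift_rsup ?rA //.
  rewrite (shift_csup _ Aij Aik) !cA.
  case: eqP => _; [|case: eqP => _; last exact: cM].
    have := cM j; have := ht j; rewrite -/(c j) in hj *; move: hj.
    rewrite -/(c j); case: (c j) => //= cj; rewrite ltnS -(ler_nat R) -addn1 natrD !ler_norml.
    move=> ? /andP[? ?] /andP[? ?]; apply/andP; split; lra.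
  have := cM k; have := ht k; rewrite -/(c k) in hk *; move: hk.
  rewrite -(ler_nat R) -addn1 natrD !ler_norml.
  move=> ? /andP[? ?] /andP[? ?]; apply/andP; split; lra.
have := min _ PS; rewrite leqNgt => /negP[].
rewrite [X in (_ < X)%N](eq_bigr (fun b => dist #|csup A b| b)) => [|b _]; last by rewrite cA.
apply: (shift_descent (F := fun b c => dist c b)) => //.
rewrite !cA /dist -/(c j) -/(c k); move: hj hk; rewrite -/(c j) -/(c k).
by move: (c j) (c k) (t j) (t k) => a b d e; clear; lia.
Qed.

From mathcomp Require Import all_classical all_reals all_analysis.
Import Order.TTheory GRing.Theory Num.Theory.
Import numFieldNormedType.Exports.
Local Open Scope ring_scope.

(** * The permanent of a flat perturbation of the all-ones matrix *)

Section Gronwall.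
Variable R : realType.

Lemma is_derive_continuous (F dF : R -> R) :
  (forall x : R, is_derive x 1 F (dF x)) -> continuous F.
Proof.
move=> h x; apply/differentiable_continuous/derivable1_diffP.
by have [] := h x.
Qed.

(** F exp(-Q) has nonpositive derivative. No sign of F is assumed, so that the reverse bound follows
    from - F. *)
Lemma gronwall_le (F dF Q dQ : R -> R) (a b : R) : a <= b ->
  (forall x : R, is_derive x 1 F (dF x)) -> (forall x : R, is_derive x 1 Q (dQ x)) ->
  (forall x, a < x < b -> dF x <= dQ x * F x) -> F b <= F a * expR (Q b - Q a).
Proof.
move=> ab hF hQ h.
pose g x := F x * expR (- Q x).
pose dg x := (dF x - dQ x * F x) * expR (- Q x).
have hg (x : R) : is_derive x 1 g (dg x).
  have hN : is_derive x 1 (fun y => - Q y) (- dQ x) by exact: is_deriveN.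
  have hE : is_derive x 1 (expR \o (fun y => - Q y)) (expR (- Q x) * - dQ x).
    exact: is_derive1_comp.
  have d := is_deriveM (hF x) hE.
  apply: (is_derive_eq d); rewrite /dg /GRing.scale /=; ring.
have gb : g b <= g a.
  move: ab; rewrite le_eqVlt => /predU1P[->//|ab].
  have [x xab e] := MVT ab (fun x _ => hg x) (continuous_subspaceT (is_derive_continuous hg)).
  rewrite -subr_le0 e; apply: mulr_le0_ge0; last by rewrite subr_ge0 ltW.
  rewrite /dg; apply: mulr_le0_ge0; last exact: expR_ge0.
  by rewrite subr_le0; apply: h; move: xab; rewrite in_itv.
have e : F b = g b * expR (Q b) by rewrite /g -mulrA -expRD addNr expR0 mulr1.
rewrite e [X in _ <= X](_ : _ = g a * expR (Q b)); last by rewrite /g expRD; ring.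
by apply: ler_wpM2r => //; exact: expR_ge0.
Qed.

Lemma gronwall_ge (F dF Q dQ : R -> R) (a b : R) : a <= b ->
  (forall x : R, is_derive x 1 F (dF x)) -> (forall x : R, is_derive x 1 Q (dQ x)) ->
  (forall x, a < x < b -> dQ x * F x <= dF x) -> F a * expR (Q b - Q a) <= F b.
Proof.
move=> ab hF hQ h.
have hN (x : R) : is_derive x 1 (fun y => - F y) (- dF x) by exact: is_deriveN.
have := gronwall_le ab hN hQ _; rewrite mulNr lerN2; apply => x xab.
by rewrite mulrN lerN2; exact: h.
Qed.

End Gronwall.

Section PermanentExpansion.
Variables (R : realType) (n : nat) (q T : R) (K : nat).
Local Notation N := (n%:R : R).
Variable U : 'I_n -> 'I_n -> R.

Lemma deriv_prod (I : eqType) (r : seq I) (p : I -> {poly R}) : uniq r ->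
  (\prod_(i <- r) p i)^`() = \sum_(i <- r) (p i)^`() * \prod_(j <- r | j != i) p j.
Proof.
elim: r => [|i r IH] /=; first by rewrite !big_nil derivC.
move=> /andP[ir ur]; rewrite !big_cons derivM IH // eqxx /=; congr (_ * _ + _).
  rewrite big_seq_cond [RHS]big_seq_cond; apply: eq_bigl => j; rewrite andbT.
  by case jr : (j \in r) => //=; apply/esym; apply: contraNneq ir => <-.
rewrite mulr_sumr; apply: eq_big_seq => j jr; rewrite big_cons.
have -> : i != j by apply: contraNneq ir => ->.
by rewrite mulrCA.
Qed.

Definition wpoly i j : {poly R} := 1 + U i j *: 'X.

(** As a polynomial in theta the permanent is differentiated formally, and the derivative is read
    off term by term. *)
Definition permpoly : {poly R} := \sum_(sg : 'S_n) \prod_i wpoly i (sg i).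

Lemma permpolyE (th : R) : permpoly.[th] = pm (wt th U) [::].
Proof.
rewrite pm_nil horner_sum; apply: eq_bigr => sg _; rewrite horner_prod.
by apply: eq_bigr => i _; rewrite /wpoly /wt !hornerE mulrC.
Qed.

Lemma deriv_permpolyE (th : R) :
  (permpoly^`()).[th] = \sum_i \sum_j U i j * pm (wt th U) [:: (i, j)].
Proof.
have -> : permpoly^`() = \sum_(sg : 'S_n) \sum_i (wpoly i (sg i))^`() * \prod_(j | j != i) wpoly j (sg j).
  rewrite /permpoly raddf_sum /=; apply: eq_bigr => sg _.
  by rewrite deriv_prod ?index_enum_uniq.
rewrite horner_sum; under eq_bigr => sg _ do rewrite horner_sum.
rewrite exchange_big /=; apply: eq_bigr => i _.
rewrite (partition_big (fun sg : 'S_n => sg i) xpredT) //=; apply: eq_bigr => j _.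
rewrite /pm mulr_sumr; apply: eq_big => [sg|sg /eqP e]; first by rewrite /extends /= andbT.
rewrite hornerM horner_prod /wpoly e; congr (_ * _).
  by rewrite derivD derivC add0r derivZ derivX !hornerE.
apply: eq_big => [k|k _]; first by rewrite /= inE.
by rewrite /wt !hornerE mulrC.
Qed.

Hypotheses (q2 : 2 <= q) (qT : q <= T) (nbig : q ^+ 60 * T <= N).
Hypothesis Kbig : (1 - (16 * q ^+ 2)^-1) ^+ K <= (N ^+ 2)^-1.
Hypothesis Kq : (3 * K).+4%:R <= q ^+ 4.
Hypothesis flU : flat q T U.

Theorem permanent_expansion : exists2 d : R, `|d| <= q ^+ 46 * T / N &
  \sum_(sg : 'S_n) \prod_i (1 + U i (sg i)) =
  n`!%:R * expR ((\sum_i \sum_j U i j) / N + (\sum_i \sum_j U i j ^+ 2) / (2 * N ^+ 2) + d).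
Proof.
pose a1 := (\sum_i \sum_j U i j) / N; pose a2 := (\sum_i \sum_j U i j ^+ 2) / N ^+ 2.
pose ka := q ^+ 46 * T / N.
pose F := horner permpoly; pose dF := horner permpoly^`().
have hF (x : R) : is_derive x 1 F (dF x) by exact: is_derive_poly.
pose Qp (c : R) : {poly R} := (a1 + c) *: 'X + (a2 / 2) *: 'X^2.
have hQ c (x : R) : is_derive x 1 (horner (Qp c)) ((Qp c)^`().[x]) by exact: is_derive_poly.
have dQ c x : (Qp c)^`().[x] = a1 + x * a2 + c.
  rewrite /Qp; move: (a1) (a2) => b1 b2.
  by rewrite derivD !derivZ derivX derivXn !hornerE /=; field.
have vF x : 0 < x < 1 -> `|dF x - (a1 + x * a2) * F x| <= ka * F x.
  move=> /andP[x0 x1]; rewrite /F /dF deriv_permpolyE permpolyE.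
  exact: (derivative_near (ltW x0) (ltW x1) q2 qT nbig Kbig Kq flU).
have F0 : F 0 = n`!%:R.
  rewrite /F permpolyE pm_nil; under eq_bigr => sg _.
    rewrite big1 => [|i _]; last by rewrite /wt mul0r addr0.
    over.
  by rewrite sumr_const card_Sn.
have F1 : F 1 = \sum_(sg : 'S_n) \prod_i (1 + U i (sg i)).
  rewrite /F permpolyE pm_nil; apply: eq_bigr => sg _; apply: eq_bigr => i _.
  by rewrite /wt mul1r.
have QQ c : (Qp c).[1] - (Qp c).[0] = a1 + a2 / 2 + c by rewrite /Qp !hornerE /=; ring.
have up : F 1 <= F 0 * expR (a1 + a2 / 2 + ka).
  rewrite -QQ; apply: (gronwall_le ler01 hF (hQ ka)) => x x01; rewrite dQ.
  by have := vF x x01; rewrite ler_norml => /andP[_ ?]; rewrite mulrDl -lerBlDl.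
have lo : F 0 * expR (a1 + a2 / 2 - ka) <= F 1.
  rewrite -QQ; apply: (gronwall_ge ler01 hF (hQ (- ka))) => x x01; rewrite dQ.
  by have := vF x x01; rewrite ler_norml => /andP[? _]; rewrite mulrDl mulNr addrC -lerBrDr.
have F0p : 0 < F 0 by rewrite F0 ltr0n fact_gt0.
have F1p : 0 < F 1 by apply: lt_le_trans lo; rewrite mulr_gt0 // expR_gt0.
exists (ln (F 1 / F 0) - (a1 + a2 / 2)); last first.
  rewrite -F1 -F0 [X in expR X](_ : _ = ln (F 1 / F 0)); last first.
    by rewrite /a1 /a2; field; rewrite gt_eqF //; exact: N_gt0 q2 qT nbig.
  by rewrite lnK ?posrE ?divr_gt0 // mulrC divfK // gt_eqF.
have e1 : ln (F 1 / F 0) <= a1 + a2 / 2 + ka.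
  rewrite -ler_expR lnK ?posrE ?divr_gt0 //; rewrite ler_pdivrMr // mulrC; exact: up.
have e2 : a1 + a2 / 2 - ka <= ln (F 1 / F 0).
  rewrite -ler_expR lnK ?posrE ?divr_gt0 //; rewrite ler_pdivlMr // mulrC; exact: lo.
by rewrite -/ka ler_norml; apply/andP; split; lra.
Qed.

End PermanentExpansion.

(** * Concentration of row statistics *)

Section Derivatives.
Variable R : realType.

Lemma is_derive_bigsum (I : Type) (r : seq I) (h : I -> R -> R) (dh : I -> R) (x : R) :
  (forall i, is_derive x 1 (h i) (dh i)) ->
  is_derive x 1 (fun y => \sum_(i <- r) h i y) (\sum_(i <- r) dh i).
Proof.
move=> hd; elim: r => [|i r IH].
  rewrite big_nil (_ : (fun y => _) = cst 0); first exact: is_derive_cst.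
  by apply/funext => y; rewrite big_nil.
rewrite big_cons (_ : (fun y => _) = h i + (fun y => \sum_(i <- r) h i y)); first exact: is_deriveD.
by apply/funext => y; rewrite big_cons.
Qed.

Lemma is_derive_mulr (c x : R) : is_derive x 1 (fun y => y * c) c.
Proof.
have d := is_deriveM (is_derive_id x (1 : R)) (is_derive_cst c x (1 : R)).
by apply: (is_derive_eq d); rewrite /GRing.scale /=; ring.
Qed.

Lemma is_derive_expM (a c x : R) :
  is_derive x 1 (fun y => a * expR (y * c)) (c * (a * expR (x * c))).
Proof.
have d1 : is_derive x 1 (expR \o (fun y : R => y * c)) (expR (x * c) * c).
  by apply: is_derive1_comp; exact: is_derive_mulr.
have d := is_deriveM (is_derive_cst a x (1 : R)) d1.
by apply: (is_derive_eq d); rewrite /GRing.scale /=; ring.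
Qed.

End Derivatives.

Section ExchangeableSubset.
Variables (R : realType) (n sz : nat).
Local Notation N := (n%:R : R).
Variables (nu : {set 'I_n} -> R) (f : pred 'I_n) (u : 'I_n -> R) (B eta : R).
Hypotheses (nu0 : forall V, 0 <= nu V) (nu_sz : forall V : {set 'I_n}, #|V| != sz -> nu V = 0).
Hypothesis swap : forall (V : {set 'I_n}) (j k : 'I_n), j \in V -> k \notin V -> f j -> f k ->
  (1 - eta) * nu V <= nu (k |: (V :\ j)).
Hypotheses (f1 : (#|[set j | ~~ f j]| <= 1)%N) (uB : forall j, `|u j| <= B).
Hypotheses (n0 : (0 < n)%N) (eta0 : 0 <= eta) (eta1 : eta <= 1).

Definition stat (V : {set 'I_n}) : R := \sum_(j in V) u j.
(** The expectation of [stat] for a uniformly random subset of size [sz]. *)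
Definition mean : R := sz%:R / N * \sum_j u j.
Definition mgf (x : R) : R := \sum_V nu V * expR (x * stat V).

Let N0 : 0 < N. Proof. by rewrite ltr0n. Qed.
Let B0 : 0 <= B. Proof. by apply: le_trans (uB (Ordinal n0)). Qed.

Local Notation triple := ({set 'I_n} * 'I_n * 'I_n)%type.
Let c (p : triple) := [&& p.1.2 \in p.1.1, p.2 \notin p.1.1, f p.1.2 & f p.2].
Let phi (p : triple) : triple := (p.2 |: (p.1.1 :\ p.1.2), p.2, p.1.2).

Let phiK p : c p -> phi (phi p) = p.
Proof.
case: p => [[V j] k]; rewrite /c /phi /= => /and4P[jV kV _ _].
congr (_, _, _); apply/setP => a; rewrite !inE.
have [->|aj] := eqVneq a j; first by rewrite jV.
have [->|ak] := eqVneq a k; first by rewrite (negbTE kV).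
by [].
Qed.

Let phic p : c p -> c (phi p).
Proof.
case: p => [[V j] k]; rewrite /c /phi /= => /and4P[jV kV fj fk].
have jk : j != k by apply: contraTneq jV => ->.
by rewrite fj fk !inE eqxx (negbTE jk) eqxx.
Qed.

Let sum_phi (F : triple -> R) : \sum_(p | c p) F p = \sum_(p | c p) F (phi p).
Proof.
rewrite (reindex_onto phi phi) => [|p cp]; last exact: phiK.
apply: eq_bigl => p; apply/andP/idP => [[cp /eqP e]|cp]; first by rewrite -e; exact: phic.
by rewrite phic // phiK.
Qed.

Lemma stat_swap (V : {set 'I_n}) j k : j \in V -> k \notin V ->
  stat (k |: (V :\ j)) = stat V - (u j - u k).
Proof.
move=> jV kV; rewrite /stat big_setU1 /=; last by rewrite !inE (negbTE kV) andbF.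
by rewrite [in RHS](big_setD1 j) //=; ring.
Qed.

(** The total change of [stat] over all exchanges of an element for a non-element measures its
    distance from the mean; this converts near-invariance under exchanges into concentration about
    [mean]. *)
Lemma stat_pairs (V : {set 'I_n}) : #|V| = sz ->
  \sum_j \sum_k (j \in V)%:R * (k \notin V)%:R * (u j - u k) = N * stat V - sz%:R * \sum_j u j.
Proof.
move=> cV.
have e1 : \sum_j (j \in V)%:R * u j = stat V.
  by rewrite /stat [RHS]big_mkcond; apply: eq_bigr => j _; case: (j \in V); rewrite ?mul1r ?mul0r.
have e2 : \sum_(j < n) (j \in V)%:R = sz%:R :> R.
  by rewrite -cV -sum1_card natr_sum [RHS]big_mkcond; apply: eq_bigr => j _; case: (j \in V).
have e3 : \sum_(k < n) (k \notin V)%:R = N - sz%:R :> R.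
  rewrite -e2 -[in N](card_ord n) -sum1_card natr_sum -sumrB; apply: eq_bigr => j _.
  by case: (j \in V); rewrite /= ?subrr ?subr0.
have e4 : \sum_k (k \notin V)%:R * u k = \sum_j u j - stat V.
  rewrite -e1 -sumrB; apply: eq_bigr => j _.
  by case: (j \in V); rewrite /= ?mul1r ?mul0r ?subrr ?subr0.
transitivity (\sum_j ((j \in V)%:R * u j * (N - sz%:R) - (j \in V)%:R * (\sum_j u j - stat V))).
  apply: eq_bigr => j _; rewrite -e3 -e4 !mulr_sumr -sumrB; apply: eq_bigr => k _; ring.
by rewrite sumrB -!mulr_suml e1 e2; ring.
Qed.

Let A (x : R) V := nu V * expR (x * stat V).

Let A0 x V : 0 <= A x V. Proof. by rewrite mulr_ge0 // expR_ge0. Qed.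

Let zeta (x : R) := eta + 2 * B * x.

Lemma u_diff j k : `|u j - u k| <= 2 * B.
Proof. by apply: le_trans (ler_normB _ _) _; have := uB j; have := uB k; lra. Qed.

Let swapA x p : 0 <= x -> c p -> (1 - zeta x) * A x p.1.1 <= A x (phi p).1.1.
Proof.
case: p => [[V j] k]; rewrite /c /phi /A /= => x0 /and4P[jV kV fj fk].
have h1 := swap jV kV fj fk.
rewrite stat_swap // mulrBr expRD.
set E := expR (x * stat V); have E0 : 0 <= E by exact: expR_ge0.
have h2 : 1 - 2 * B * x <= expR (- (x * (u j - u k))).
  apply: le_trans (expR_ge1Dx _); rewrite lerD2l lerN2.
  rewrite mulrC; apply: ler_wpM2r => //; apply: le_trans (ler_norm _) (u_diff _ _).
set G := expR _ in h2 *; have G0 : 0 <= G by exact: expR_ge0.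
have h3 : (1 - eta) * nu V * G <= nu (k |: (V :\ j)) * G by apply: ler_wpM2r.
have e0 : 0 <= (1 - eta) * nu V by rewrite mulr_ge0 // subr_ge0.
have h4 : (1 - eta) * nu V * (1 - 2 * B * x) <= (1 - eta) * nu V * G by apply: ler_wpM2l.
have h5 : (1 - zeta x) * nu V <= (1 - eta) * nu V * (1 - 2 * B * x).
  have : 0 <= eta * (2 * B * x) * nu V by rewrite !mulr_ge0.
  by rewrite /zeta; lra.
have h6 := le_trans h5 (le_trans h4 h3).
have := ler_wpM2r E0 h6; lra.
Qed.

Let D x := \sum_(p | c p) (u p.1.2 - u p.2) * A x p.1.1.

(** The involution [phi] reverses an exchange and the sign of u j - u k, so only the difference of
    the two weights counts. [zeta] bounds it: [eta] for [nu], and 2 B x for the exponential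
    factor. *)
Let D_le x : 0 <= x -> `|D x| <= 2 * B * zeta x * (N * N * mgf x).
Proof.
move=> x0.
have z0 : 0 <= zeta x by rewrite addr_ge0 // !mulr_ge0.
have e : D x + D x = \sum_(p | c p) (u p.1.2 - u p.2) * (A x p.1.1 - A x (phi p).1.1).
  rewrite /D [X in _ + X]sum_phi -big_split /=; apply: eq_bigr => p _.
  by rewrite /phi /=; ring.
have h : `|D x + D x| <= \sum_(p | c p) 2 * B * (zeta x * (A x p.1.1 + A x (phi p).1.1)).
  rewrite e; apply: le_trans (ler_norm_sum _ _ _) _; apply: ler_sum => p cp.
  rewrite normrM; apply: ler_pM => //; first exact: u_diff.
  have h1 := swapA x0 cp; have h2 := swapA x0 (phic cp); rewrite phiK // in h2.
  have a1 := A0 x p.1.1; have a2 := A0 x (phi p).1.1.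
  have za1 := mulr_ge0 z0 a1; have za2 := mulr_ge0 z0 a2.
  by rewrite ler_norml; apply/andP; split; lra.
have h3 : \sum_(p | c p) A x p.1.1 <= N * N * mgf x.
  apply: le_trans (_ : \sum_(p : triple) A x p.1.1 <= _).
    by rewrite [X in _ <= X](bigID c) /= lerDl; apply: sumr_ge0.
  rewrite -(pair_bigA _ (fun (p : {set 'I_n} * 'I_n) (k : 'I_n) => A x p.1)) /=.
  rewrite -(pair_bigA _ (fun (V : {set 'I_n}) (j : 'I_n) => \sum_(k < n) A x V)) /=.
  rewrite /mgf mulr_sumr; apply: ler_sum => V _.
  by rewrite !sumr_const !card_ord -[X in X <= _]mulr_natl -[A x V *+ n]mulr_natl mulrA.
have h4 : \sum_(p | c p) 2 * B * (zeta x * (A x p.1.1 + A x (phi p).1.1)) =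
    2 * (2 * B * zeta x * \sum_(p | c p) A x p.1.1).
  rewrite -!mulr_sumr big_split /= -(sum_phi (fun p => A x p.1.1)); ring.
rewrite h4 in h.
have h5 : 2 * B * zeta x * (\sum_(p | c p) A x p.1.1) <= 2 * B * zeta x * (N * N * mgf x).
  by apply: ler_wpM2l => //; rewrite !mulr_ge0.
have : `|D x + D x| = 2 * `|D x|.
  by rewrite (_ : D x + D x = 2 * D x); [rewrite normrM ger0_norm | ring].
lra.
Qed.

(** At most one element is not free, so at most 2 N exchanges are discarded, each worth at most 2
    B. *)
Let restrict x : `|\sum_V (N * stat V - sz%:R * \sum_j u j) * A x V - D x| <= 4 * B * N * mgf x.
Proof.
have -> : \sum_V (N * stat V - sz%:R * \sum_j u j) * A x V =
    \sum_(V : {set 'I_n}) \sum_j \sum_k (j \in V)%:R * (k \notin V)%:R * (u j - u k) * A x V.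
  apply: eq_bigr => V _; have [cV|cV] := eqVneq #|V| sz; last first.
    rewrite /A nu_sz // mul0r mulr0 big1 // => j _; rewrite big1 // => k _; by rewrite mulr0.
  rewrite -stat_pairs // mulr_suml; apply: eq_bigr => j _; by rewrite mulr_suml.
have -> : D x = \sum_(V : {set 'I_n}) \sum_j \sum_k (c (V, j, k))%:R * (u j - u k) * A x V.
  rewrite /D big_mkcond.
  rewrite (pair_bigA _ (fun (V : {set 'I_n}) (j : 'I_n) => \sum_k (c (V, j, k))%:R * (u j - u k) * A x V)) /=.
  rewrite (pair_bigA _ (fun (p : {set 'I_n} * 'I_n) (k : 'I_n) => (c (p.1, p.2, k))%:R * (u p.2 - u k) * A x p.1)) /=.
  by apply: eq_bigr => -[[V j] k] _ /=; case: (c _); rewrite ?mul1r ?mul0r.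
rewrite -sumrB /mgf mulr_sumr; apply: le_trans (ler_norm_sum _ _ _) _; apply: ler_sum => V _.
have nf : \sum_(j < n) (~~ f j)%:R <= 1 :> R.
  rewrite (_ : \sum_(j < n) _ = #|[set j | ~~ f j]|%:R); first by rewrite (ler_nat _ _ 1).
  by rewrite -sum1dep_card natr_sum [RHS]big_mkcond; apply: eq_bigr => j _; case: (f j).
rewrite -sumrB.
apply: le_trans (_ : \sum_j \sum_k ((~~ f j)%:R + (~~ f k)%:R) * (2 * B * A x V) <= _); last first.
  have -> : \sum_j \sum_k ((~~ f j)%:R + (~~ f k)%:R) * (2 * B * A x V) =
     2 * (N * \sum_j (~~ f j)%:R) * (2 * B * A x V).
    transitivity (\sum_j (N * (~~ f j)%:R + \sum_k (~~ f k)%:R) * (2 * B * A x V)).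
      apply: eq_bigr => j _; rewrite -mulr_suml big_split /= sumr_const card_ord.
      by rewrite -[_ *+ n]mulr_natl.
    rewrite -mulr_suml big_split /= -mulr_sumr sumr_const card_ord -[_ *+ n]mulr_natl; ring.
  have BA : 0 <= 2 * B * A x V by rewrite !mulr_ge0.
  have h : 2 * (N * \sum_j (~~ f j)%:R) <= 2 * (N * 1).
    by apply: ler_wpM2l => //; apply: ler_wpM2l => //; exact: ltW.
  by have := ler_wpM2r BA h; rewrite /A; lra.
apply: le_trans (ler_norm_sum _ _ _) _; apply: ler_sum => j _.
rewrite -sumrB; apply: le_trans (ler_norm_sum _ _ _) _; apply: ler_sum => k _.
rewrite -mulrBl -mulrBl normrM normrM (ger0_norm (A0 x V)) mulrA.
apply: ler_wpM2r; first exact: A0.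
apply: ler_pM => //; last exact: u_diff.
rewrite /c /=; case: (j \in V); case: (k \notin V); case: (f j); case: (f k) => /=;
  rewrite ?mulr0 ?mulr1 ?mul0r ?subrr ?subr0 ?normr0 ?normr1 //; lra.
Qed.

(** The first term comes from the inexact exchange, the second from the exchanges that involve a
    prescribed cell, both after division by N. *)
Definition drift (x : R) : R := 2 * B * N * (eta + 2 * B * x) + 4 * B.

Lemma mgf_ge0 x : 0 <= mgf x. Proof. by apply: sumr_ge0 => V _; exact: A0. Qed.

(* Pairing V with k |: (V :\ j) shows that the logarithmic derivative of mgf is at most
   mean + drift. *)
Lemma mgf_le (x : R) : 0 <= x -> mgf x <= mgf 0 * expR (x * (mean + drift x)).
Proof.
move=> x0.
have hF (y : R) : is_derive y 1 mgf (\sum_V stat V * A y V).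
  by apply: is_derive_bigsum => V; exact: is_derive_expM.
have := gronwall_le x0 hF (Q := fun y => y * (mean + drift x)) (dQ := fun=> mean + drift x) _ _.
rewrite mul0r subr0; apply.
  by move=> y; exact: is_derive_mulr.
move=> y /andP[y0 yx].
have h1 := restrict y; have h2 := D_le (ltW y0).
have e : \sum_V (N * stat V - sz%:R * \sum_j u j) * A y V =
   N * (\sum_V stat V * A y V) - N * mean * mgf y.
  have -> : N * mean = sz%:R * \sum_j u j by rewrite /mean; field; rewrite gt_eqF.
  by rewrite /mgf !mulr_sumr -sumrB; apply: eq_bigr => V _; rewrite /A; ring.
rewrite e in h1.
have S0 := mgf_ge0 y.
have h3 : N * (\sum_V stat V * A y V) - N * mean * mgf y <= 4 * B * N * mgf y + 2 * B * zeta y * (N * N * mgf y).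
  by move: h1 h2; rewrite !ler_norml => /andP[_ ?] /andP[_ ?]; lra.
rewrite -(ler_pM2l N0).
have zz : zeta y <= zeta x.
  by rewrite /zeta lerD2l; apply: ler_wpM2l; [rewrite mulr_ge0|exact: ltW].
have h4 : 2 * B * zeta y * (N * N * mgf y) <= 2 * B * zeta x * (N * N * mgf y).
  apply: ler_wpM2r; first by rewrite !mulr_ge0 // ltW.
  by apply: ler_wpM2l => //; rewrite mulr_ge0.
have -> : N * ((mean + drift x) * mgf y) = N * mean * mgf y +
    4 * B * N * mgf y + 2 * B * zeta x * (N * N * mgf y) by rewrite /drift /zeta; ring.
lra.
Qed.

Lemma upper_tail (x tau : R) : 0 <= x ->
  \sum_(V | mean + tau <= stat V) nu V <= (\sum_V nu V) * expR (x * (drift x - tau)).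
Proof.
move=> x0.
have h := mgf_le x0.
have e0 : mgf 0 = \sum_V nu V by apply: eq_bigr => V _; rewrite mul0r expR0 mulr1.
rewrite e0 in h.
have h1 : (\sum_(V | mean + tau <= stat V) nu V) * expR (x * (mean + tau)) <= mgf x.
  rewrite /mgf [X in _ <= X](bigID (fun V => mean + tau <= stat V)) /= mulr_suml.
  rewrite -[X in X <= _]addr0; apply: lerD; last by apply: sumr_ge0 => V _; exact: A0.
  apply: ler_sum => V hV; apply: ler_wpM2l => //.
  by rewrite ler_expR; apply: ler_wpM2l.
have E0 : 0 < expR (x * (mean + tau)) by exact: expR_gt0.
rewrite -(ler_pM2r E0); apply: le_trans h1 (le_trans h _).
by rewrite -mulrA -expRD; apply: le_of_eq; congr (_ * expR _); ring.
Qed.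

End ExchangeableSubset.

Section RowTail.
Variables (R : realType) (n : nat) (s t : 'I_n -> nat) (sig Del de : R).
Local Notation N := (n%:R : R).
Hypothesis nr : near_regular s t sig Del de.
Variable m : nat.
Hypotheses (m4 : (4 <= m)%N) (m2 : (2 * m)%:R <= de * N) (e1 : eta Del m <= 1).

Let Del0 : 0 <= Del. Proof. by case: nr => _ _ [_ _ _ _ [_ _ ?]]. Qed.

Let e0 : 0 <= eta Del m.
Proof.
have m3 : 0 < m%:R - 3 :> R by rewrite subr_gt0 (ltr_nat _ 3).
apply: addr_ge0; first by rewrite invr_ge0 exprn_ge0.
by rewrite divr_ge0 ?(ltW m3) //; move: Del0; lra.
Qed.

Lemma fiber_partition (Phi : 'I_n -> 'I_n -> bool) (M0 : 'M[bool]_n) i (P : pred {set 'I_n}) :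
  \sum_(V | P V) #|fiber s t Phi M0 i V|%:R = #|[set M in fam Phi M0 s t | P (rsup M i)]|%:R :> R.
Proof.
rewrite -sum1_card natr_sum (partition_big (fun M => rsup M i) P) /= => [|M]; last by rewrite inE => /andP[].
apply: eq_bigr => V PV; rewrite -sum1_card natr_sum; apply: eq_bigl => M.
by rewrite !inE; case: eqVneq => [->|]; rewrite ?andbF // PV !andbT.
Qed.

(** The weight of a set V is the number of matrices whose row i is V; [swap_ratio] provides the
    approximate exchangeability. *)
Lemma row_upper_tail (Phi : 'I_n -> 'I_n -> bool) (M0 : 'M[bool]_n) i (u : 'I_n -> R) (B x tau : R) :
  (forall j, #|[set a | Phi a j]| <= 2)%N -> (#|[set j | Phi i j]| <= 1)%N ->
  (forall j, `|u j| <= B) -> 0 <= x ->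
  #|[set M in fam Phi M0 s t | mean (s i) u + tau <= stat u (rsup M i)]|%:R <=
  #|fam Phi M0 s t|%:R * expR (x * (drift n B (eta Del m) x - tau)).
Proof.
move=> P2 P1 uB x0.
have n0 : (0 < n)%N by apply: leq_ltn_trans (ltn_ord i).
have h := @upper_tail R n (s i) (fun V => #|fiber s t Phi M0 i V|%:R) [pred j | ~~ Phi i j] u B (eta Del m).
have {h} := h _ _ _ _ uB n0 e0 e1 x tau x0.
rewrite (fiber_partition Phi M0 i (fun V => mean (s i) u + tau <= stat u V)).
rewrite (fiber_partition Phi M0 i xpredT) (_ : [set M in fam Phi M0 s t | true] = fam Phi M0 s t); last first.
  by apply/setP => M; rewrite [LHS]inE andbT.
apply=> //.
- move=> V; apply: contraNeq; rewrite pnatr_eq0 cards_eq0 => /set0Pn[M].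
  by rewrite inE => /andP[/famP[/zoP[<- _] _] /eqP ->].
- by move=> V j k jV kV pj pk; apply: (swap_ratio nr).
- apply: leq_trans P1; apply: subset_leq_card; apply/fintype.subsetP => j.
  by rewrite !inE negbK.
Qed.

Lemma row_tail (Phi : 'I_n -> 'I_n -> bool) (M0 : 'M[bool]_n) i (u : 'I_n -> R) (B x tau : R) :
  (forall j, #|[set a | Phi a j]| <= 2)%N -> (#|[set j | Phi i j]| <= 1)%N ->
  (forall j, `|u j| <= B) -> 0 <= x ->
  #|[set M in fam Phi M0 s t | tau <= `|stat u (rsup M i) - mean (s i) u|]|%:R <=
  #|fam Phi M0 s t|%:R * (2 * expR (x * (drift n B (eta Del m) x - tau))).
Proof.
move=> P2 P1 uB x0.
have h1 := row_upper_tail M0 tau P2 P1 uB x0.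
have uB' j : `|(fun j => - u j) j| <= B by rewrite normrN.
have h2 := row_upper_tail M0 tau P2 P1 uB' x0.
have eS V : stat (fun j => - u j) V = - stat u V by rewrite /stat sumrN.
have eM : mean (s i) (fun j => - u j) = - mean (s i) u by rewrite /mean sumrN mulrN.
apply: le_trans (_ : #|[set M in fam Phi M0 s t | mean (s i) u + tau <= stat u (rsup M i)] :|:
  [set M in fam Phi M0 s t | mean (s i) (fun j => - u j) + tau <= stat (fun j => - u j) (rsup M i)]|%:R <= _).
  rewrite ler_nat; apply: subset_leq_card; apply/fintype.subsetP => M; rewrite !inE eS eM.
  move=> /andP[-> h] /=; move: h; rewrite ler_normr; case/orP => h; apply/orP; [left|right]; lra.
apply: le_trans (_ : (_ + _)%:R <= _); first by rewrite ler_nat; exact: leq_card_setU.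
by rewrite natrD; lra.
Qed.

End RowTail.

(** * Typical matrices and the union bound *)

Section GoodEvents.
Variables (R : realType) (n : nat).
Local Notation N := (n%:R : R).

(* tau1 controls the weighted row sums that survive the rank-one rescaling, tau2 the row overlaps. *)
Definition half_good (s t : 'I_n -> nat) (sig tau1 tau2 : R) (M : 'M[bool]_n) : bool :=
  [forall i, `|stat (fun j => sig / (t j)%:R - 1) (rsup M i)
     - mean (s i) (fun j => sig / (t j)%:R - 1)| < tau1] &&
  [forall i, forall i', (i != i') ==>
     (`|#|rsup M i :&: rsup M i'|%:R - (s i)%:R * (s i')%:R / N| < tau2)].

Definition good s t sig tau1 tau2 M :=
  half_good s t sig tau1 tau2 M && half_good t s sig tau1 tau2 M^T.

Definition partial_perm (H : 'I_n -> 'I_n -> bool) :=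
  (forall j, #|[set i | H i j]| <= 1)%N /\ (forall i, #|[set j | H i j]| <= 1)%N.

Section Half.
Variables (s t : 'I_n -> nat) (sig Del de : R).
Hypothesis nr : near_regular s t sig Del de.
Variable m : nat.
Hypotheses (m4 : (4 <= m)%N) (m2 : (2 * m)%:R <= de * N) (e1 : eta Del m <= 1).
Variables (x1 B1 tau1 x2 tau2 p : R).
Hypotheses (x10 : 0 <= x1) (x20 : 0 <= x2).
Hypothesis uB : forall j, `|sig / (t j)%:R - 1| <= B1.
Hypothesis p1 : 2 * expR (x1 * (drift n B1 (eta Del m) x1 - tau1)) <= p.
Hypothesis p2 : 2 * expR (x2 * (drift n 1 (eta Del m) x2 - tau2)) <= p.

(** The overlap of rows i and i' is a linear statistic of row i once row i' is fixed, so the tail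
    bound is applied in each fiber of row i' and summed. N + N^2 counts the events of the union
    bound. *)
Lemma half_good_count (H : 'I_n -> 'I_n -> bool) (M0 : 'M[bool]_n) : partial_perm H ->
  #|[set M in fam H M0 s t | ~~ half_good s t sig tau1 tau2 M]|%:R <=
  (N + N ^+ 2) * p * #|fam H M0 s t|%:R.
Proof.
move=> [Hc Hr].
pose F := fam H M0 s t.
pose u j := sig / (t j)%:R - 1.
pose bad1 i := [set M in F | tau1 <= `|stat u (rsup M i) - mean (s i) u|].
pose bad2 i i' := [set M in F | (i != i') &&
   (tau2 <= `|#|rsup M i :&: rsup M i'|%:R - (s i)%:R * (s i')%:R / N|)].
have b1 i : #|bad1 i|%:R <= p * #|F|%:R :> R.
  apply: le_trans (row_tail nr m4 m2 e1 M0 tau1 _ (Hr i) uB x10) _.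
    by move=> j; apply: leq_trans (Hc j) _.
  by rewrite mulrC; apply: ler_wpM2r.
have b2 i i' : #|bad2 i i'|%:R <= p * #|F|%:R :> R.
  have [<-|ii] := eqVneq i i'.
    rewrite (_ : bad2 i i = finset.set0) ?cards0; last by apply/setP => M; rewrite !inE eqxx !andbF.
    by rewrite mulr_ge0 //; apply: le_trans p1; rewrite mulr_ge0 // expR_ge0.
  have -> : #|F|%:R = \sum_V #|fiber s t H M0 i' V|%:R :> R.
    rewrite (fiber_partition R s t H M0 i' xpredT); congr _%:R.
    by apply: eq_card => M; rewrite [RHS]inE andbT.
  have -> : #|bad2 i i'|%:R = \sum_V #|[set M in fiber s t H M0 i' V |
       tau2 <= `|#|rsup M i :&: V|%:R - (s i)%:R * (s i')%:R / N|]|%:R :> R.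
    rewrite -sum1_card natr_sum (partition_big (fun M => rsup M i') xpredT) //=.
    apply: eq_bigr => V _; rewrite -sum1_card natr_sum; apply: eq_bigl => M.
    rewrite !inE ii /=; case: (eqVneq (rsup M i') V) => [<-|]; rewrite ?andbF ?andbT //.
  rewrite mulr_sumr; apply: ler_sum => V _.
  have [->|[M1 M1V]] := set_0Vmem (fiber s t H M0 i' V).
    rewrite cards0 mulr0 (_ : [set M in _ | _] = finset.set0) ?cards0 //.
    by apply/setP => M; rewrite !inE.
  have sV : #|V| = s i'.
    by move: M1V; rewrite inE => /andP[/famP[/zoP[h _] _] /eqP <-].
  rewrite (fiber_fam M1V).
  pose w j : R := (j \in V)%:R.
  have eS (M : 'M[bool]_n) : stat w (rsup M i) = #|rsup M i :&: V|%:R.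
    rewrite /stat /w -sum1_card natr_sum big_mkcond [RHS]big_mkcond; apply: eq_bigr => j _.
    by rewrite [j \in _ :&: _]inE; case: (j \in rsup M i); case: (j \in V).
  have eM : mean (s i) w = (s i)%:R * (s i')%:R / N.
    rewrite /mean /w -sV -[X in _ * X = _](_ : #|V|%:R = _); first by rewrite mulrAC.
    by rewrite -sum1_card natr_sum big_mkcond; apply: eq_bigr => j _; case: (j \in V).
  have wB j : `|w j| <= 1 by rewrite /w; case: (j \in V); rewrite ?normr1 ?normr0.
  have := row_tail nr m4 m2 e1 M1 tau2 (Phi := fun a b => H a b || (a == i')) (i := i) _ _ wB x20.
  rewrite eM => /(_ _ _) h.
  apply: le_trans (_ : #|fam (fun a b => H a b || (a == i')) M1 s t|%:R * p <= _); last by rewrite mulrC.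
  apply: le_trans (_ : _ <= #|fam (fun a b => H a b || (a == i')) M1 s t|%:R *
    (2 * expR (x2 * (drift n 1 (eta Del m) x2 - tau2)))) _; last by apply: ler_wpM2l.
  rewrite (_ : [set M in _ | _] = [set M in fam (fun a b => H a b || (a == i')) M1 s t |
     tau2 <= `|stat w (rsup M i) - (s i)%:R * (s i')%:R / N|]); last first.
    by apply/setP => M; rewrite !inE eS.
  apply: h => [j|].
    apply: leq_trans (_ : #|[set a | H a j] :|: [set i']| <= _)%N.
      by apply: subset_leq_card; apply/fintype.subsetP => a; rewrite !inE.
    by apply: leq_trans (leq_card_setU _ _) _; rewrite cards1 addn1 ltnS.
  apply: leq_trans (Hr i); apply: subset_leq_card; apply/fintype.subsetP => j.
  by rewrite !inE (negbTE ii) orbF.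
have cover : [set M in F | ~~ half_good s t sig tau1 tau2 M] \subset
    (\bigcup_i bad1 i) :|: (\bigcup_i \bigcup_i' bad2 i i').
  apply/fintype.subsetP => M; rewrite inE => /andP[MF]; rewrite /half_good negb_and => /orP[].
    rewrite negb_forall => /existsP[i h]; apply/finset.setUP; left; apply/finset.bigcupP; exists i => //.
    by rewrite inE MF /= leNgt.
  rewrite negb_forall => /existsP[i]; rewrite negb_forall => /existsP[i'].
  rewrite negb_imply => /andP[ii h]; apply/finset.setUP; right.
  by apply/finset.bigcupP; exists i => //; apply/finset.bigcupP; exists i' => //; rewrite inE MF ii /= leNgt.
have cardU (I : finType) (G : I -> {set 'M[bool]_n}) :
    #|\bigcup_i G i|%:R <= \sum_i #|G i|%:R :> R.
  rewrite -natr_sum ler_nat; elim/big_ind2: _ => [|A a C c hA hC|i _]; rewrite ?cards0 //.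
  by apply: leq_trans (leq_card_setU _ _) _; exact: leq_add.
apply: le_trans (_ : #|(\bigcup_i bad1 i) :|: (\bigcup_i \bigcup_i' bad2 i i')|%:R <= _).
  by rewrite ler_nat subset_leq_card.
apply: le_trans (_ : #|\bigcup_i bad1 i|%:R + #|\bigcup_i \bigcup_i' bad2 i i'|%:R <= _).
  by rewrite -natrD ler_nat leq_card_setU.
have c1 : #|\bigcup_i bad1 i|%:R <= N * (p * #|F|%:R).
  by apply: le_trans (cardU _ _) _; exact: sum_le_const.
have c2 : #|\bigcup_i \bigcup_i' bad2 i i'|%:R <= N * (N * (p * #|F|%:R)).
  apply: le_trans (cardU _ _) _; apply: sum_le_const => i.
  by apply: le_trans (cardU _ _) _; exact: sum_le_const.
apply: le_trans (lerD c1 c2) _.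
by apply: le_of_eq; rewrite /F; ring.
Qed.

End Half.

Lemma near_regular_sym (s t : 'I_n -> nat) (sig Del de : R) :
  near_regular s t sig Del de -> near_regular t s sig Del de.
Proof. by case=> ? ? ?; split. Qed.

Lemma zo_tr (s t : 'I_n -> nat) (M : 'M[bool]_n) : (M^T \in zo_mats t s) = (M \in zo_mats s t).
Proof.
have r (A : 'M[bool]_n) j : rsup A^T j = csup A j by apply/setP => i; rewrite !inE mxE.
have c (A : 'M[bool]_n) i : csup A^T i = rsup A i by apply/setP => j; rewrite !inE mxE.
by apply/zoP/zoP => -[h1 h2]; split=> i; [rewrite -c|rewrite -r|rewrite r|rewrite c].
Qed.

Lemma fam_tr (H : 'I_n -> 'I_n -> bool) (M0 : 'M[bool]_n) (s t : 'I_n -> nat) (M : 'M[bool]_n) :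
  (M^T \in fam (fun i j => H j i) M0^T t s) = (M \in fam H M0 s t).
Proof.
apply/famP/famP; rewrite zo_tr => -[h1 h2]; split=> // i j hij.
  by have := h2 j i hij; rewrite !mxE.
by rewrite !mxE; apply: h2.
Qed.

Lemma good_count (s t : 'I_n -> nat) (sig Del de : R) (m : nat) (x1 B1 tau1 x2 tau2 p : R)
   (H : 'I_n -> 'I_n -> bool) (M0 : 'M[bool]_n) :
  near_regular s t sig Del de -> (4 <= m)%N -> (2 * m)%:R <= de * N -> eta Del m <= 1 ->
  0 <= x1 -> 0 <= x2 ->
  (forall j, `|sig / (t j)%:R - 1| <= B1) -> (forall i, `|sig / (s i)%:R - 1| <= B1) ->
  2 * expR (x1 * (drift n B1 (eta Del m) x1 - tau1)) <= p ->
  2 * expR (x2 * (drift n 1 (eta Del m) x2 - tau2)) <= p ->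
  partial_perm H ->
  #|[set M in fam H M0 s t | ~~ good s t sig tau1 tau2 M]|%:R <=
  2 * (N + N ^+ 2) * p * #|fam H M0 s t|%:R.
Proof.
move=> nr m4 m2 e1 x10 x20 uB vB p1 p2 HP.
have h1 := half_good_count nr m4 m2 e1 x10 x20 uB p1 p2 M0 HP.
have HP' : partial_perm (fun i j => H j i) by case: HP.
have h2 := half_good_count (near_regular_sym nr) m4 m2 e1 x10 x20 vB p1 p2 M0^T HP'.
have trI : injective (@trmx bool n n) by apply: can_inj; exact: trmxK.
have e2 : #|[set M in fam (fun i j => H j i) M0^T t s | ~~ half_good t s sig tau1 tau2 M]| =
    #|[set M in fam H M0 s t | ~~ half_good t s sig tau1 tau2 M^T]|.
  rewrite -(card_imset _ trI); apply: eq_card => M; apply/imsetP/idP => [[A]|].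
    rewrite inE => /andP[hA hg] ->; rewrite inE trmxK hg andbT -(fam_tr H M0 s t) trmxK; exact: hA.
  rewrite inE => hM; exists M^T; last by rewrite trmxK.
  by rewrite inE fam_tr.
have e3 : #|fam (fun i j => H j i) M0^T t s| = #|fam H M0 s t|.
  rewrite -(card_imset _ trI); apply: eq_card => M; apply/imsetP/idP => [[A]|hM].
    by move=> hA ->; rewrite -(fam_tr H M0 s t) trmxK.
  by exists M^T; rewrite ?trmxK // fam_tr.
rewrite e2 e3 in h2.
apply: le_trans (_ : (#|[set M in fam H M0 s t | ~~ half_good s t sig tau1 tau2 M]| +
   #|[set M in fam H M0 s t | ~~ half_good t s sig tau1 tau2 M^T]|)%:R <= _); last by rewrite natrD; lra.
rewrite ler_nat; apply: leq_trans (leq_card_setU _ _); apply: subset_leq_card; apply/fintype.subsetP => M.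
by rewrite !inE /good negb_and => /andP[-> ->].
Qed.

End GoodEvents.

(** * Averaging *)

Section Logarithm.
Variable R : realType.

(** Gronwall's inequality for x -> 1 + x z against the exponent x z - x^2 z^2 / 2, with a linear
    slack of slope 2 |z|^3 on either side. *)
Lemma ln1D_third (z : R) : `|z| <= 1 / 2 -> `|ln (1 + z) - (z - z ^+ 2 / 2)| <= 2 * `|z| ^+ 3.
Proof.
move=> hz; have /andP[z1 z2] : - (1 / 2) <= z <= 1 / 2 by rewrite -ler_norml.
pose F : {poly R} := 1 + z *: 'X.
pose Q (c : R) : {poly R} := (z + c) *: 'X - (z ^+ 2 / 2) *: 'X^2.
have hF (x : R) : is_derive x 1 (horner F) (F^`()).[x] by exact: is_derive_poly.
have hQ c (x : R) : is_derive x 1 (horner (Q c)) ((Q c)^`()).[x] by exact: is_derive_poly.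
have eF x : F.[x] = 1 + x * z by rewrite /F !hornerE mulrC.
have dF x : (F^`()).[x] = z by rewrite /F derivD derivZ derivX -polyC1 derivC !hornerE.
have dQ c x : ((Q c)^`()).[x] = z + c - x * z ^+ 2.
  by rewrite /Q derivB !derivZ derivX derivXn !hornerE /=; field.
have eQ c : (Q c).[1] - (Q c).[0] = z + c - z ^+ 2 / 2 by rewrite /Q !hornerE /=; ring.
set c := 2 * `|z| ^+ 3.
have key (x : R) : 0 < x < 1 -> `|z - (z - x * z ^+ 2) * (1 + x * z)| <= c * (1 + x * z).
  move=> /andP[x0 x1].
  have -> : z - (z - x * z ^+ 2) * (1 + x * z) = x ^+ 2 * z ^+ 3 by ring.
  have xz : - (1 / 2) <= x * z.
    apply: le_trans (_ : - `|x * z| <= _); last by rewrite lerNl -normrN ler_norm.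
    rewrite lerN2 normrM (gtr0_norm x0); apply: le_trans hz.
    by rewrite ler_piMl // ltW.
  apply: le_trans (_ : `|z| ^+ 3 <= _).
    rewrite normrM !normrX (gtr0_norm x0).
    by rewrite ler_piMl ?exprn_ge0 // exprn_ile1 // ltW.
  rewrite /c; have : 0 <= `|z| ^+ 3 by exact: exprn_ge0.
  by move: (`|z| ^+ 3) => w w0; nra.
have p0 : 0 < 1 + z by lra.
rewrite ler_norml; apply/andP; split.
  have := gronwall_ge ler01 hF (hQ (- c)).
  rewrite eQ !eF mul0r addr0 !mul1r => h.
  have {}h : expR (z + - c - z ^+ 2 / 2) <= 1 + z.
    apply: h => x /[dup] x01 /key; rewrite dQ dF eF ler_norml => /andP[? _]; lra.
  by move: h; rewrite -[X in _ <= X]lnK ?posrE // ler_expR; lra.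
have := gronwall_le ler01 hF (hQ c).
rewrite eQ !eF mul0r addr0 !mul1r => h.
have {}h : 1 + z <= expR (z + c - z ^+ 2 / 2).
  apply: h => x /[dup] x01 /key; rewrite dQ dF eF ler_norml => /andP[_ ?]; lra.
by move: h; rewrite -[X in X <= _]lnK ?posrE // ler_expR; lra.
Qed.

(** As the mean of x is sig, the linear terms of the logarithms cancel; the quadratic ones are the
    variance term of the exponent. *)
Lemma prod_ratio (n : nat) (x : 'I_n -> R) (sig B : R) : 0 < sig -> B <= 1 / 2 ->
  \sum_i x i = n%:R * sig -> (forall i, `|x i / sig - 1| <= B) ->
  exists2 d, `|d| <= 2 * n%:R * B ^+ 3 &
    \prod_i (x i / sig) = expR (- (\sum_i (x i - sig) ^+ 2) / (2 * sig ^+ 2) + d).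
Proof.
move=> s0 B2 sx hB.
pose z i := x i / sig - 1.
have z2 i : `|z i| <= 1 / 2 by apply: le_trans (hB i) B2.
pose d := \sum_i (ln (1 + z i) - (z i - z i ^+ 2 / 2)).
exists d.
  rewrite [2 * _]mulrC -mulrA; apply: norm_sum_le_const => i; apply: le_trans (ln1D_third (z2 i)) _.
  by rewrite ler_pM2l // lerXn2r ?nnegrE //; apply: le_trans (hB i).
have -> : - (\sum_i (x i - sig) ^+ 2) / (2 * sig ^+ 2) + d = \sum_i ln (x i / sig).
  have e i : ln (x i / sig) = ln (1 + z i) by rewrite /z; congr ln; ring.
  rewrite (eq_bigr _ (fun i _ => e i)).
  have sz : \sum_i z i = 0.
    by rewrite /z sumrB -mulr_suml sx sumr_const card_ord; field; rewrite gt_eqF.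
  rewrite /d sumrB sumrB sz -mulr_suml.
  have -> : \sum_i (x i - sig) ^+ 2 = sig ^+ 2 * \sum_i z i ^+ 2.
    by rewrite mulr_sumr; apply: eq_bigr => i _; rewrite /z; field; rewrite gt_eqF.
  by field; rewrite gt_eqF.
rewrite expR_sum; apply: eq_bigr => i _; rewrite lnK // posrE.
by have := z2 i; rewrite /z ler_norml => /andP[? ?]; lra.
Qed.

End Logarithm.

Section Averaging.
Variables (R : realType) (n : nat) (s t : 'I_n -> nat).
Variables (gd : pred 'M[bool]_n) (pi lo hi : R).
Hypothesis zo0 : exists M, M \in zo_mats s t.
Hypotheses (lo0 : 0 <= lo) (lohi : lo <= hi).
Hypothesis rare : forall H M0, partial_perm H ->
  #|[set M in fam H M0 s t | ~~ gd M]|%:R <= pi * #|fam H M0 s t|%:R.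
Hypothesis bounds : forall M, M \in zo_mats s t -> gd M -> lo <= (perm01 M)%:R <= hi.

Let none (i j : 'I_n) := false.
Let graph (sg : 'S_n) (i j : 'I_n) := j == sg i.
Let ones : 'M[bool]_n := const_mx true.

Let famT : fam none ones s t = zo_mats s t.
Proof. by apply/setP => M; apply/famP/idP => [[]|]. Qed.

Let none_pp : partial_perm none.
Proof.
by split=> i; rewrite (_ : [set _ | _] = finset.set0) ?cards0 //; apply/setP => j; rewrite !inE.
Qed.

Let graph_pp sg : partial_perm (graph sg).
Proof.
split=> i.
  rewrite (_ : [set _ | _] = [set (sg^-1)%g i]) ?cards1 //; apply/setP => j.
  by rewrite !inE /graph eq_sym (canF_eq (permK sg)).
by rewrite (_ : [set _ | _] = [set sg i]) ?cards1 //; apply/setP => j; rewrite !inE.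
Qed.

Let permE (P : pred 'M[bool]_n) :
  \sum_(M in zo_mats s t | P M) (perm01 M)%:R = \sum_(sg : 'S_n) #|[set M in fam (graph sg) ones s t | P M]|%:R :> R.
Proof.
rewrite /perm01; under eq_bigr => M _ do rewrite natr_sum.
rewrite exchange_big /=; apply: eq_bigr => sg _.
rewrite -sum1_card natr_sum big_mkcond [RHS]big_mkcond; apply: eq_bigr => M _.
have e : (\prod_(i < n) M i (sg i))%N = [forall i, M i (sg i)] :> nat.
  have [/forallP h|] := boolP [forall i, M i (sg i)]; first by rewrite big1 // => i _; rewrite h.
  by rewrite negb_forall => /existsP[i h]; rewrite (bigD1 i) //= (negbTE h).
have f : (M \in fam (graph sg) ones s t) = (M \in zo_mats s t) && [forall i, M i (sg i)].
  apply/famP/andP => -[h1 h2]; split=> //.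
    by apply/forallP => i; rewrite (h2 i (sg i)) ?mxE /graph.
  by move=> i j /eqP ->; rewrite mxE; exact: (forallP h2).
rewrite [in RHS]inE f e; case: (M \in zo_mats s t); case: (P M); case: [forall i, M i (sg i)] => //.
Qed.

(* rare is used without constraint and with the graph of each permutation, because the sum
   of perm01 over a set of matrices counts the pairs of a permutation and a matrix of the set
   that contains its graph. *)
Lemma average_between : lo * (1 - pi) <= expected_perm R s t /\ expected_perm R s t * (1 - pi) <= hi.
Proof.
pose Z := zo_mats s t; pose T : R := \sum_(M in Z) (perm01 M)%:R.
have [M1 M1Z] := zo0.
have N0 : 0 < #|Z|%:R :> R by rewrite ltr0n; apply/card_gt0P; exists M1.
have Nsplit : #|Z|%:R = #|[set M in Z | gd M]|%:R + #|[set M in Z | ~~ gd M]|%:R :> R.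
  by rewrite -natrD -(cardsID [set M | gd M] Z); congr (_ + _)%:R; apply: eq_card => M; rewrite !inE // andbC.
have Nbad : #|[set M in Z | ~~ gd M]|%:R <= pi * #|Z|%:R by have := rare ones none_pp; rewrite famT.
have Tsplit : T = \sum_(M in Z | gd M) (perm01 M)%:R + \sum_(M in Z | ~~ gd M) (perm01 M)%:R.
  exact: bigID.
have Tbad : \sum_(M in Z | ~~ gd M) (perm01 M)%:R <= pi * T.
  have -> : T = \sum_(M in zo_mats s t | true) (perm01 M)%:R by apply: eq_bigl => M; rewrite andbT.
  rewrite !permE mulr_sumr; apply: ler_sum => sg _.
  apply: le_trans (rare ones (graph_pp sg)) _.
  by rewrite (_ : [set M in _ | true] = fam (graph sg) ones s t) //; apply/setP => M; rewrite [LHS]inE andbT.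
have gE (c : R) : \sum_(M in Z | gd M) c = c * #|[set M in Z | gd M]|%:R.
  by rewrite mulr_natr -sumr_const; apply: eq_bigl => M; rewrite [in RHS]inE.
have lo1 : lo * #|[set M in Z | gd M]|%:R <= \sum_(M in Z | gd M) (perm01 M)%:R.
  by rewrite -gE; apply: ler_sum => M /andP[MZ gM]; have /andP[] := bounds MZ gM.
have hi1 : \sum_(M in Z | gd M) (perm01 M)%:R <= hi * #|[set M in Z | gd M]|%:R.
  by rewrite -gE; apply: ler_sum => M /andP[MZ gM]; have /andP[] := bounds MZ gM.
have bad0 : 0 <= \sum_(M in Z | ~~ gd M) (perm01 M)%:R :> R by exact: sumr_ge0.
have good0 : 0 <= #|[set M in Z | gd M]|%:R :> R by [].
have nbad0 : 0 <= #|[set M in Z | ~~ gd M]|%:R :> R by [].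
rewrite /expected_perm -/Z -/T; split.
  rewrite ler_pdivlMr // -mulrA; apply: le_trans (_ : lo * #|[set M in Z | gd M]|%:R <= _); last by lra.
  by apply: ler_wpM2l => //; lra.
rewrite mulrAC ler_pdivrMr //.
apply: le_trans (_ : hi * #|[set M in Z | gd M]|%:R <= _); first by lra.
by apply: ler_wpM2l; [exact: le_trans lohi|lra].
Qed.

End Averaging.

(** * Rescaled 0-1 matrices *)

Section Scaling.
Variables (R : realType) (n : nat).
Local Notation N := (n%:R : R).

Definition scaled (s t : 'I_n -> nat) (sig : R) (M : 'M[bool]_n) (i j : 'I_n) : R :=
  N / sig * (sig / (s i)%:R * (sig / (t j)%:R)) * (M i j)%:R - 1.

Lemma scaled_tr s t sig M i j : scaled t s sig M^T i j = scaled s t sig M j i.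
Proof. by rewrite /scaled mxE; ring. Qed.

Section Half.
Variables (s t : 'I_n -> nat) (sig L B tau1 tau2 : R) (M : 'M[bool]_n).
Hypotheses (n0 : 0 < N) (s0 : 0 < sig) (NL : N <= L * sig) (B4 : B <= 1 / 4) (B0 : 0 <= B).
Hypotheses (spos : forall i, (0 < s i)%N) (tpos : forall j, (0 < t j)%N).
Hypotheses (sB : forall i, `|sig / (s i)%:R - 1| <= B) (tB : forall j, `|sig / (t j)%:R - 1| <= B).
Hypotheses (tsum : \sum_j (t j)%:R = N * sig).
Hypotheses (Mz : M \in zo_mats s t) (Mg : half_good s t sig tau1 tau2 M).

Let al i : R := sig / (s i)%:R.
Let be j : R := sig / (t j)%:R.
Let u j := be j - 1.
Let st i := stat u (rsup M i).
Let U := scaled s t sig M.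

Let sp i : 0 < (s i)%:R :> R. Proof. by rewrite ltr0n. Qed.
Let tp j : 0 < (t j)%:R :> R. Proof. by rewrite ltr0n. Qed.
Let alB i : 1 - B <= al i <= 1 + B.
Proof. by have := sB i; rewrite -/(al i) ler_norml => /andP[? ?]; apply/andP; split; lra. Qed.
Let beB j : 1 - B <= be j <= 1 + B.
Proof. by have := tB j; rewrite -/(be j) ler_norml => /andP[? ?]; apply/andP; split; lra. Qed.
Let al54 i : 0 <= al i <= 5 / 4.
Proof. by have := alB i; move: B4 => ? /andP[? ?]; apply/andP; split; lra. Qed.
Let be54 j : 0 <= be j <= 5 / 4.
Proof. by have := beB j; move: B4 => ? /andP[? ?]; apply/andP; split; lra. Qed.
Let NsL : N / sig <= L. Proof. by rewrite ler_pdivrMr. Qed.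
Let Ns0 : 0 <= N / sig. Proof. by rewrite divr_ge0 // ltW. Qed.
Let L0 : 0 <= L. Proof. exact: le_trans NsL. Qed.

Let rowM i : \sum_j (M i j)%:R = (s i)%:R :> R.
Proof. by have /zoP[<- _] := Mz; rewrite /rsup -sum1dep_card natr_sum [RHS]big_mkcond; apply: eq_bigr => j _; case: (M i j). Qed.
Let colM j : \sum_i (M i j)%:R = (t j)%:R :> R.
Proof. by have /zoP[_ <-] := Mz; rewrite /csup -sum1dep_card natr_sum [RHS]big_mkcond; apply: eq_bigr => i _; case: (M i j). Qed.

Let stE i : st i = \sum_j u j * (M i j)%:R.
Proof.
rewrite /st /stat big_mkcond; apply: eq_bigr => j _.
by rewrite inE; case: (M i j); rewrite ?mulr1 ?mulr0.
Qed.

(** u j is 1 - t j / sig plus u j^2 / be j, and the first parts sum to zero; what remains is of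
    second order in B. *)
Let sum_u : 0 <= \sum_j u j <= 2 * N * B ^+ 2.
Proof.
have e : \sum_j u j = \sum_j u j ^+ 2 / be j.
  have z : \sum_j (u j - u j ^+ 2 / be j) = 0.
    rewrite (eq_bigr (fun j => 1 - (t j)%:R / sig)) => [|j _].
      by rewrite sumrB -mulr_suml tsum sumr_const card_ord; field; rewrite gt_eqF.
    by rewrite /u /be; field; rewrite !gt_eqF.
  by move: z; rewrite sumrB => /eqP; rewrite subr_eq0 => /eqP.
rewrite e; apply/andP; split.
  by apply: sumr_ge0 => j _; rewrite divr_ge0 ?sqr_ge0 //; case/andP: (be54 j).
rewrite [2 * _]mulrC -mulrA; apply: sum_le_const => j; have /andP[b1 b2] := beB j.
have b12 : 1 / 2 <= be j by move: B4; lra.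
have b0 : 0 < be j by lra.
rewrite ler_pdivrMr //.
have u2 : u j ^+ 2 <= B ^+ 2 by rewrite -[u j ^+ 2]real_normK ?num_real // lerXn2r ?nnegrE //; exact: tB.
have B20 : 0 <= B ^+ 2 by exact: sqr_ge0.
by move: u2 B20; move: (u j ^+ 2) (B ^+ 2) => a c ? ?; nra.
Qed.

Let row_le i : (s i)%:R <= N.
Proof.
by rewrite -rowM -[X in _ <= X]mulr1; apply: sum_le_const => j; case: (M i j).
Qed.

Let st_le i : `|st i| <= tau1 + 2 * N * B ^+ 2.
Proof.
have /andP[/forallP /(_ i) h _] := Mg.
have /andP[u0 u1] := sum_u.
have m0 : 0 <= mean (s i) u <= 2 * N * B ^+ 2.
  rewrite /mean mulr_ge0 ?divr_ge0 //=; apply: le_trans u1.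
  by rewrite ler_piMl // ler_pdivrMr // mul1r.
move: h m0; rewrite -/u -/(st i) ltr_norml ler_norml => /andP[? ?] /andP[? ?].
by apply/andP; split; lra.
Qed.

Let rowU i : \sum_j U i j = N / sig * al i * st i.
Proof.
rewrite /U /scaled sumrB sumr_const card_ord -/(al i).
have -> : \sum_j N / sig * (al i * (sig / (t j)%:R)) * (M i j)%:R =
    N / sig * al i * (\sum_j u j * (M i j)%:R + \sum_j (M i j)%:R).
  rewrite -big_split mulr_sumr; apply: eq_bigr => j _ /=.
  by rewrite /u /be; field; rewrite !gt_eqF.
by rewrite -stE rowM /al; field; rewrite !gt_eqF.
Qed.

Lemma scaled_row_sum i : `|\sum_j U i j| <= 5 / 4 * L * (tau1 + 2 * N * B ^+ 2).
Proof.
have /andP[a0 a1] := al54 i.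
rewrite rowU normrM (ger0_norm (mulr_ge0 Ns0 a0)).
apply: ler_pM => //; first exact: mulr_ge0.
by rewrite [5 / 4 * L]mulrC; apply: ler_pM.
Qed.

(** The [st i] sum to zero, because u j summed over the ones of column j becomes sig - t j. Only the
    deviation of [al i] from 1 contributes, which gains a factor B over the bound for single
    rows. *)
Lemma scaled_sum : `|\sum_i \sum_j U i j| <= N * (L * (B * (tau1 + 2 * N * B ^+ 2))).
Proof.
have st0 : \sum_i st i = 0.
  under eq_bigr => i _ do rewrite stE.
  rewrite exchange_big /=; under eq_bigr => j _ do rewrite -mulr_sumr colM.
  rewrite (eq_bigr (fun j => sig - (t j)%:R)) => [|j _].
    by rewrite sumrB tsum sumr_const card_ord -[_ *+ n]mulr_natl subrr.
  by rewrite /u /be; field; rewrite gt_eqF.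
have -> : \sum_i \sum_j U i j = \sum_i N / sig * ((al i - 1) * st i).
  under eq_bigr => i _ do rewrite rowU.
  rewrite (eq_bigr (fun i => N / sig * ((al i - 1) * st i) + N / sig * st i)) => [|i _]; last by ring.
  by rewrite big_split /= -[X in _ + X]mulr_sumr st0 mulr0 addr0.
apply: norm_sum_le_const => i; rewrite normrM (ger0_norm Ns0) normrM.
by apply: ler_pM => //; apply: ler_pM => //; exact: sB.
Qed.

Lemma scaled_bound (q : R) : 25 / 16 * L <= q -> forall i j, -1 <= U i j <= q - 1.
Proof.
move=> Lq i j; rewrite /U /scaled -/(al i) -/(be j).
have /andP[a0 a1] := al54 i; have /andP[b0 b1] := be54 j.
have ab0 : 0 <= al i * be j by exact: mulr_ge0.
have p0 : 0 <= N / sig * (al i * be j) by exact: mulr_ge0.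
have p1 : N / sig * (al i * be j) <= L * (25 / 16).
  apply: ler_pM => //; apply: le_trans (_ : 5 / 4 * (5 / 4) <= _); last by lra.
  by apply: ler_pM.
by case: (M i j); rewrite ?mulr1 ?mulr0; apply/andP; split; lra.
Qed.

(** Inner products of rows of U + 1 are weighted counts of common ones, controlled by tau2;
    replacing the squared column factors by 1 costs 3 B N. *)
Lemma scaled_codegree i i' : i != i' ->
  `|\sum_j U i j * U i' j| <= 25 / 16 * L ^+ 2 * (3 * B * N + tau2) + 5 / 2 * L * (tau1 + 2 * N * B ^+ 2).
Proof.
move=> ii.
pose W i j := U i j + 1.
have WE a j : W a j = N / sig * al a * be j * (M a j)%:R by rewrite /W /U /scaled subrK -/(al a) -/(be j); ring.
have e : \sum_j U i j * U i' j = (\sum_j W i j * W i' j - N) - \sum_j U i j - \sum_j U i' j.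
  have -> : N = \sum_(j < n) 1 by rewrite sumr_const card_ord.
  by rewrite -!sumrB; apply: eq_bigr => j _; rewrite /W; ring.
pose cd : R := #|rsup M i :&: rsup M i'|%:R.
have cdE : cd = \sum_j (M i j && M i' j)%:R.
  rewrite /cd -sum1_card natr_sum big_mkcond; apply: eq_bigr => j _.
  by rewrite !inE; case: (M i j); case: (M i' j).
pose g := N / sig * al i * (N / sig * al i').
have g0 : 0 <= g.
  have k a : 0 <= N / sig * al a by apply: mulr_ge0 => //; case/andP: (al54 a).
  exact: mulr_ge0.
have g1 : g <= 25 / 16 * L ^+ 2.
  have k a : 0 <= N / sig * al a <= L * (5 / 4).
    by have /andP[? ?] := al54 a; rewrite mulr_ge0 //=; apply: ler_pM.
  have /andP[? ?] := k i; have /andP[? ?] := k i'.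
  have -> : 25 / 16 * L ^+ 2 = L * (5 / 4) * (L * (5 / 4)) by field.
  exact: ler_pM.
have WW : \sum_j W i j * W i' j - N = g * ((\sum_j (be j ^+ 2 - 1) * (M i j && M i' j)%:R) +
    (cd - (s i)%:R * (s i')%:R / N)).
  have gN : g * ((s i)%:R * (s i')%:R / N) = N by rewrite /g /al; field; rewrite !gt_eqF.
  rewrite addrA mulrBr gN; congr (_ - N).
  rewrite cdE -big_split mulr_sumr; apply: eq_bigr => j _ /=.
  by rewrite !WE /g; case: (M i j); case: (M i' j); rewrite /= ?mulr1 ?mulr0 ?mul0r; ring.
have S1 : `|\sum_j (be j ^+ 2 - 1) * (M i j && M i' j)%:R| <= 3 * B * N.
  rewrite [3 * B * N]mulrC; apply: norm_sum_le_const => j; have /andP[b1 b2] := beB j; move: B0 B4 => B0' B4'.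
  case: (_ && _); rewrite ?mulr1 ?mulr0 ?normr0; last by lra.
  by rewrite ler_norml; apply/andP; split; nra.
have S2 : `|cd - (s i)%:R * (s i')%:R / N| <= tau2.
  by have /andP[_ /forallP /(_ i) /forallP /(_ i') /implyP /(_ ii) /ltW] := Mg.
rewrite e; apply: le_trans (ler_normB _ _) _.
have r1 := scaled_row_sum i; have r2 := scaled_row_sum i'.
apply: le_trans (lerD (ler_normB _ _) r2) _.
suff : `|\sum_j W i j * W i' j - N| <= 25 / 16 * L ^+ 2 * (3 * B * N + tau2) by lra.
rewrite WW normrM (ger0_norm g0); apply: ler_pM => //.
exact: le_trans (ler_normD _ _) (lerD S1 S2).
Qed.

Lemma scaled_half_flat (q T : R) : 25 / 16 * L <= q -> 5 / 4 * L * (tau1 + 2 * N * B ^+ 2) <= q ->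
  25 / 16 * L ^+ 2 * (3 * B * N + tau2) + 5 / 2 * L * (tau1 + 2 * N * B ^+ 2) <= T ->
  half_flat q T (tr U).
Proof.
move=> h1 h2 h3; split=> [i j|j|j k jk]; rewrite /tr.
- exact: scaled_bound.
- exact: le_trans (scaled_row_sum j) h2.
- exact: le_trans (scaled_codegree jk) h3.
Qed.

(** As the entries of M are 0 or 1, the squares of U + 1 sum to about (N / sig)^2 N sig = N^3 / sig.
    Subtracting N^2 and dividing by 2 N^2 yields the term (1 - lambda) / (2 lambda) of the
    exponent. *)
Lemma scaled_sum_sqr : `|(\sum_i \sum_j U i j ^+ 2) / (2 * N ^+ 2) - (N / sig - 1) / 2| <=
  3 * B * L + L * (B * (tau1 + 2 * N * B ^+ 2)) / N.
Proof.
pose S := \sum_i \sum_j U i j.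
have tot : \sum_i \sum_j (M i j)%:R = N * sig.
  by rewrite exchange_big /= -tsum; apply: eq_bigr => j _; rewrite colM.
pose E := \sum_i \sum_j ((al i * be j) ^+ 2 - 1) * (M i j)%:R.
have eS : \sum_i \sum_j U i j ^+ 2 = (N / sig) ^+ 2 * (E + N * sig) - N ^+ 2 - 2 * S.
  have -> : N ^+ 2 = \sum_(i < n) \sum_(j < n) 1.
    by under eq_bigr do rewrite sumr_const card_ord; rewrite sumr_const card_ord -[N *+ n]mulr_natl expr2.
  rewrite /E /S -tot -big_split mulr_sumr [2 * _]mulr_sumr -!sumrB; apply: eq_bigr => i _ /=.
  rewrite -big_split mulr_sumr [2 * _]mulr_sumr -!sumrB; apply: eq_bigr => j _ /=.
  by rewrite /U /scaled -/(al i) -/(be j); case: (M i j); rewrite /= ?mulr1 ?mulr0; ring.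
have EB : `|E| <= 6 * B * (N * sig).
  apply: le_trans (ler_norm_sum _ _ _) _; rewrite -tot mulr_sumr; apply: ler_sum => i _.
  apply: le_trans (ler_norm_sum _ _ _) _; rewrite mulr_sumr; apply: ler_sum => j _.
  rewrite normrM [`|(M i j)%:R|]ger0_norm //; apply: ler_wpM2r => //.
  have /andP[a1 a2] := alB i; have /andP[b1 b2] := beB j; move: B0 B4 => B0' B4'.
  have c1 : (1 - B) * (1 - B) <= al i * be j by apply: ler_pM; lra.
  have c2 : al i * be j <= (1 + B) * (1 + B) by apply: ler_pM; lra.
  move: c1 c2; move: (al i * be j) => c c1 c2.
  have c3 : 1 - 2 * B <= c by nra.
  have c4 : c <= 1 + 9 / 4 * B by nra.
  by rewrite ler_norml; apply/andP; split; nra.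
rewrite eS.
have -> : ((N / sig) ^+ 2 * (E + N * sig) - N ^+ 2 - 2 * S) / (2 * N ^+ 2) - (N / sig - 1) / 2 =
   E / (2 * sig ^+ 2) - S / N ^+ 2 by field; rewrite !gt_eqF.
apply: le_trans (ler_normB _ _) _; apply: lerD.
  have p2 : 0 < 2 * sig ^+ 2 by rewrite mulr_gt0 // exprn_gt0.
  rewrite normrM normfV (gtr0_norm p2) ler_pdivrMr //.
  apply: le_trans EB _.
  have := ler_wpM2l B0 NL; have := ltW s0; move: (sig) => x x0 h.
  have := ler_wpM2r x0 h; lra.
have pN : 0 < N ^+ 2 by exact: exprn_gt0.
rewrite normrM normfV (gtr0_norm pN) ler_pdivrMr //.
apply: le_trans scaled_sum _; apply: le_of_eq; field; rewrite gt_eqF //.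
Qed.

End Half.
End Scaling.

(** * Permanents of good matrices and their expectation *)

Section GoodPermanent.
Variables (R : realType) (n : nat) (s t : 'I_n -> nat) (sig L B tau1 tau2 : R).
Local Notation N := (n%:R : R).
Hypotheses (n0 : 0 < N) (s0 : 0 < sig) (NL : N <= L * sig) (B4 : B <= 1 / 4) (B0 : 0 <= B).
Hypotheses (spos : forall i, (0 < s i)%N) (tpos : forall j, (0 < t j)%N).
Hypotheses (sB : forall i, `|sig / (s i)%:R - 1| <= B) (tB : forall j, `|sig / (t j)%:R - 1| <= B).
Hypotheses (sB' : forall i, `|(s i)%:R / sig - 1| <= B) (tB' : forall j, `|(t j)%:R / sig - 1| <= B).
Hypotheses (ssum : \sum_j (s j)%:R = N * sig) (tsum : \sum_j (t j)%:R = N * sig).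
Variables (q T : R) (K : nat).
Hypotheses (q2 : 2 <= q) (qT : q <= T) (nbig : q ^+ 60 * T <= N).
Hypothesis Kbig : (1 - (16 * q ^+ 2)^-1) ^+ K <= (N ^+ 2)^-1.
Hypothesis Kq : (3 * K).+4%:R <= q ^+ 4.
Local Notation D := (tau1 + 2 * N * B ^+ 2).
Hypotheses (Lq : 25 / 16 * L <= q) (Dq : 5 / 4 * L * D <= q).
Hypothesis DT : 25 / 16 * L ^+ 2 * (3 * B * N + tau2) + 5 / 2 * L * D <= T.
Hypothesis N1 : 1 <= N.

Definition main_exponent : R :=
  (1 - sig / N) / (2 * (sig / N)) - (sqdev s sig + sqdev t sig) / (2 * (sig / N) ^+ 2 * N ^+ 2).

(** The rescaling takes out (sig / N)^n and the products of s i / sig and t j / sig. These products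
    give the variances in the exponent through [prod_ratio]; the flat matrix U gives the rest. *)
Lemma good_perm (M : 'M[bool]_n) : M \in zo_mats s t -> good s t sig tau1 tau2 M ->
  exists2 d, `|d| <= q ^+ 46 * T / N + 4 * N * B ^+ 3 + 2 * (L * (B * D)) + 3 * B * L &
    (perm01 M)%:R = n`!%:R * (sig / N) ^+ n * expR (main_exponent + d).
Proof.
move=> Mz /andP[g1 g2].
pose U := scaled s t sig M.
have hf1 : half_flat q T (tr U) by exact: (scaled_half_flat n0 s0 NL B4 B0 spos tpos sB tB tsum Mz g1).
have hf2 : half_flat q T U.
  have Mz' : M^T \in zo_mats t s by rewrite zo_tr.
  have [h1 h2 h3] := scaled_half_flat n0 s0 NL B4 B0 tpos spos tB sB ssum Mz' g2 Lq Dq DT.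
  split=> [i j|j|j k jk].
  - by have := h1 i j; rewrite /tr scaled_tr.
  - by have := h2 j; rewrite /tr; under eq_bigr do rewrite scaled_tr.
  - by have := h3 j k jk; rewrite /tr; under eq_bigr do rewrite !scaled_tr.
have [d1 d1B e1] := permanent_expansion q2 qT nbig Kbig Kq (conj hf2 hf1).
have B2 : B <= 1 / 2 by move: B4; lra.
have [d2 d2B e2] := prod_ratio s0 B2 ssum sB'.
have [d3 d3B e3] := prod_ratio s0 B2 tsum tB'.
have sumB : `|\sum_i \sum_j U i j| <= N * (L * (B * D)).
  exact: (scaled_sum n0 s0 NL B4 B0 spos tpos sB tB tsum Mz g1).
have sqrB := scaled_sum_sqr n0 s0 NL B4 B0 spos tpos sB tB tsum Mz g1.
set a1 := \sum_i \sum_j U i j in sumB e1.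
have perm : (perm01 M)%:R = (sig / N) ^+ n * (\prod_i ((s i)%:R / sig)) * (\prod_i ((t i)%:R / sig)) *
    \sum_(sg : 'S_n) \prod_i (1 + U i (sg i)).
  rewrite /perm01 natr_sum mulr_sumr; apply: eq_bigr => sg _.
  rewrite natr_prod [\prod_i ((t i)%:R / sig)](reindex_inj (@perm_inj _ sg)) /=.
  have -> : (sig / N) ^+ n = \prod_(i < n) (sig / N) by rewrite prodr_const card_ord.
  rewrite -!big_split; apply: eq_bigr => i _ /=.
  rewrite /U /scaled; field.
  by rewrite !gt_eqF // ltr0n.
exists (d1 + d2 + d3 + a1 / N + ((\sum_i \sum_j U i j ^+ 2) / (2 * N ^+ 2) - (N / sig - 1) / 2)); last first.
  rewrite perm e1 e2 e3.
  rewrite [LHS](_ : _ = n`!%:R * (sig / N) ^+ n * (expR (- (\sum_i ((s i)%:R - sig) ^+ 2) / (2 * sig ^+ 2) + d2) *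
    expR (- (\sum_i ((t i)%:R - sig) ^+ 2) / (2 * sig ^+ 2) + d3) *
    expR (a1 / N + (\sum_i \sum_j U i j ^+ 2) / (2 * N ^+ 2) + d1))); last by ring.
  rewrite -!expRD; congr (_ * expR _).
  rewrite /main_exponent /sqdev; field.
  by rewrite !gt_eqF.
have a1N : `|a1 / N| <= L * (B * D) by rewrite normrM normfV (gtr0_norm n0) ler_pdivrMr // mulrC.
have pos : 0 <= L * (B * D) by apply: le_trans a1N.
have last : L * (B * D) / N <= L * (B * D) by rewrite ler_pdivrMr // ler_peMr.
apply: le_trans (ler_normD _ _) _.
apply: le_trans (lerD (ler_normD _ _) (lexx _)) _.
apply: le_trans (lerD (lerD (ler_normD _ _) (lexx _)) (lexx _)) _.
apply: le_trans (lerD (lerD (lerD (ler_normD _ _) (lexx _)) (lexx _)) (lexx _)) _.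
move: d1B d2B d3B a1N sqrB last.
move: `|d1| `|d2| `|d3| `|a1 / N| `|_ - _| (L * (B * D) / N) (L * (B * D)) (q ^+ 46 * T / N) (B ^+ 3) => *; lra.
Qed.

Variables (Del de : R) (m : nat) (x1 x2 p : R).
Hypothesis nr : near_regular s t sig Del de.
Hypotheses (m4 : (4 <= m)%N) (m2 : (2 * m)%:R <= de * N) (e1 : eta Del m <= 1).
Hypotheses (x10 : 0 <= x1) (x20 : 0 <= x2) (tau10 : 0 <= tau1).
Hypothesis p1 : 2 * expR (x1 * (drift n B (eta Del m) x1 - tau1)) <= p.
Hypothesis p2 : 2 * expR (x2 * (drift n 1 (eta Del m) x2 - tau2)) <= p.
Hypothesis psmall : 2 * (N + N ^+ 2) * p <= 1 / 2.

(** The exceptional share pi enters through 1 - pi >= exp(-2 pi), valid for pi <= 1/2, and so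
    becomes an additive error 2 pi in the exponent. *)
Lemma expected_perm_near :
  exists2 d, `|d| <= q ^+ 46 * T / N + 4 * N * B ^+ 3 + 2 * (L * (B * D)) + 3 * B * L + 4 * (N + N ^+ 2) * p &
    expected_perm R s t = n`!%:R * (sig / N) ^+ n * expR (main_exponent + d).
Proof.
set ka := q ^+ 46 * T / N + 4 * N * B ^+ 3 + 2 * (L * (B * D)) + 3 * B * L.
set E1 := n`!%:R * (sig / N) ^+ n.
pose pi := 2 * (N + N ^+ 2) * p.
have E10 : 0 < E1 by rewrite mulr_gt0 ?ltr0n ?fact_gt0 // exprn_gt0 // divr_gt0.
have p0 : 0 <= p by apply: le_trans p1; rewrite mulr_ge0 // expR_ge0.
have pi0 : 0 <= pi by rewrite /pi !mulr_ge0 // addr_ge0 // sqr_ge0.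
have zo0 : exists M, M \in zo_mats s t.
  apply: (zo_nonempty nr); apply/eqP; rewrite -(eqr_nat R) !natr_sum ssum tsum //.
have rare H M0 : partial_perm H -> #|[set M in fam H M0 s t | ~~ good s t sig tau1 tau2 M]|%:R <= pi * #|fam H M0 s t|%:R.
  exact: (good_count M0 nr m4 m2 e1 x10 x20 tB sB p1 p2).
have bounds M : M \in zo_mats s t -> good s t sig tau1 tau2 M ->
    E1 * expR (main_exponent - ka) <= (perm01 M)%:R <= E1 * expR (main_exponent + ka).
  move=> Mz Mg; have [d dka ->] := good_perm Mz Mg.
  move: dka; rewrite -/ka ler_norml => /andP[d1 d2].
  by rewrite !ler_pM2l // !ler_expR !lerD2l d1 d2.
have lo0 : 0 <= E1 * expR (main_exponent - ka) by rewrite mulr_ge0 ?expR_ge0 // ltW.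
have ka0 : 0 <= ka.
  have L0 : 0 <= L by rewrite -(pmulr_lge0 L s0); apply: le_trans NL.
  have q0 : 0 <= q by apply: le_trans q2.
  have D0 : 0 <= D by rewrite addr_ge0 // !mulr_ge0 // sqr_ge0.
  by rewrite /ka !addr_ge0 // ?divr_ge0 ?mulr_ge0 ?exprn_ge0 //; apply: le_trans qT.
have lohi : E1 * expR (main_exponent - ka) <= E1 * expR (main_exponent + ka).
  by rewrite ler_pM2l // ler_expR; lra.
have [b1 b2] := average_between zo0 lo0 lohi rare bounds.
have pi2 : expR (- (2 * pi)) <= 1 - pi.
  rewrite expRN -[X in X <= _]mul1r ler_pdivrMr ?expR_gt0 //.
  apply: le_trans (_ : (1 - pi) * (1 + 2 * pi) <= _).
    have := psmall; rewrite -/pi => ?; nra.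
  apply: ler_wpM2l; first by have := psmall; rewrite -/pi; lra.
  exact: expR_ge1Dx.
set E := expected_perm R s t in b1 b2 *.
have lo : E1 * expR (main_exponent - ka - 2 * pi) <= E.
  apply: le_trans b1; rewrite expRD mulrA.
  exact: ler_wpM2l.
have Ep : 0 < E by apply: lt_le_trans lo; rewrite mulr_gt0 // expR_gt0.
have hi : E <= E1 * expR (main_exponent + ka + 2 * pi).
  rewrite expRD mulrA; apply: le_trans (_ : E * (1 - pi) * expR (2 * pi) <= _); last first.
    by apply: ler_wpM2r => //; exact: expR_ge0.
  rewrite -mulrA ler_peMr ?(ltW Ep) //.
  by rewrite -[X in X <= _](_ : expR (- (2 * pi)) * expR (2 * pi) = 1) ?ler_pM2r ?expR_gt0 // -expRD addNr expR0.
have EE : 0 < E / E1 by exact: divr_gt0.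
exists (ln (E / E1) - main_exponent); last first.
  by rewrite [main_exponent + _]addrC subrK lnK ?posrE // mulrC divfK ?gt_eqF.
rewrite ler_norml; apply/andP; split.
  have : expR (main_exponent - ka - 2 * pi) <= E / E1 by rewrite ler_pdivlMr // mulrC.
  by rewrite -[X in _ <= X]lnK ?posrE // ler_expR /pi; lra.
have : E / E1 <= expR (main_exponent + ka + 2 * pi) by rewrite ler_pdivrMr // mulrC.
by rewrite -[X in X <= _]lnK ?posrE // ler_expR /pi; lra.
Qed.

End GoodPermanent.

(** * Choice of the scales *)

Lemma error_budget (R : realFieldType) (z z47 z48 u v w : R) : u <= z -> v <= z -> 1 <= z -> w <= z ->
  z <= z47 -> 16 * z47 <= z48 -> z47 + 4 * u + 2 * w + 3 * v + 1 <= z48.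
Proof. by move=> *; lra. Qed.

(* y is a small power of n and h = sqrt n; z and h * z play the roles of q and T. *)
Section Scales.
Variables (R : realType) (n : nat) (sig y h : R).
Local Notation N := (n%:R : R).
Hypotheses (y16 : 16 <= y) (h0 : 0 < h) (hN : h ^+ 2 = N).
Local Notation z := (y ^+ 25).
Hypotheses (zh : z ^+ 61 <= h) (lny : 8 * ln N <= y).

Let y0 : 0 < y. Proof. by apply: lt_le_trans y16. Qed.
Let y1 : 1 <= y. Proof. by apply: le_trans y16; rewrite (ler_nat _ 1). Qed.

Lemma scaleX_le (k l : nat) : (k <= l)%N -> y ^+ k <= y ^+ l.
Proof. by move=> kl; rewrite ler_weXn2l. Qed.

Lemma cscaleX_le (a d k : nat) : (a <= 16 ^ d)%N -> a%:R * y ^+ k <= y ^+ (d + k).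
Proof.
move=> ad; rewrite exprD; apply: ler_wpM2r; first by rewrite exprn_ge0 // ltW.
apply: le_trans (_ : (16 ^ d)%:R <= _); first by rewrite ler_nat.
by rewrite natrX lerXn2r ?nnegrE // ltW.
Qed.

Lemma scale_le_h : y ^+ 50 <= h.
Proof.
apply: le_trans zh; rewrite -[50%N]/(25 * 2)%N exprM ler_weXn2l //.
exact: exprn_ege1.
Qed.

(** K is the integer part of 4 z^2 y, plus 1. With a = 1 / (16 z^2), (1 - a)^K <= exp(- a K) and a K
    >= y / 4 >= 2 ln N, while 3 K + 4 stays below z^4 because 16 y <= z. *)
Lemma contraction_steps : exists2 K,
  (1 - (16 * z ^+ 2)^-1) ^+ K <= (N ^+ 2)^-1 & (3 * K).+4%:R <= z ^+ 4.
Proof.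
have z1 : 1 <= z by exact: exprn_ege1.
have z2 : 0 < z ^+ 2 by apply: exprn_gt0; apply: lt_le_trans z1.
have N0 : 0 < N by rewrite -hN exprn_gt0.
set a := (16 * z ^+ 2)^-1.
have a0 : 0 < a by rewrite invr_gt0 mulr_gt0.
have a1 : a <= 1.
  rewrite invf_le1 ?mulr_gt0 //; have : 1 <= z ^+ 2 by exact: exprn_ege1.
  by lra.
have zy0 : 0 <= 4 * z ^+ 2 * y by rewrite !mulr_ge0 // ltW.
have /andP[k1 k2] := truncn_itv zy0.
set k := Num.truncn _ in k1 k2.
exists k.+1.
  apply: le_trans (_ : expR (- a) ^+ k.+1 <= _).
    by apply: lerXn2r; rewrite ?nnegrE ?expR_ge0 ?subr_ge0 //; exact: expR_ge1Dx.
  rewrite -[X in _ <= X^-1]lnK ?posrE ?exprn_gt0 // -expRN -expRM_natl ler_expR lnXn //.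
  rewrite mulrN lerN2 -[ln N *+ 2]mulr_natl.
  apply: le_trans (_ : 4 * z ^+ 2 * y * a <= _); last first.
    by rewrite ler_wpM2r ?ltW.
  have -> : 4 * z ^+ 2 * y * a = y / 4 by rewrite /a; field; rewrite gt_eqF.
  by have := lny; lra.
rewrite -addn4 natrD natrM -(addn1 k) natrD.
have h1 : y ^+ 2 <= z by exact: scaleX_le.
have -> : z ^+ 4 = z ^+ 2 * z ^+ 2 by ring.
have h2 : 1 <= z ^+ 2 by exact: exprn_ege1.
have h3 : 16 * y <= z by have := @cscaleX_le 16 1 1 isT; rewrite expr1 => h3; apply: le_trans h3 _.
have h4 : 16 * z <= z ^+ 2.
  by rewrite expr2; apply: ler_wpM2r; [apply: le_trans z1|apply: le_trans (le_trans y16 _) h1; rewrite expr2 ler_peMl // ltW].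
have h5 := ler_wpM2l (ltW z2) h3; have h6 := ler_wpM2l (ltW z2) h4.
have h7 := ler_wpM2l (ltW z2) y16.
by move: k1 h2 h5 h6 h7; move: (z) => w; lra.
Qed.

Section NearRegular.
Variables (s t : 'I_n -> nat).
Hypotheses (s0 : 0 < sig) (sN : sig < N) (dens : N ^+ 2 <= y * (sig * (N - sig))).
Hypotheses (sD : forall i, `|(s i)%:R - sig| <= h * y ^+ 2) (tD : forall i, `|(t i)%:R - sig| <= h * y ^+ 2).
Local Notation de := (sig * (N - sig) / (8 * N ^+ 2)).
Local Notation B := (y ^+ 4 / h).

Let N0 : 0 < N. Proof. by rewrite -hN exprn_gt0. Qed.

Lemma scale_density : N <= y * sig.
Proof.
rewrite -(ler_pM2l N0) -expr2; apply: le_trans dens _.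
have -> : N * (y * sig) = y * (sig * N) by ring.
by rewrite !ler_pM2l // gerBl ltW.
Qed.

Lemma scale_de : h ^+ 2 / (8 * y) <= de * N.
Proof.
rewrite ler_pdivrMr ?mulr_gt0 // hN.
have -> : de * N * (8 * y) = y * (sig * (N - sig)) / N by field; rewrite gt_eqF.
by rewrite ler_pdivlMr // -expr2.
Qed.

Lemma scale_B : B <= 1 / 4.
Proof.
rewrite ler_pdivrMr //; have a := scale_le_h.
have b : 16 * y ^+ 4 <= y ^+ 5 := @cscaleX_le 16 1 4 isT.
by have := h0; have := @scaleX_le 5 50 isT; move: (y ^+ 50) a => *; lra.
Qed.

(** As sig >= N / y, a deviation h y^2 is at most y^3 / h relative to sig; the remaining factor y in
    y^4 / h absorbs the constant 2 that the inverse ratio costs. *)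
Lemma scale_dev (x : R) : `|x - sig| <= h * y ^+ 2 -> `|x / sig - 1| <= B /\ (0 < x -> `|sig / x - 1| <= B).
Proof.
move=> hx.
have B0 : 0 <= B by rewrite divr_ge0 ?exprn_ge0 // ltW.
have y3 : 2 * (h * y ^+ 2) <= B * sig.
  rewrite -(ler_pM2l y0); apply: le_trans (_ : B * N <= _); last first.
    by rewrite mulrCA; apply: ler_wpM2l => //; exact: scale_density.
  rewrite -hN; have -> : B * h ^+ 2 = h * y ^+ 4 by field; rewrite gt_eqF.
  have c : 2 * y ^+ 3 <= y ^+ 4 := @cscaleX_le 2 1 3 isT.
  by have := ler_wpM2l (ltW h0) c; lra.
have B4 := ler_wpM2r (ltW s0) scale_B.
have w0 : 0 <= h * y ^+ 2 by apply: le_trans hx.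
move: hx y3 B0 B4; move: (B) (h * y ^+ 2) w0 => e w w0 hx y3 B0 B4.
split.
  have -> : x / sig - 1 = (x - sig) / sig by field; rewrite gt_eqF.
  rewrite normrM normfV (gtr0_norm s0) ler_pdivrMr //; apply: le_trans hx _.
  by lra.
move=> x0.
have -> : sig / x - 1 = (sig - x) / x by field; rewrite gt_eqF.
rewrite normrM normfV (gtr0_norm x0) ler_pdivrMr // distrC; apply: (le_trans hx).
have : sig / 2 <= x by move: hx; rewrite ler_norml => /andP[? _]; lra.
by move=> /(ler_wpM2l B0); lra.
Qed.

Lemma scale_near_regular : near_regular s t sig (h * y ^+ 2) de.
Proof.
have sN' : 0 < N - sig by rewrite subr_gt0.
have de0 : 0 < de by rewrite divr_gt0 ?mulr_gt0 ?exprn_gt0.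
have deN : 8 * de * N = sig * (N - sig) / N by field; rewrite gt_eqF.
have h2 := scale_de; have h50 := scale_le_h.
have y16' := y16; have h0' := h0.
split=> //; split=> //.
- by rewrite deN ler_pdivrMr // ler_pM2l // gerBl ltW.
- by rewrite deN ler_pdivrMr // mulrC ler_pM2l // ltW.
- apply: le_of_eq; field; rewrite gt_eqF //.
have yh : y ^+ 5 <= h by apply: le_trans h50; exact: scaleX_le.
have e1 : 16 * y ^+ 4 <= y ^+ 5 := @cscaleX_le 16 1 4 isT.
have e2 : 16 * y ^+ 3 <= y ^+ 4 := @cscaleX_le 16 1 3 isT.
have e3 : 16 * y ^+ 2 <= y ^+ 3 := @cscaleX_le 16 1 2 isT.
have e4 : 16 * y ^+ 1 <= y ^+ 2 := @cscaleX_le 16 1 1 isT.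
rewrite expr1 in e4.
split; last by rewrite mulr_ge0 ?exprn_ge0 // ltW.
  apply: le_trans h2; rewrite ler_pdivlMr ?mulr_gt0 //.
  have := ler_wpM2l (ltW h0) yh; have := ler_wpM2l (ltW h0) e1; have := ler_wpM2l (ltW h0) e2.
  have := ler_wpM2l (ltW h0) e3; have := ler_wpM2l (ltW h0) e4.
  have : 20 <= h by lra.
  by move=> /(ler_wpM2r (ltW y0)); lra.
have -> : de ^+ 2 * N = (de * N) ^+ 2 / N by field; rewrite gt_eqF.
rewrite ler_pdivlMr // -[X in 12 * X]hN.
apply: le_trans (_ : (h ^+ 2 / (8 * y)) ^+ 2 <= _); last first.
  have A : 0 <= h ^+ 2 / (8 * y) by rewrite divr_ge0 ?sqr_ge0 // mulr_ge0 // ltW.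
  by apply: lerXn2r; rewrite ?nnegrE //; apply: (le_trans A).
have -> : (h ^+ 2 / (8 * y)) ^+ 2 = h ^+ 2 * (h / (8 * y)) ^+ 2 by field; rewrite gt_eqF.
rewrite mulrC ler_pM2l ?exprn_gt0 //.
have : 4 <= h / (8 * y) by rewrite ler_pdivlMr ?mulr_gt0 //; lra.
move=> k; apply: le_trans (_ : 4 ^+ 2 <= _); first by lra.
by apply: lerXn2r; rewrite ?nnegrE //; apply: le_trans k.
Qed.

(** m is about h^2 / (16 y), as large as the lower bound on de N allows; then Del / m is of order
    y^3 / h, and 2^-m is negligible. *)
Lemma scale_eta : exists m, [/\ (4 <= m)%N, (2 * m)%:R <= de * N & eta (h * y ^+ 2) m <= y ^+ 12 / h].
Proof.
have h50 := scale_le_h; have y16' := y16; have h0' := h0.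
have yh : y ^+ 5 <= h by apply: le_trans h50; exact: scaleX_le.
have e1 : 16 * y ^+ 4 <= y ^+ 5 := @cscaleX_le 16 1 4 isT.
have e2 : 16 * y ^+ 3 <= y ^+ 4 := @cscaleX_le 16 1 3 isT.
have e3 : 16 * y ^+ 2 <= y ^+ 3 := @cscaleX_le 16 1 2 isT.
have e4 : 16 * y ^+ 1 <= y ^+ 2 := @cscaleX_le 16 1 1 isT.
rewrite expr1 in e4.
pose g := h ^+ 2 / (32 * y).
have g8 : 8 <= g.
  rewrite /g ler_pdivlMr ?mulr_gt0 //.
  have : h * y <= h ^+ 2 by rewrite expr2 ler_pM2l //; lra.
  have : 256 * y <= h * y by rewrite ler_pM2r //; lra.
  by lra.
have g0 : 0 <= 2 * g by lra.
have /andP[m1 m2] := truncn_itv g0.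
set m := Num.truncn _ in m1 m2; exists m.
have {}m2 : 2 * g - 1 < m%:R by move: m2; rewrite -(addn1 m) natrD; lra.
have m3 : g <= m%:R - 3 by lra.
split.
- by rewrite -ltnS -(ltr_nat R) -(addn1 m) natrD; lra.
- apply: le_trans scale_de; rewrite natrM.
  have -> : h ^+ 2 / (8 * y) = 2 * (2 * g) by rewrite /g; field; rewrite gt_eqF.
  by rewrite ler_pM2l.
have p3 : 0 < m%:R - 3 :> R by lra.
have w0 : 0 <= h * y ^+ 2 by rewrite mulr_ge0 ?exprn_ge0 ?ltW.
apply: le_trans (_ : (2 * (h * y ^+ 2) + 5) / (m%:R - 3) <= _).
  rewrite /eta (_ : 2 * (h * y ^+ 2) + 5 = 1 + (2 * (h * y ^+ 2) + 4)); last by ring.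
  rewrite [X in _ <= X]mulrDl lerD2r mul1r lef_pV2 ?posrE ?exprn_gt0 //.
  apply: le_trans (_ : m%:R <= _); first by lra.
  by rewrite -natrX ler_nat ltnW // ltn_expl.
rewrite ler_pdivrMr //.
apply: le_trans (_ : y ^+ 12 / h * g <= _); last first.
  by apply: ler_wpM2l => //; rewrite divr_ge0 ?exprn_ge0 // ltW.
have -> : y ^+ 12 / h * g = h * (y ^+ 11 / 32) by rewrite /g; field; rewrite !gt_eqF.
have e5 : y ^+ 5 <= y ^+ 11 by exact: scaleX_le.
apply: le_trans (_ : h * (y ^+ 5 / 32) <= _); last by rewrite ler_pM2l // ler_pM2r.
have : h * 5 <= h * y ^+ 2 by rewrite ler_pM2l //; lra.
have := ler_wpM2l (ltW h0) e1; have := ler_wpM2l (ltW h0) e2; have := ler_wpM2l (ltW h0) e3.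
have : 1 <= h by lra.
lra.
Qed.

Hypotheses (spos : forall i, (0 < s i)%N) (tpos : forall i, (0 < t i)%N).
Hypotheses (ssum : \sum_j (s j)%:R = N * sig) (tsum : \sum_j (t j)%:R = N * sig).

Let D : R := 2 * y ^+ 18 + 2 * N * B ^+ 2.

Let D_le : D <= y ^+ 20.
Proof.
have -> : D = 2 * y ^+ 18 + 2 * y ^+ 8 by rewrite /D -hN; field; rewrite gt_eqF.
have a : 2 * y ^+ 18 <= y ^+ 19 := @cscaleX_le 2 1 18 isT.
have b : y ^+ 8 <= y ^+ 18 by exact: scaleX_le.
have c : 2 * y ^+ 19 <= y ^+ 20 := @cscaleX_le 2 1 19 isT.
lra.
Qed.

Let y_le k : (0 < k)%N -> y <= y ^+ k.
Proof. by move=> k0; rewrite -[X in X <= _]expr1; exact: scaleX_le. Qed.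

(** The entries of the statistic are at most y^4 / h, so even with x = 1 the drift is only of order
    y^16, and the threshold 2 y^18 exceeds it by more than y. *)
Lemma scale_tail1 (e : R) : e <= y ^+ 12 / h -> 2 * expR (1 * (drift n B e 1 - 2 * y ^+ 18)) <= 2 * expR (- y).
Proof.
move=> eh; rewrite ler_pM2l // ler_expR mul1r /drift mulr1.
have B1 := scale_B.
have B0 : 0 <= B by rewrite divr_ge0 ?exprn_ge0 // ltW.
have b0 : 0 <= 2 * B * N by rewrite mulr_ge0 // mulr_ge0.
have h1 : 2 * B * N * (e + 2 * B) <= 2 * B * N * (y ^+ 12 / h + 2 * B) by rewrite ler_wpM2l // lerD2r.
have h2 : 2 * B * N * (y ^+ 12 / h + 2 * B) = 2 * y ^+ 16 + 4 * y ^+ 8.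
  by rewrite -hN; field; rewrite gt_eqF.
have h3 : 16 * y ^+ 16 <= y ^+ 17 := @cscaleX_le 16 1 16 isT.
have h4 : y ^+ 8 <= y ^+ 16 by exact: scaleX_le.
have h5 : y ^+ 17 <= y ^+ 18 by exact: scaleX_le.
have h6 : y <= y ^+ 16 by exact: y_le.
have y16' := y16.
move: B1 h1 h2; move: (2 * B * N * (e + 2 * B)) (2 * B * N * (y ^+ 12 / h + 2 * B)) (B) => u v w *; lra.
Qed.

(** For overlaps the entries have size 1 and the drift is of order h y^12. Taking x = 1 / h keeps
    its term quadratic in the entries of lower order, and the threshold h y^20 brings the exponent
    below - y. *)
Lemma scale_tail2 (e : R) : e <= y ^+ 12 / h -> 2 * expR (h^-1 * (drift n 1 e h^-1 - h * y ^+ 20)) <= 2 * expR (- y).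
Proof.
move=> eh; rewrite ler_pM2l // ler_expR ler_pdivrMl // /drift !mulr1.
have h1 : 2 * N * (e + 2 * h^-1) <= 2 * N * (y ^+ 12 / h + 2 * h^-1).
  by rewrite ler_wpM2l ?mulr_ge0 // lerD2r.
have h2 : 2 * N * (y ^+ 12 / h + 2 * h^-1) = h * (2 * y ^+ 12 + 4).
  by rewrite -hN; field; rewrite gt_eqF.
have y16' := y16.
have h3 : 16 * y ^+ 12 <= y ^+ 13 := @cscaleX_le 16 1 12 isT.
have h4 : y <= y ^+ 12 by exact: y_le.
have h5 : y ^+ 13 <= y ^+ 20 by exact: scaleX_le.
have h6 : h * (2 * y ^+ 12 + 5 + y) <= h * y ^+ 20 by rewrite ler_pM2l //; lra.
have h7 : 4 <= h.
  by have := scale_le_h; have := @y_le 50 isT; move: (y ^+ 50) => *; lra.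
move: h1 h2; move: (2 * N * (e + 2 * h^-1)) (2 * N * (y ^+ 12 / h + 2 * h^-1)) => u v *; lra.
Qed.

(** y >= 3 ln N makes exp(- y) at most N^-3, which beats the union bound over N + N^2 events by a
    factor of order N = h^2. *)
Lemma scale_rare : 4 * (N + N ^+ 2) * (2 * expR (- y)) <= 1 / h.
Proof.
have h16 : 16 <= h.
  by have := scale_le_h; have := @y_le 50 isT; have := y16; move: (y ^+ 50) => *; lra.
have e : expR (- y) <= (N ^+ 3)^-1.
  rewrite -[X in _ <= X^-1]lnK ?posrE ?exprn_gt0 // -expRN ler_expR lerN2 lnXn //.
  rewrite -[_ *+ _]mulr_natl; apply: le_trans lny.
  rewrite ler_wpM2r // ?ln_ge0 //; first by rewrite -hN expr2; nra.
  by lra.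
have N1 : 1 <= N by rewrite -hN expr2; nra.
have NN : N <= N ^+ 2 by rewrite expr2 ler_peMl // ltW.
apply: le_trans (_ : 4 * (N ^+ 2 + N ^+ 2) * (2 * (N ^+ 3)^-1) <= _).
  by apply: ler_pM; rewrite ?mulr_ge0 ?addr_ge0 ?sqr_ge0 ?expR_ge0 //; lra.
have -> : 4 * (N ^+ 2 + N ^+ 2) * (2 * (N ^+ 3)^-1) = 16 / N by field; rewrite gt_eqF.
rewrite ler_pdivrMr // -hN.
have -> : 1 / h * h ^+ 2 = h by field; rewrite gt_eqF.
by [].
Qed.

(** The expansion of the permanent contributes z^46 (h z) / N = z^47 / h; every other error is at
    most a constant times z / h, and one more factor z absorbs the constants. *)
Theorem expected_perm_scales :
  exists2 d, `|d| <= z ^+ 48 / h &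
    expected_perm R s t = n`!%:R * (sig / N) ^+ n * expR (main_exponent s t sig + d).
Proof.
have [K Kbig Kq] := contraction_steps.
have [m [m4 m2 em]] := scale_eta.
have y16' := y16.
have hz : y ^+ 50 <= h := scale_le_h.
have z2 : 2 <= z by apply: le_trans (_ : y <= _); [lra|exact: y_le].
have h1 : 1 <= h by have := @y_le 50 isT; move: hz; move: (y ^+ 50) => *; lra.
have B0 : 0 <= B by rewrite divr_ge0 ?exprn_ge0 // ltW.
have e1 : eta (h * y ^+ 2) m <= 1.
  by apply: le_trans em _; rewrite ler_pdivrMr // mul1r; apply: le_trans hz; exact: scaleX_le.
have y20 : 16 * y ^+ 20 <= y ^+ 21 := @cscaleX_le 16 1 20 isT.
have y21 : 16 * y ^+ 21 <= y ^+ 22 := @cscaleX_le 16 1 21 isT.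
have y22 : 16 * y ^+ 22 <= y ^+ 23 := @cscaleX_le 16 1 22 isT.
have y23 : 16 * y ^+ 23 <= y ^+ 24 := @cscaleX_le 16 1 23 isT.
have y24 : 16 * y ^+ 24 <= y ^+ 25 := @cscaleX_le 16 1 24 isT.
have y24' : y <= y ^+ 24 by exact: y_le.
have yD : y * D <= y ^+ 21 by rewrite exprS ler_pM2l.
have y20' : 0 <= y ^+ 20 by rewrite exprn_ge0 // ltW.
have y6 : y ^+ 6 <= y ^+ 22 by exact: scaleX_le.
have sB i : `|sig / (s i)%:R - 1| <= B by apply: (scale_dev (sD i)).2; rewrite ltr0n.
have tB i : `|sig / (t i)%:R - 1| <= B by apply: (scale_dev (tD i)).2; rewrite ltr0n.
have sB' i : `|(s i)%:R / sig - 1| <= B := (scale_dev (sD i)).1.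
have tB' i : `|(t i)%:R / sig - 1| <= B := (scale_dev (tD i)).1.
have qT : z <= h * z by rewrite ler_peMl // exprn_ge0 // ltW.
have nbig : z ^+ 60 * (h * z) <= N.
  rewrite -hN; have -> : z ^+ 60 * (h * z) = h * z ^+ 61 by rewrite [z ^+ 61]exprSr mulrCA.
  by rewrite [h ^+ 2]expr2 ler_pM2l.
have Lq : 25 / 16 * y <= z by move: y20 y21 y22 y23 y24 y24'; move: (z) => *; lra.
have Dq : 5 / 4 * y * D <= z by move: y20 y21 y22 y23 y24 yD; move: (z) => *; lra.
have BN : 3 * B * N = h * (3 * y ^+ 4) by rewrite -hN; field; rewrite gt_eqF.
have DT : 25 / 16 * y ^+ 2 * (3 * B * N + h * y ^+ 20) + 5 / 2 * y * D <= h * z.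
  rewrite BN [X in X + _](_ : _ = h * (25 / 16 * (3 * y ^+ 6 + y ^+ 22))); last by field.
  apply: le_trans (_ : h * (25 / 16 * (3 * y ^+ 6 + y ^+ 22)) + h * (5 / 2 * y ^+ 21) <= _).
    rewrite lerD2l; apply: le_trans (_ : 1 * (5 / 2 * y ^+ 21) <= _); first by lra.
    by rewrite ler_wpM2r // mulr_ge0 // exprn_ge0 // ltW.
  by rewrite -mulrDr ler_pM2l //; move: y20 y21 y22 y23 y24 y6; move: (z) => *; lra.
have N1 : 1 <= N by rewrite -hN exprn_ege1.
have rare := scale_rare.
have psmall : 2 * (N + N ^+ 2) * (2 * expR (- y)) <= 1 / 2.
  have : 1 / h <= 1 by rewrite ler_pdivrMr // mul1r.
  move=> h1'; rewrite (_ : _ * _ = 4 * (N + N ^+ 2) * (2 * expR (- y)) / 2); last by field.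
  by rewrite ler_pM2r //; exact: le_trans rare h1'.
have h10 : 0 <= h^-1 by rewrite invr_ge0 ltW.
have t10 : 0 <= 2 * y ^+ 18 by rewrite mulr_ge0 // exprn_ge0 // ltW.
have [d dB ->] := expected_perm_near N0 s0 scale_density scale_B B0 spos tpos sB tB sB' tB' ssum tsum
  z2 qT nbig Kbig Kq Lq Dq DT N1 scale_near_regular m4 m2 e1 ler01 h10 t10
  (scale_tail1 em) (scale_tail2 em) psmall.
exists d => //; apply: (le_trans dB); rewrite -/D.
have k1 : z ^+ 46 * (h * z) / N = z ^+ 47 / h.
  by rewrite -hN [z ^+ 47]exprSr; move: (z) (z ^+ 46) => v w; field; rewrite gt_eqF.
have k2 : 4 * N * B ^+ 3 = 4 * y ^+ 12 / h by rewrite -hN; field; rewrite gt_eqF.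
have k3 : 2 * (y * (B * D)) = 2 * (y ^+ 4 * (y * D)) / h by field; rewrite gt_eqF.
have k4 : 3 * B * y = 3 * y ^+ 5 / h by field; rewrite gt_eqF.
apply: le_trans (lerD (lexx _) rare) _.
rewrite k1 k2 k3 k4 -!mulrDl ler_wpM2r //.
have c12 : y ^+ 12 <= z by exact: scaleX_le.
have c5 : y ^+ 5 <= z by exact: scaleX_le.
have c0 : y ^+ 0 <= z by exact: scaleX_le.
have cD : y ^+ 4 * (y * D) <= z.
  by rewrite -[25%N]/(4 + 21)%N exprD ler_pM2l // exprn_gt0.
have z47 : z <= z ^+ 47 by rewrite -[X in X <= _]expr1 ler_weXn2l //; lra.
have z48 : 16 * z ^+ 47 <= z ^+ 48.
  rewrite [z ^+ 48]exprS ler_wpM2r //; last by apply: le_trans (y_le _) => //.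
  by rewrite !exprn_ge0 // ltW.
rewrite expr0 in c0; exact: (error_budget c12 c5).
Qed.

End NearRegular.
End Scales.

(** With x = ln n, a fixed power of n eventually exceeds any affine function of ln n. The proof
    splits the exponential into a square, each factor being at least linear. *)
Lemma expR_ge_affine (R : realType) (c C : R) : 0 < c -> 0 <= C ->
  exists M, forall x, M <= x -> C * x + C <= expR (c * x).
Proof.
move=> c0 C0; exists (1 + 8 * C / c ^+ 2) => x hx.
have k0 : 0 <= C / c ^+ 2 by rewrite divr_ge0 // sqr_ge0.
have x1 : 1 <= x by lra.
have cx : 0 <= c * x / 2 by rewrite divr_ge0 // mulr_ge0 //; [exact: ltW|lra].
apply: le_trans (_ : (c * x / 2) ^+ 2 <= _).
  have h : 8 * C <= c ^+ 2 * x.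
    have e : 8 * C = c ^+ 2 * (8 * C / c ^+ 2) by field; rewrite gt_eqF.
    by rewrite e ler_pM2l ?exprn_gt0 //; lra.
  have h2 : 8 * C * x <= c ^+ 2 * x * x by apply: ler_wpM2r => //; lra.
  have h3 : C * 1 <= C * x by apply: ler_wpM2l.
  by lra.
rewrite [X in expR X](_ : _ = 2%:R * (c * x / 2)); last by field.
rewrite expRM_natl; apply: lerXn2r; rewrite ?nnegrE ?expR_ge0 //.
by have := expR_ge1Dx (c * x / 2); lra.
Qed.

(** These are the exponents in z^61 <= h and z^48 / h <= n^-b for y = n^c and z = y^25; 1600 is
    chosen above both 25 * 61 and 25 * 48. *)
Lemma exponent_budget (R : realFieldType) (b l : R) : 0 < b -> b < 1 / 2 -> 0 <= l ->
  25 * 61 * ((1 / 2 - b) / 1600 * l) <= l / 2 /\ 25 * 48 * ((1 / 2 - b) / 1600 * l) - l / 2 <= - b * l.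
Proof.
move=> b0 b1 l0; have h1 : 0 <= b * l by rewrite mulr_ge0 // ltW.
have h2 : 0 <= (1 / 2 - b) * l by rewrite mulr_ge0 //; lra.
by split; lra.
Qed.

(** Since (1 - 2 lam)^2 = 1 - 4 lam (1 - lam), the density condition bounds 1 / (lam (1 - lam)) by 4
    + 3 al / 2, that is, by O(log n). *)
Lemma density_scale (R : realFieldType) (lam N al y : R) : 0 < lam < 1 -> 0 <= al ->
  (1 - 2 * lam) ^+ 2 / (3 * (1 / 2 * lam * (1 - lam))) <= al -> 2 * al + 4 <= y ->
  N ^+ 2 <= y * (lam * N * (N - lam * N)).
Proof.
move=> /andP[lam0 lam1] al0 dens hy.
have w0 : 0 < lam * (1 - lam) by rewrite mulr_gt0 // subr_gt0.
have -> : y * (lam * N * (N - lam * N)) = lam * (1 - lam) * y * N ^+ 2 by ring.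
rewrite ler_peMl ?sqr_ge0 //.
move: dens; rewrite ler_pdivrMr; last by rewrite mulr_gt0 // -mulrA mulr_gt0.
have : lam * (1 - lam) * (2 * al + 4) <= lam * (1 - lam) * y by rewrite ler_pM2l.
have : 0 <= lam * (1 - lam) * al by rewrite mulr_ge0 // ltW.
lra.
Qed.

Theorem theorem2p8 (R : realType) (a b : R) :
  0 < a -> 0 < b -> a + b < 1 / 2 ->
  exists eps0 : R, 0 < eps0 /\
  forall eps : R, 0 < eps -> eps < eps0 ->
  forall K : R, 0 < K ->
  exists (N : nat) (Cst : R), forall (n : nat) (s t : 'I_n -> nat),
    (N <= n)%N ->
    (forall j, (0 < s j)%N) -> (forall k, (0 < t k)%N) ->
    (\sum_(j < n) s j = \sum_(k < n) t k)%N ->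
    let s0 : R := avg R s in
    let lam : R := s0 / n%:R in
    let A : R := 1 / 2 * lam * (1 - lam) in
    let Rs : R := sqdev s s0 in
    let Ct : R := sqdev t s0 in
    0 < lam < 1 ->
    (forall j, `|(s j)%:R - s0| <= K * (n%:R `^ (1 / 2 + eps))) ->
    (forall k, `|(t k)%:R - s0| <= K * (n%:R `^ (1 / 2 + eps))) ->
    (1 - 2 * lam) ^+ 2 / (3 * A) <= a * ln (n%:R) ->
    exists delta : R, `|delta| <= Cst * (n%:R `^ (- b)) /\
      expected_perm R s t =
        (n`!)%:R * lam ^+ n *
        expR ((1 - lam) / (2 * lam) - (Rs + Ct) / (2 * lam ^+ 2 * (n%:R) ^+ 2) + delta).
Proof.
move=> a0 b0 ab.
pose c := (1 / 2 - b) / 1600.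
have c0 : 0 < c by rewrite /c; lra.
(* For eps < c, n^eps is at most y = n^c; this and K <= y are the two factors y in the deviation h
   y^2. *)
exists c; split=> // eps eps0 epsc K K0.
(* This constant makes y exceed 16, 8 ln n, 2 a ln n + 4 and K at once. *)
have C0 : 0 <= 16 + 2 * a + K by lra.
have [M hM] := expR_ge_affine c0 C0.
exists (Num.truncn (expR M)).+1, 1 => n s t Nn spos tpos st s0 lam A Rs Ct lam01 sD tD dens.
have n0 : 0 < n%:R :> R by rewrite ltr0n; apply: leq_trans Nn.
set l := ln (n%:R) in dens.
have nE : n%:R = expR l by rewrite lnK.
have powE x : n%:R `^ x = expR (x * l) by rewrite /powR gt_eqF.
have Ml : M <= l.
  rewrite -ler_expR -nE; apply: ltW; apply: lt_le_trans (_ : (Num.truncn (expR M)).+1%:R <= _).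
    by have /andP[] := truncn_itv (expR_ge0 M).
  by rewrite ler_nat.
have l0 : 0 <= l by rewrite ln_ge0 // (ler_nat _ 1) (leq_trans _ Nn).
pose y := expR (c * l); pose h := expR (l / 2).
have yC : (16 + 2 * a + K) * l + (16 + 2 * a + K) <= y by exact: hM.
have al0 : 0 <= a * l by rewrite mulr_ge0 // ltW.
have Kl0 : 0 <= K * l by rewrite mulr_ge0 // ltW.
have y16 : 16 <= y by lra.
have h0 : 0 < h by exact: expR_gt0.
have hN : h ^+ 2 = n%:R by rewrite nE /h -expRM_natl; congr expR; field.
have yX k : y ^+ k = expR (k%:R * (c * l)) by rewrite expRM_natl.
have zX (k : nat) : y ^+ 25 ^+ k = expR ((25 * k)%:R * (c * l)) by rewrite -exprM yX.
have b1 : b < 1 / 2 by lra.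
have budget := exponent_budget b0 b1 l0.
have zh : y ^+ 25 ^+ 61 <= h.
  by rewrite zX ler_expR natrM; case: budget.
have lny : 8 * ln (n%:R : R) <= y by rewrite -/l; lra.
have [lam0 lam1] := andP lam01.
have s0E : s0 = lam * n%:R by rewrite /lam; field; rewrite gt_eqF.
have sp : 0 < s0 by rewrite s0E mulr_gt0.
have sN : s0 < n%:R by rewrite s0E gtr_pMl.
have densE : n%:R ^+ 2 <= y * (s0 * (n%:R - s0)).
  have h2 : 2 * (a * l) + 4 <= y by lra.
  by have := density_scale n%:R lam01 al0 dens h2; rewrite -s0E.
have dev (x : R) : `|x - s0| <= K * (n%:R `^ (1 / 2 + eps)) -> `|x - s0| <= h * y ^+ 2.
  move=> hx; apply: (le_trans hx); rewrite powE mulrDl expRD mul1r [2^-1 * l]mulrC -/h mulrCA.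
  rewrite ler_pM2l // expr2; apply: ler_pM; rewrite ?expR_ge0 ?(ltW K0) //.
    by lra.
  by rewrite ler_expR ler_wpM2r // ltW.
have ssum : \sum_j (s j)%:R = n%:R * s0 by rewrite /s0 /avg natr_sum; field; rewrite gt_eqF.
have tsum : \sum_j (t j)%:R = n%:R * s0 by rewrite -ssum -!natr_sum st.
have [d dB ->] := expected_perm_scales y16 h0 hN zh lny sp sN densE (fun i => dev _ (sD i)) (fun i => dev _ (tD i))
  spos tpos ssum tsum.
exists d; split=> //; apply: (le_trans dB).
rewrite mul1r powE zX /h -expRN -expRD ler_expR natrM; case: budget => _; exact.
Qed.
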